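(* Let $\pi_0\in\mathcal S$ and suppose that the (nonrandom) initial empirical measures satisfy $\pi^n(0)\to\pi_0$ in $\mathcal S$ as $n\to\infty$. Then $\pi^n\to\pi$ in probability in $\mathbb D([0,T]:\mathcal S)$, where $\pi$ is the unique solution in $\mathbb C([0,T]:\mathcal S)$ of the ordinary differential equation $\dot\pi(t)=F(\pi(t))$, $\pi(0)=\pi_0$, i.e. of $$\pi(t)=\pi_0+\int_0^tF(\pi(s))\,ds,\qquad t\in[0,T].$$
   Context: **System.** Fix $T\in(0,\infty)$, $\lambda>0$ and integers $1\le k\le L$. For each integer $n\ge L$ consider $n$ servers, each with an infinite capacity queue. Requests arrive according to a Poisson process of rate $n\lambda$; each request selects one of the $\binom nL$ subsets of $L$ servers uniformly at random (independently of everything else) and sends one job to each of the $k$ shortest queues among the $L$ selected ones. Each server processes its queue in first-in-first-out order, with mutually independent exponential service times of mean $1/k$. Let $Q^n_i(t)$ be the length of the $i$-th queue at time $t$ and let $\pi^n(t)=(\pi^n_i(t))_{i\in\mathbb N_0}$, $\pi^n_i(t)=\frac1n\sum_{j=1}^n1_{\{Q^n_j(t)=i\}}$. The initial queue lengths $Q^n(0)$, hence $\pi^n(0)$, are nonrandom. **State space.** $\mathcal S=\{s\in\mathbb R_+^\infty:\sum_{i=0}^\infty s_i=1\}$ (sequences indexed by $\mathbb N_0$), identified with the space of probability measures on $\mathbb N_0$ with the weak topology, metrized by $d_0(\mu,\nu)=\sum_{j\ge0}2^{-j}|\mu_j-\nu_j|$; $\mathcal S_n=\frac1n\mathbb N_0^\infty\cap\mathcal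 S$. $\mathbb D([0,T]:E)$ is the space of right continuous functions with left limits from $[0,T]$ to $E$ with the Skorohod topology; $\mathbb C([0,T]:E)$ is the space of continuous functions with the uniform topology. $\boldsymbol\ell_1$, $\boldsymbol\ell_2$ are the spaces of absolutely summable, respectively square summable, real sequences indexed by $\mathbb N_0$; $e_j$ is the $j$-th unit vector. **Generator.** Equivalently, $\pi^n$ is the continuous time Markov chain on $\mathcal S_n$ with generator $$\mathcal L^nf(r)=\frac{n\lambda}{\binom nL}\sum_{\ell\in\Sigma}\Big(\prod_{i=0}^\infty\binom{nr_i}{\rho_i(\ell)}\Big)\Big[f\big(r+\tfrac1n\Delta_\ell\big)-f(r)\Big]+k\sum_{i=1}^\infty nr_i\Big[f\big(r+\tfrac1n(e_{i-1}-e_i)\big)-f(r)\Big],$$ where $\Sigma=\{\ell\in\mathbb N_0^L:\ell_1\le\dots\le\ell_L\}$, $\rho_i(\ell)=\sum_{j=1}^L1_{\{\ell_j=i\}}$, $\Delta_\ell=\sum_{i=1}^ke_{\ell_i+1}-\sum_{i=1}^ke_{\ell_i}$. **The map $F$.** For $r\in\boldsymbol\ell_1$ (with $r_{-1}:=0$) $$F(r)=\lambda L!\sum_{j=0}^\infty[\bar\zeta(j-1,r)-\bar\zeta(j,r)]e_j+k\sum_{j=0}^\infty[r_{j+1}-r_j]e_j+k\,r_0e_0,$$ $$\bar\zeta(j,r)=\sum_{i_1=0}^{k-1}\frac{\big(\sum_{m=0}^{j-1}r_m\big)^{i_1}}{i_1!}\sum_{i_2=1}^{L-i_1}[i_2\wedge(k-i_1)]\frac{r_j^{i_2}}{i_2!}\frac{\big(\sum_{m=j+1}^\infty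 r_m\big)^{L-i_1-i_2}}{(L-i_1-i_2)!},$$ with $\bar\zeta(-1,r)=0$. Conventions: $0^0=\binom00=0!=1$, $\binom ab=0$ for $a<b$, empty sums are $0$. $F$ maps $\boldsymbol\ell_1$ to $\boldsymbol\ell_1$ and is bounded on $\mathcal S$ in $\boldsymbol\ell_1$ norm; the integral is a Bochner integral. *)

(* Defs.v *)
From mathcomp Require Import all_boot all_order all_algebra.
From mathcomp Require Import all_classical all_reals all_analysis.
Import Order.TTheory GRing.Theory Num.Theory.
Import numFieldNormedType.Exports.

Set Implicit Arguments.
Unset Strict Implicit.
Unset Printing Implicit Defensive.

Local Open Scope classical_set_scope.
Local Open Scope ring_scope.

(* Real sequences indexed by nat are plain functions [nat -> R]. *)

Section StateSpace.
Context {R : realType}.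
Implicit Types (r s : nat -> R) (x y : R -> nat -> R).

Definition simplex : set (nat -> R) :=
  [set s | (forall i, 0 <= s i) /\ series s @ \oo --> (1 : R)].

Definition simplex_n (n : nat) : set (nat -> R) :=
  [set s | simplex s /\ forall i, exists m : nat, s i = m%:R / n%:R].

Definition d0 (r s : nat -> R) : R :=
  \big[+%R/0]_(0 <= j <oo) (2 ^- j * `|r j - s j|).

(* Membership in C([0,T] : S), for a path of which only the values on [0,T]
   matter. *)
Definition continuous_path (T : R) (x : R -> nat -> R) : Prop :=
  forall t : R, 0 <= t <= T ->
    simplex (x t) /\
    d0 (x s) (x t) @[s --> within `[0, T] (nbhs t)] --> (0 : R).

Definition cadlag (x : R -> nat -> R) : Prop :=
  forall t : R, 0 <= t ->
    [/\ simplex (x t),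
        d0 (x s) (x t) @[s --> t^'+] --> (0 : R) &
        0 < t -> exists2 l, simplex l & d0 (x s) l @[s --> t^'-] --> (0 : R)].

(* A strictly increasing surjection of [0,T] onto itself is automatically a
   homeomorphism fixing both end points. *)
Definition time_change (T : R) (h : R -> R) : Prop :=
  {in `[0, T] &, {homo h : s t / s < t}} /\ h @` [set` `[0, T]] = [set` `[0, T]].

(* Skorohod's J1 metric on D([0,T] : S), in the form of Billingsley,
   "Convergence of Probability Measures", Section 12. *)
Definition skorohod (T : R) (x y : R -> nat -> R) : R :=
  inf [set e | exists h : R -> R, time_change T h /\
    forall t : R, 0 <= t <= T -> `|h t - t| <= e /\ d0 (x t) (y (h t)) <= e].

End StateSpace.

Section BochnerIntegral.
Context {R : realType}.
Local Open Scope ereal_scope.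

Definition l1norm (r : nat -> R) : \bar R := \sum_(0 <= j <oo) `|r j|%:E.

Definition step_fun (N : nat) (A : nat -> set R) (c : nat -> nat -> R) (s : R)
    : nat -> R :=
  fun j => (\sum_(0 <= i < N) \1_(A i) s * c i j)%R.

Definition step_int (D : set R) (N : nat) (A : nat -> set R)
    (c : nat -> nat -> R) : nat -> R :=
  fun j => (\sum_(0 <= i < N) fine (lebesgue_measure (D `&` A i)) * c i j)%R.

(* [v] is the l1-valued Bochner integral of [g] over the set [D] of finite
   Lebesgue measure: [g] is the pointwise limit in l1 of simple functions
   [step_fun (N m) (A m) (c m)] which also converge to [g] in mean, and [v] is
   the limit in l1 of their integrals. *)
Definition bochner_integral_l1 (D : set R) (g : R -> nat -> R) (v : nat -> R)
    : Prop :=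
  exists (N : nat -> nat) (A : nat -> nat -> set R)
         (c : nat -> nat -> nat -> R),
    [/\ forall m i, measurable (A m i) /\ l1norm (c m i) < +oo,
        forall s, D s ->
          l1norm (fun j => (g s j - step_fun (N m) (A m) (c m) s j)%R)
            @[m --> \oo] --> 0,
        (\int[lebesgue_measure]_(s in D)
          l1norm (fun j => (g s j - step_fun (N m) (A m) (c m) s j)%R))
            @[m --> \oo] --> 0 &
        l1norm (fun j => (v j - step_int D (N m) (A m) (c m) j)%R)
            @[m --> \oo] --> 0].

End BochnerIntegral.

Section Chain.
Context {R : realType}.
Local Notation state := (nat -> R).

(* The transition semigroup exp(tA) = sum_m t^m A^m / m!; it is used only for
   operators [A] that are bounded in supremum norm on the state space. *)
Definition exp_semigroup (A : (state -> R) -> state -> R) (t : R)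
    (f : state -> R) (r : state) : R :=
  \big[+%R/0]_(0 <= m <oo) (t ^+ m / m`!%:R * iter m A f r).

(* The sigma-algebra generated by the [X u], 0 <= u <= s; the singletons
   suffice because the state space is countable. *)
Definition history {Omega : Type} (X : R -> Omega -> state) (s : R)
    : set (set Omega) :=
  <<s [set B | exists (u : R) r, 0 <= u <= s /\ B = [set w | X u w = r]] >>.

(* [X] is a continuous time Markov chain with right continuous paths with left
   limits, countable state space [E], bounded generator [A] and nonrandom
   initial state [r0]. *)
Definition markov_chain {d} {Omega : measurableType d} (P : probability Omega R)
    (E : set state) (A : (state -> R) -> state -> R) (r0 : state)
    (X : R -> Omega -> state) : Prop :=
  [/\ forall w, X 0 w = r0,
      forall (t : R) w, 0 <= t -> E (X t w),
      forall (t : R) r, 0 <= t -> measurable [set w | X t w = r],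
      forall w, cadlag (fun t => X t w) &
      forall (s t : R) (B : set Omega) (f : state -> R),
        0 <= s -> 0 <= t -> history X s B ->
        (exists M : R, forall r, E r -> `|f r| <= M) ->
        (\int[P]_(w in B) (f (X (s + t) w))%:E =
         \int[P]_(w in B) (exp_semigroup A t f (X s w))%:E)%E].

Section Generator.
Variables (k L : nat) (lambda : R).

Definition rho (i : nat) (l : L.-tuple nat) : nat := count_mem i l.

Definition unit_vec (i j : nat) : R := (i == j)%:R.

Definition Delta (l : L.-tuple nat) (j : nat) : R :=
  \sum_(i < L | (i < k)%N) unit_vec (tnth l i).+1 j
  - \sum_(i < L | (i < k)%N) unit_vec (tnth l i) j.

(* For [r] in [simplex_n n], n * r_i is a natural number, which
   [Num.truncn] merely reads back as an element of [nat]. The product and both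
   sums over infinite index sets have finite support there. *)
Definition generator (n : nat) (f : state -> R) (r : state) : R :=
  n%:R * lambda / 'C(n, L)%:R *
    \sum_(l \in [set l : L.-tuple nat | sorted leq l])
      ((\big[muln/1%N]_(i \in [set: nat])
          'C(Num.truncn (n%:R * r i), rho i l))%:R *
       (f (fun j => r j + n%:R^-1 * Delta l j) - f r))
  + k%:R *
    \sum_(i \in [set i : nat | (0 < i)%N])
      (n%:R * r i *
       (f (fun j => r j + n%:R^-1 * (unit_vec i.-1 j - unit_vec i j)) - f r)).

Definition zeta (j : nat) (r : state) : R :=
  \sum_(0 <= i1 < k)
    ((\sum_(0 <= m < j) r m) ^+ i1 / i1`!%:R *
     \sum_(1 <= i2 < (L - i1).+1)
       ((minn i2 (k - i1))%:R * (r j ^+ i2 / i2`!%:R) *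
        ((\big[+%R/0]_(j.+1 <= m <oo) r m) ^+ (L - i1 - i2) / (L - i1 - i2)`!%:R))).

(* [zeta_pred j] is the paper's zeta(j - 1), with zeta(-1) = 0. *)
Definition zeta_pred (j : nat) (r : state) : R :=
  if j is j'.+1 then zeta j' r else 0.

Definition F (r : state) : state := fun j =>
  lambda * L`!%:R * (zeta_pred j r - zeta j r)
  + k%:R * (r j.+1 - r j) + k%:R * r 0%N * unit_vec 0 j.

End Generator.

(* Solutions in C([0,T] : S) of the integral equation
   x(t) = r0 + int_0^t F(x(s)) ds. *)
Definition ode_solution (k L : nat) (lambda T : R) (r0 : state)
    (x : R -> state) : Prop :=
  continuous_path T x /\
  forall t : R, 0 <= t <= T ->
    bochner_integral_l1 `[0, t] (fun s => F k L lambda (x s))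
      (fun j => x t j - r0 j).

End Chain.

(* Main.v *)
Require Import Defs.
From mathcomp Require Import all_boot all_order all_algebra.
From mathcomp Require Import all_classical all_reals all_analysis.
From mathcomp Require Import measurable_realfun zify ring lra.
Import Order.TTheory GRing.Theory Num.Theory.
Import numFieldNormedType.Exports.

Set Implicit Arguments.
Unset Strict Implicit.
Unset Printing Implicit Defensive.

Local Open Scope classical_set_scope.
Local Open Scope ring_scope.

(* In terms of the cumulative masses [u_j = r_0 + ... + r_(j-1)], the drift of
   [u_j] depends only on [u_(j-1)], [u_j] and [u_(j+1)], and in a Lipschitz way.
   Hence it is controlled by the truncated weighted square distance
   [gap J p a = \sum_(j < J) 2^-j (p_j - a_j)^2], up to a boundary term of order
   [2^-J], without any moment assumption on the initial condition. Along the
   chain, the gap between [X t] and the solution [x t] is therefore a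
   supermartingale up to exponential growth and errors [O(2^-J) + O(1/n)]; a
   first-exit decomposition on dyadic time grids gives a maximal inequality,
   which right continuity extends to all times. Closeness in all the [u_j],
   [j <= J0], gives closeness in [d0], and the identity time change bounds the
   Skorohod distance by the uniform one.

   Solutions are obtained from Euler's scheme, which preserves the simplex for
   small steps because [F_j r >= - K r_j], and converges in l1 because [F] is
   l1-Lipschitz on the simplex. Uniqueness is Gronwall's inequality for the gap
   of two solutions, followed by [J --> oo]. *)

(** * Summable sequences and the field F *)

(** The square in [gap] tames the noise: a transition moves a cumulative mass by [O(1/n)] and the
    total jump rate is [O(n)], so the exact expansion of the square leaves the drift term plus an
    [O(1/n)] remainder at each level, and the weights [2^-j] have total at most 2. The weights
    change only by a factor 2 between neighbouring levels, so the gap itself absorbs the interaction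
    between neighbours. The chain is known through [exp(tA)], where the bound on [A] grows like [n].
    A step of length [h] is expanded to first order in [h], with an error of order [(h n)^2]. This
    dictates the order of the limits: the time grid is refined for fixed [n] and [J], then [n]
    grows, and [J] has been chosen so that the boundary term is already small. A second error comes
    from sampling: the generator counts sets of [L] distinct servers, while [zeta] is the
    multinomial expression for sampling with replacement. These differ by [O(1/n)], uniformly in the
    state. *)

Definition cumul {R : realType} (r : nat -> R) (j : nat) : R :=
  \sum_(0 <= m < j) r m.

(** Bounding all partial sums expresses summability and the norm bound at once, inside the reals;
    [l1norm_le] passes to the extended-real norm. *)
Definition l1le {R : realType} (r : nat -> R) (c : R) : Prop :=
  forall J, \sum_(0 <= j < J) `|r j| <= c.

Section Sequences.
Context {R : realType}.
Implicit Types (r s : nat -> R) (c : R).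

Lemma cumul0 r : cumul r 0 = 0.
Proof. by rewrite /cumul big_nil. Qed.

Lemma cumulS r j : cumul r j.+1 = cumul r j + r j.
Proof. by rewrite /cumul big_nat_recr. Qed.

Lemma cumulB r s j : cumul (fun i => r i - s i) j = cumul r j - cumul s j.
Proof. by rewrite /cumul sumrB. Qed.

Lemma cumul_cvg r : simplex r -> cumul r @ \oo --> (1 : R).
Proof. by case. Qed.

Lemma cumul_nd r : (forall i, 0 <= r i) -> {homo cumul r : i j / (i <= j)%N >-> i <= j}.
Proof.
move=> r0 i j ij; rewrite -(subnK ij) addnC.
elim: (j - i)%N => [|p IH]; first by rewrite addn0.
by rewrite addnS cumulS (le_trans IH)// lerDl.
Qed.

Lemma cumul_le1 r j : simplex r -> cumul r j <= 1.
Proof.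
move=> rS; have c := cumul_cvg rS; rewrite -(cvg_lim _ c)//.
by apply: nondecreasing_cvgn_le; [exact: (cumul_nd rS.1)|apply/cvg_ex; exists 1].
Qed.

Lemma cumul_ge0 r j : simplex r -> 0 <= cumul r j.
Proof. by move=> rS; rewrite -(cumul0 r); exact: (cumul_nd rS.1). Qed.

Lemma simplex_ge0 r j : simplex r -> 0 <= r j.
Proof. by case. Qed.

Lemma simplex_le1 r j : simplex r -> r j <= 1.
Proof.
by move=> rS; rewrite (le_trans _ (cumul_le1 j.+1 rS))// cumulS lerDr cumul_ge0.
Qed.

(** Makes the infinite tail in [zeta] an affine function of a cumulative mass. *)
Lemma simplex_tail r j : simplex r ->
  \big[+%R/0]_(j <= m <oo) r m = 1 - cumul r j.
Proof.
move=> rS; apply: cvg_lim => //.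
have H : cumul r m - cumul r j @[m --> \oo] --> 1 - cumul r j.
  by apply: cvgB; [exact: cumul_cvg|exact: cvg_cst].
 apply: (cvg_trans _ H); apply: near_eq_cvg; near=> m.
have jm : (j <= m)%N by near: m; exact: nbhs_infty_ge.
have : cumul r m = cumul r j + \sum_(j <= i < m) r i by rewrite /cumul (big_cat_nat _ jm).
by move=> /= ->; rewrite addrAC subrr add0r.
Unshelve. all: by end_near. Qed.

Lemma l1le_ge0 r c : l1le r c -> 0 <= c.
Proof. by move=> /(_ 0%N); rewrite big_nil. Qed.

Lemma l1le_trans r c c' : l1le r c -> c <= c' -> l1le r c'.
Proof. by move=> h cc' J; exact: le_trans (h J) cc'. Qed.

Lemma l1le_dom r s c : (forall j, `|r j| <= `|s j|) -> l1le s c -> l1le r c.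
Proof. by move=> rs h J; apply: le_trans (h J); apply: ler_sum. Qed.

Lemma l1leD r s c c' : l1le r c -> l1le s c' -> l1le (fun j => r j + s j) (c + c').
Proof.
move=> h h' J; apply: le_trans (lerD (h J) (h' J)).
by rewrite -big_split/=; apply: ler_sum => j _; exact: ler_normD.
Qed.

Lemma l1leZ r c a : l1le r c -> l1le (fun j => a * r j) (`|a| * c).
Proof.
move=> h J; under eq_bigr do rewrite normrM.
by rewrite -mulr_sumr ler_wpM2l.
Qed.

Lemma l1leN r c : l1le r c -> l1le (fun j => - r j) c.
Proof. by move=> h; apply: l1le_dom h => j; rewrite normrN. Qed.

Lemma l1leB r s c c' : l1le r c -> l1le s c' -> l1le (fun j => r j - s j) (c + c').
Proof. by move=> h h'; apply: l1leD => //; exact: l1leN. Qed.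

Lemma eq_l1le r s c : r =1 s -> l1le r c -> l1le s c.
Proof. by move=> rs; apply: l1le_dom => j; rewrite rs. Qed.

Lemma l1le_sub r s c c' : l1le r c -> r =1 s -> c <= c' -> l1le s c'.
Proof. by move=> h rs cc'; apply: l1le_trans cc'; exact: eq_l1le h. Qed.

Lemma l1le0 c : 0 <= c -> l1le (fun=> 0) c.
Proof. by move=> c0 J; rewrite big1// => i _; rewrite normr0. Qed.

Lemma l1le_coord r c j : l1le r c -> `|r j| <= c.
Proof.
by move=> /(_ j.+1); apply: le_trans; rewrite big_nat_recr//= lerDr sumr_ge0.
Qed.

Lemma l1le_cumul r c j : l1le r c -> `|cumul r j| <= c.
Proof. by move=> /(_ j); apply: le_trans; exact: ler_norm_sum. Qed.

Lemma l1le_simplex r : simplex r -> l1le r 1.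
Proof.
move=> rS J; under eq_bigr do rewrite ger0_norm ?simplex_ge0//.
exact: cumul_le1.
Qed.

(** Fatou's lemma for l1: a partial sum involves finitely many coordinates, so coordinatewise
    convergence suffices. *)
Lemma l1le_cvg (v : nat -> nat -> R) (b : nat -> R) r c :
  (forall m, l1le (v m) (b m)) -> (forall j, v ^~ j @ \oo --> r j) ->
  b @ \oo --> c -> l1le r c.
Proof.
move=> vb vr bc J.
have : \sum_(0 <= j < J) `|v m j| @[m --> \oo] --> \sum_(0 <= j < J) `|r j|.
  elim: J => [|J IH].
    by under eq_fun do rewrite big_nil; rewrite big_nil; exact: cvg_cst.
  under eq_fun do rewrite big_nat_recr//=.
  by rewrite big_nat_recr//=; apply: cvgD => //; apply: cvg_norm; exact: vr.
move=> H; have -> : \sum_(0 <= j < J) `|r j| = lim (\sum_(0 <= j < J) `|v m j| @[m --> \oo]).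
  by rewrite (cvg_lim _ H).
rewrite -(cvg_lim _ bc)//; apply: ler_lim.
- by apply/cvg_ex; eexists; exact: H.
- by apply/cvg_ex; eexists; exact: bc.
- by apply: nearW => m; exact: vb.
Qed.

End Sequences.

Section UnitInterval.
Context {R : realType}.
Implicit Types x y a b c : R.

Lemma dist_mul_unit x y x' y' : 0 <= x <= 1 -> 0 <= y <= 1 ->
  0 <= x' <= 1 -> 0 <= y' <= 1 -> `|x * y - x' * y'| <= `|x - x'| + `|y - y'|.
Proof.
move=> /andP[x0 x1] /andP[y0 y1] /andP[x'0 x'1] /andP[y'0 y'1].
have -> : x * y - x' * y' = (x - x') * y + x' * (y - y') by ring.
rewrite (le_trans (ler_normD _ _))// !normrM lerD//.
  by rewrite ler_piMr// ger0_norm.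
by rewrite ler_piMl// ger0_norm.
Qed.

Lemma expr_unit x n : 0 <= x <= 1 -> 0 <= x ^+ n <= 1.
Proof. by move=> /andP[x0 x1]; rewrite exprn_ge0//= exprn_ile1. Qed.

Lemma mul_unit x y : 0 <= x <= 1 -> 0 <= y <= 1 -> 0 <= x * y <= 1.
Proof. by move=> /andP[x0 x1] /andP[y0 y1]; rewrite mulr_ge0//= mulr_ile1. Qed.

Lemma dist_expr_unit x y n : 0 <= x <= 1 -> 0 <= y <= 1 ->
  `|x ^+ n - y ^+ n| <= n%:R * `|x - y|.
Proof.
move=> xu yu; elim: n => [|n IH]; first by rewrite !expr0 subrr normr0 mul0r.
rewrite !exprS (le_trans (dist_mul_unit xu (expr_unit n xu) yu (expr_unit n yu)))//.
by rewrite -nat1r mulrDl mul1r lerD2l.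
Qed.

End UnitInterval.

(** * The polynomial behind [zeta] *)

Section Zeta.
Context {R : realType} (k L : nat).
Implicit Types a b c : R.

Definition zcoef (i1 i2 : nat) : R :=
  (minn i2 (k - i1))%:R / (i1`!%:R * i2`!%:R * (L - i1 - i2)`!%:R).

(** [zeta j r] as a homogeneous polynomial of degree [L] in the masses below, at and above level
    [j]. *)
Definition zt a b c : R := \sum_(0 <= i1 < k) \sum_(1 <= i2 < (L - i1).+1)
  zcoef i1 i2 * (a ^+ i1 * b ^+ i2 * c ^+ (L - i1 - i2)).

Definition zcst : R := \sum_(0 <= i1 < k) \sum_(1 <= i2 < (L - i1).+1)
  zcoef i1 i2 * L.+1%:R.

Lemma zcoef_ge0 i1 i2 : 0 <= zcoef i1 i2.
Proof. by rewrite /zcoef divr_ge0 ?mulr_ge0. Qed.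

Lemma zcst_ge0 : 0 <= zcst.
Proof.
by rewrite sumr_ge0// => i1 _; rewrite sumr_ge0// => i2 _; rewrite mulr_ge0 ?zcoef_ge0.
Qed.

Lemma zetaE j (r : nat -> R) : simplex r ->
  zeta k L j r = zt (cumul r j) (r j) (1 - cumul r j.+1).
Proof.
move=> rS; rewrite /zeta simplex_tail// /zt; apply: eq_bigr => i1 _.
rewrite mulr_sumr; apply: eq_bigr => i2 _; rewrite /zcoef /cumul !invfM; ring.
Qed.

Lemma zt_ge0 a b c : 0 <= a -> 0 <= b -> 0 <= c -> 0 <= zt a b c.
Proof.
move=> a0 b0 c0; apply: sumr_ge0 => i1 _; apply: sumr_ge0 => i2 _.
by rewrite mulr_ge0 ?zcoef_ge0// !mulr_ge0 ?exprn_ge0.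
Qed.

(** Every monomial contains [b] since [i2 >= 1]. Hence changes of [a] and [c] cost only in
    proportion to [b'], and this weight is what makes the bound summable over the levels in
    [F_lip]. *)
Lemma zt_lip a b c a' b' c' : 0 <= a <= 1 -> 0 <= b <= 1 -> 0 <= c <= 1 ->
    0 <= a' <= 1 -> 0 <= b' <= 1 -> 0 <= c' <= 1 ->
  `|zt a b c - zt a' b' c'| <= zcst * (b' * (`|a - a'| + `|c - c'|) + `|b - b'|).
Proof.
move=> au bu cu a'u b'u c'u; rewrite /zt /zcst -sumrB mulr_suml.
rewrite (le_trans (ler_norm_sum _ _ _))//; apply: ler_sum => i1 _.
rewrite -sumrB mulr_suml (le_trans (ler_norm_sum _ _ _))// !big_nat.
apply: ler_sum => -[//|i2] /andP[_]; rewrite ltnS => i2L.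
rewrite -mulrBr normrM ger0_norm ?zcoef_ge0//.
rewrite -[leRHS]mulrA ler_wpM2l ?zcoef_ge0//.
set p := a ^+ i1 * b ^+ i2 * c ^+ (L - i1 - i2.+1).
set p' := a' ^+ i1 * b' ^+ i2 * c' ^+ (L - i1 - i2.+1).
(* One power of [b] is split off: it contributes the 1 in the factor [L + 1] of [zcst], the
   remaining exponents at most [L]. *)
have -> : a ^+ i1 * b ^+ i2.+1 * c ^+ (L - i1 - i2.+1) -
  a' ^+ i1 * b' ^+ i2.+1 * c' ^+ (L - i1 - i2.+1) = (b - b') * p + b' * (p - p').
  by rewrite /p /p' !exprS; ring.
have pu : 0 <= p <= 1 by rewrite !mul_unit ?expr_unit.
rewrite (le_trans (ler_normD _ _))// (normrM (b - b')) (normrM b') (ger0_norm (_ : 0 <= b')); last by case/andP: b'u.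
have pp' : `|p - p'| <= i1%:R * `|a - a'| + i2%:R * `|b - b'| +
    (L - i1 - i2.+1)%:R * `|c - c'|.
  rewrite (le_trans (dist_mul_unit _ _ _ _)) ?mul_unit ?expr_unit//.
  rewrite lerD ?dist_expr_unit//.
  by rewrite (le_trans (dist_mul_unit _ _ _ _)) ?mul_unit ?expr_unit// lerD ?dist_expr_unit.
have i1L : (i1 <= L)%N.
  by rewrite leqNgt; apply/negP => Li1; move: i2L; rewrite (eqP (ltnW Li1 : (L - i1 == 0)%N)).
have p1 : `|b - b'| * `|p| <= `|b - b'|.
  by rewrite ler_piMr// ger0_norm; case/andP: pu.
have h1 : b' * `|p - p'| <= b' * (L%:R * `|a - a'| + i2%:R * `|b - b'| + L%:R * `|c - c'|).
  rewrite ler_wpM2l//; first by case/andP: b'u.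
  rewrite (le_trans pp')// lerD// ?lerD2r// ler_wpM2r// ler_nat//.
  by rewrite (leq_trans (leq_subr _ _))// leq_subr.
rewrite (le_trans (lerD p1 h1))//.
have : b' * (i2%:R * `|b - b'|) <= L%:R * `|b - b'|.
  rewrite mulrA ler_wpM2r//.
  have : i2%:R <= L%:R :> R by rewrite ler_nat (leq_trans (ltnW i2L))// leq_subr.
  by apply: le_trans; rewrite ler_piMl//; case/andP: b'u.
have : 0 <= b' * `|a - a'| by rewrite mulr_ge0//; case/andP: b'u.
have : 0 <= b' * `|c - c'| by rewrite mulr_ge0//; case/andP: b'u.
by rewrite -natr1; lra.
Qed.

Lemma zt_b0 a c : zt a 0 c = 0.
Proof.
rewrite /zt big1// => i1 _; rewrite big_nat big1// => -[//|i2] _.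
by rewrite exprS !(mul0r, mulr0).
Qed.

Lemma zt_le a b c : 0 <= a <= 1 -> 0 <= b <= 1 -> 0 <= c <= 1 -> zt a b c <= zcst * b.
Proof.
move=> au bu cu; have := @zt_lip a b c a 0 c.
rewrite zt_b0 mul0r add0r !subr0 lexx ler01 => /(_ au bu cu au isT cu).
by rewrite (ger0_norm (_ : 0 <= b)) ?(andP bu).1//; exact/le_trans/ler_norm.
Qed.

End Zeta.

(** * Bounds, Lipschitz continuity and mass conservation for [F] *)

Section DriftField.
Context {R : realType} (k L : nat) (lambda : R) (lambda_ge0 : 0 <= lambda).
Implicit Types r s : nat -> R.
Local Notation F := (F k L lambda).
Local Notation zeta := (zeta k L).
Local Notation zeta_pred := (zeta_pred k L).

(* The drift of the proportion [cumul r j] of queues shorter than [j]. *)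
Definition cdrift (j : nat) (r : nat -> R) : R :=
  if j is 0 then 0 else - (lambda * L`!%:R * zeta_pred j r) + k%:R * r j.

(** Both flows telescope; the extra term at level 0 cancels the departures that empty queues would
    otherwise be charged with. *)
Lemma cumul_F r j : cumul (F r) j = cdrift j r.
Proof.
elim: j => [|j IH]; first by rewrite cumul0.
rewrite cumulS IH /Defs.F /cdrift; case: j {IH} => [|j] /=.
  by rewrite /unit_vec eqxx /=; ring.
by rewrite /unit_vec /=; ring.
Qed.

(** One generous constant for every estimate on [F] and [cdrift]: l1 bound, Lipschitz constant and
    outflow rate. The 2 counts [zeta_pred] and [zeta], the [3 * k] the shift, the diagonal and the
    term at 0, and the [3 * zcst] is what [F_lip] requires. *)
Definition Fcst : R := 2 * lambda * L`!%:R * (3 * @zcst R k L) + 3 * k%:R.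

Lemma unit_coords r j : simplex r ->
  [/\ 0 <= cumul r j <= 1, 0 <= r j <= 1 & 0 <= 1 - cumul r j <= 1].
Proof.
move=> rS; have := cumul_le1 j rS; have := cumul_ge0 j rS.
have := simplex_ge0 j rS; have := simplex_le1 j rS.
by split; apply/andP; split => //; lra.
Qed.

Lemma zeta_ge0 r j : simplex r -> 0 <= zeta j r.
Proof.
move=> rS; rewrite zetaE//; have [/andP[h1 _] /andP[h2 _] _] := unit_coords j rS.
by have [_ _ /andP[h3 _]] := unit_coords j.+1 rS; exact: zt_ge0.
Qed.

Lemma zeta_le r j : simplex r -> zeta j r <= @zcst R k L * r j.
Proof.
move=> rS; rewrite zetaE//; have [? ? _] := unit_coords j rS.
by have [_ _ ?] := unit_coords j.+1 rS; exact: zt_le.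
Qed.

Lemma zeta_lip r s j : simplex r -> simplex s ->
  `|zeta j r - zeta j s| <= @zcst R k L * (s j * (`|cumul r j - cumul s j| +
     `|cumul r j.+1 - cumul s j.+1|) + `|r j - s j|).
Proof.
move=> rS sS; rewrite !zetaE//.
have [? ? _] := unit_coords j rS; have [_ _ ?] := unit_coords j.+1 rS.
have [? ? _] := unit_coords j sS; have [_ _ ?] := unit_coords j.+1 sS.
rewrite (le_trans (zt_lip _ _ _ _ _ _ _ _))//.
suff -> : `|1 - cumul r j.+1 - (1 - cumul s j.+1)| = `|cumul r j.+1 - cumul s j.+1| by [].
by rewrite -normrN; congr `|_|; ring.
Qed.

Lemma l1le_shift r c : l1le r c -> l1le (fun j => r j.+1) c.
Proof.
move=> h J; apply: le_trans (h J.+1).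
by rewrite [leRHS]big_nat_recl// lerDr.
Qed.

Lemma l1le_zeta_pred (z : nat -> R) c : l1le z c ->
  l1le (fun j => if j is j'.+1 then z j' else 0) c.
Proof.
move=> h [|J]; first by rewrite big_nil (l1le_ge0 h).
by rewrite big_nat_recl//= normr0 add0r.
Qed.

Lemma l1le_unit0 c (a : R) : `|a| <= c -> l1le (fun j => a * unit_vec 0 j) c.
Proof.
move=> ac [|J]; first by rewrite big_nil (le_trans _ ac).
rewrite big_nat_recl//= /unit_vec eqxx mulr1 big1 ?addr0// => j _.
by rewrite mulr0 normr0.
Qed.

(** [F] is linear in the pair of sequences [zeta] and [r]; keeping both abstract covers [F r] and
    also the difference [F r - F s]. *)
Lemma F_shape_l1 (z r : nat -> R) c c' : 0 <= lambda -> l1le z c -> l1le r c' ->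
  l1le (fun j => lambda * L`!%:R * ((if j is j'.+1 then z j' else 0) - z j)
     + k%:R * (r j.+1 - r j) + k%:R * r 0%N * unit_vec 0 j)
     (2 * lambda * L`!%:R * c + 3 * k%:R * c').
Proof.
move=> l0 zc rc.
have -> : 2 * lambda * L`!%:R * c + 3 * k%:R * c' = `|lambda * L`!%:R| * (c + c) +
   `|k%:R| * (c' + c') + k%:R * c'.
  by rewrite !ger0_norm ?mulr_ge0//; ring.
apply: l1leD; [apply: l1leD|].
- by apply: l1leZ; apply: l1leB => //; exact: l1le_zeta_pred.
- by apply: l1leZ; apply: l1leB => //; exact: l1le_shift.
- by apply: l1le_unit0; rewrite normrM ger0_norm// ler_wpM2l//; exact: l1le_coord.
Qed.

Lemma F_bound r : simplex r -> l1le (F r) Fcst.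
Proof.
move=> rS.
have h : l1le (zeta ^~ r) (@zcst R k L).
  have := l1leZ (@zcst R k L) (l1le_simplex rS); rewrite mulr1 (ger0_norm (zcst_ge0 _ _)).
  apply: l1le_dom => j; rewrite ger0_norm ?zeta_ge0//.
  by rewrite (le_trans (zeta_le _ _))// ler_norm.
apply: l1le_trans (F_shape_l1 lambda_ge0 h (l1le_simplex rS)) _.
rewrite /Fcst mulr1 lerD2r// ler_wpM2l ?mulr_ge0//.
by have := @zcst_ge0 R k L; lra.
Qed.

(** Each cumulative distance is at most [c], which alone would not be summable; the weights [s j] in
    [zeta_lip] have total at most 1, so the two cumulative distances cost [2 c] altogether and the
    coordinates a further [c]. *)
Lemma F_lip r s c : simplex r -> simplex s -> l1le (fun j => r j - s j) c ->
  l1le (fun j => F r j - F s j) (Fcst * c).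
Proof.
move=> rS sS rs.
have c0 := l1le_ge0 rs.
have h : l1le (fun j => zeta j r - zeta j s) (3 * @zcst R k L * c).
  have -> : 3 * @zcst R k L * c = `|@zcst R k L| * (`|2 * c| * 1 + c).
    by rewrite ger0_norm ?zcst_ge0// ger0_norm ?mulr_ge0//; ring.
  have := l1leZ (@zcst R k L) (l1leD (l1leZ (2 * c) (l1le_simplex sS)) (l1le_dom (s := fun j => r j - s j) (r := fun j => `|r j - s j|) _ rs)).
  move=> /(_ (fun j => _)) H; apply: l1le_dom (H _) => j; last by rewrite normr_id.
  apply: le_trans (zeta_lip _ _ _) _ => //; apply: le_trans (ler_norm _).
  rewrite ler_wpM2l ?zcst_ge0// lerD2r mulrC ler_wpM2r ?simplex_ge0//.
  by rewrite mulr2n mulrDl !mul1r lerD// -cumulB l1le_cumul.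
have := F_shape_l1 lambda_ge0 h rs.
have -> : 2 * lambda * L`!%:R * (3 * zcst k L * c) + 3 * k%:R * c = Fcst * c.
  by rewrite /Fcst; ring.
apply: eq_l1le => j; rewrite /Defs.F; case: j => [|j] /=; ring.
Qed.

Lemma Fcst_ge0 : 0 <= Fcst.
Proof. by rewrite /Fcst addr_ge0 ?mulr_ge0// zcst_ge0. Qed.

(** The inflow into level [j] is nonnegative, and the outflow is at most proportional to [r j] by
    [zeta_le]. *)
Lemma F_ge r j : simplex r -> - (Fcst * r j) <= F r j.
Proof.
move=> rS; rewrite /Defs.F.
have h0 : 0 <= zeta_pred j r by case: j => //= j; exact: zeta_ge0.
have h1 : lambda * L`!%:R * zeta j r <= lambda * L`!%:R * (@zcst R k L * r j).
  by rewrite ler_wpM2l ?mulr_ge0// zeta_le.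
have h2 : 0 <= lambda * L`!%:R * zeta_pred j r by rewrite !mulr_ge0.
have h3 : 0 <= k%:R * r j.+1 by rewrite mulr_ge0// simplex_ge0.
have h4 : 0 <= k%:R * r 0%N * unit_vec 0 j by rewrite !mulr_ge0// simplex_ge0.
have h5 : 0 <= lambda * L`!%:R * (@zcst R k L * r j).
  by rewrite !mulr_ge0 ?zcst_ge0// simplex_ge0.
have h6 : 0 <= k%:R * r j by rewrite mulr_ge0// simplex_ge0.
rewrite /Fcst; lra.
Qed.

Lemma simplex_cvg0 r : simplex r -> r @ \oo --> (0 : R).
Proof.
move=> rS; apply: cvg_series_cvg_0; apply/cvg_ex; exists 1.
exact: rS.2.
Qed.

(** The partial sum is the net flux across one level, bounded by a multiple of the masses next to
    it, which tend to 0. So [F] has total mass 0 and an Euler step keeps the sum equal to 1. *)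
Lemma cumul_F_cvg r : simplex r -> cumul (F r) @ \oo --> (0 : R).
Proof.
move=> rS; apply/cvgrPdist_le => e e0.
pose g := Fcst + 1.
have g0 : 0 < g by rewrite ltr_wpDl ?Fcst_ge0.
have /cvgrPdist_le/(_ (e / g)) := simplex_cvg0 rS.
rewrite divr_gt0// => /(_ isT)[N _ hN]; exists N.+1 => // -[//|j] /= Nj.
rewrite sub0r normrN cumul_F /=.
have a1 := hN j Nj; have a2 := hN j.+1 (leqW Nj).
rewrite /= !sub0r !normrN !ger0_norm ?simplex_ge0// in a1 a2.
have h1 : lambda * L`!%:R * zeta j r <= lambda * L`!%:R * (@zcst R k L * r j).
  by rewrite ler_wpM2l ?mulr_ge0// zeta_le.
have h2 : 0 <= lambda * L`!%:R * zeta j r by rewrite !mulr_ge0// zeta_ge0.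
have h6 : 0 <= k%:R * r j.+1 by rewrite mulr_ge0// simplex_ge0.
have h3 : lambda * L`!%:R * (@zcst R k L * r j) <= lambda * L`!%:R * (@zcst R k L * (e / g)).
  by rewrite ler_wpM2l ?mulr_ge0// ler_wpM2l ?zcst_ge0.
have h4 : k%:R * r j.+1 <= k%:R * (e / g) by rewrite ler_wpM2l.
have eg : 0 <= e / g by rewrite divr_ge0 ?ltW.
have h5 : 0 <= lambda * L`!%:R * (@zcst R k L * (e / g)).
  by apply: mulr_ge0; [exact: mulr_ge0|exact: mulr_ge0 (zcst_ge0 _ _) eg].
have h7 : 0 <= k%:R * (e / g) by rewrite mulr_ge0.
have <- : g * (e / g) = e by rewrite mulrCA divff ?mulr1 ?gt_eqF.
by rewrite ler_norml /g /Fcst; lra.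
Qed.

End DriftField.

(** * Euler's scheme *)

Section Euler.
Context {R : realType} (F : (nat -> R) -> nat -> R) (K : R).
Hypothesis K_ge0 : 0 <= K.
Hypothesis F_bd : forall r, simplex r -> l1le (F r) K.
Hypothesis F_lp : forall r s c, simplex r -> simplex s ->
  l1le (fun j => r j - s j) c -> l1le (fun j => F r j - F s j) (K * c).
Hypothesis F_low : forall r j, simplex r -> - (K * r j) <= F r j.
Hypothesis F_null : forall r, simplex r -> cumul (F r) @ \oo --> (0 : R).
Implicit Types (r s : nat -> R) (h D t : R).

Definition euler h r : nat -> R := fun j => r j + h * F r j.

Lemma euler_simplex h r : 0 <= h -> h * K <= 1 -> simplex r -> simplex (euler h r).
Proof.
move=> h0 hK rS; split.
  move=> j; rewrite /euler.
  have : h * - (K * r j) <= h * F r j by rewrite ler_wpM2l// F_low.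
  have : h * K * r j <= 1 * r j by rewrite ler_wpM2r// simplex_ge0.
  by rewrite mul1r mulrN mulrA; lra.
have -> : series (euler h r) = (fun J => cumul r J + h * cumul (F r) J).
  by apply/funext => J; rewrite /series/= /euler big_split/= mulr_sumr.
rewrite -[X in _ --> X]addr0 -[X in _ + X](mulr0 h).
apply: cvgD; first exact: cumul_cvg.
by apply: cvgM; [exact: cvg_cst|exact: F_null].
Qed.

Lemma iter_euler_simplex h r i : 0 <= h -> h * K <= 1 -> simplex r ->
  simplex (iter i (euler h) r).
Proof. by move=> h0 hK rS; elim: i => //= i IH; exact: euler_simplex. Qed.

Lemma iter_euler_dist h r i p : 0 <= h -> h * K <= 1 -> simplex r ->
  l1le (fun j => iter (p + i) (euler h) r j - iter i (euler h) r j) (p%:R * (h * K)).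
Proof.
move=> h0 hK rS; elim: p => [|p IH].
  by apply: (@eq_l1le _ (fun=> 0)); [move=> j; rewrite subrr|apply: l1le0; rewrite mul0r].
rewrite addSn -natr1 mulrDl mul1r.
have := l1leD IH (l1leZ h (F_bd (iter_euler_simplex (p + i) h0 hK rS))).
rewrite (ger0_norm h0); apply: eq_l1le => j; rewrite /= /euler; ring.
Qed.

(** One step of size [h] against two of size [h / 2]. The initial distance grows by [1 + h K]; the
    only new error is that the second half step evaluates [F] at a point moved by at most
    [h K / 2]. *)
Lemma euler_refine_step h r s D : 0 <= h -> h * K <= 1 -> simplex r -> simplex s ->
  l1le (fun j => r j - s j) D ->
  l1le (fun j => euler h r j - euler (h / 2) (euler (h / 2) s) j)
    ((1 + h * K) * D + (h * K) ^+ 2).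
Proof.
move=> h0 hK rS sS rs.
have h20 : 0 <= h / 2 by rewrite divr_ge0.
have hK0 : 0 <= h * K by exact: mulr_ge0.
have s'S : simplex (euler (h / 2) s) by apply: euler_simplex => //; lra.
have d1 : l1le (fun j => s j - euler (h / 2) s j) (h / 2 * K).
  have := l1leZ (- (h / 2)) (F_bd sS).
  by rewrite normrN (ger0_norm h20); apply: eq_l1le => j; rewrite /euler; ring.
have := l1leD (l1leD rs (l1leZ h (F_lp rS sS rs))) (l1leZ (h / 2) (F_lp sS s'S d1)).
move=> H; apply: (l1le_sub H) => [j|].
  by rewrite /euler; field.
rewrite !ger0_norm//.
have : h / 2 * (K * (h / 2 * K)) = (h * K) ^+ 2 / 4 by field.
by have := sqr_ge0 (h * K); lra.
Qed.

Lemma euler_refine h r i : 0 <= h -> h * K <= 1 -> simplex r ->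
  l1le (fun j => iter i (euler h) r j - iter i.*2 (euler (h / 2)) r j)
    (i%:R * (h * K) ^+ 2 * expR (i%:R * (h * K))).
Proof.
move=> h0 hK rS.
have hK0 : 0 <= h * K by exact: mulr_ge0.
elim: i => [|i IH].
  by apply: (@eq_l1le _ (fun=> 0)); [move=> j; rewrite subrr|apply: l1le0; rewrite !mul0r].
rewrite doubleS !iterS.
have h2 : h / 2 * K <= 1 by lra.
apply: l1le_trans (euler_refine_step h0 hK _ _ IH) _.
- exact: iter_euler_simplex.
- by apply: iter_euler_simplex => //; rewrite divr_ge0.
set q := (h * K) ^+ 2; set e := expR (i%:R * (h * K)).
have -> : expR (i.+1%:R * (h * K)) = expR (h * K) * e.
  by rewrite -expRD -nat1r mulrDl mul1r.
have q0 : 0 <= q by exact: sqr_ge0.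
have e1 : 1 <= e by rewrite -[1]expR0 ler_expR mulr_ge0.
have := expR_ge1Dx (h * K); set E := expR (h * K) => hE.
have i0 : 0 <= i%:R * q * e by rewrite !mulr_ge0// (le_trans _ e1).
rewrite -natr1 !mulrDl mul1r lerD//.
  rewrite (_ : i%:R * q * (E * e) = E * (i%:R * q * e)); last by ring.
  by rewrite -[X in X + _]mul1r -mulrDl ler_wpM2r.
rewrite mul1r ler_peMr// (le_trans e1)// ler_peMl//; first exact: le_trans e1.
by rewrite (le_trans _ hE)// lerDl.
Qed.

Context (T : R) (T_ge0 : 0 <= T) (r0 : nat -> R) (r0_simplex : simplex r0).

(* The factor [(K + 1)^-1] makes every step small enough for [euler_simplex]. *)
Definition mesh (m : nat) : R := (K + 1)^-1 / 2 ^+ m.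

Definition epath (m : nat) (t : R) : nat -> R :=
  iter (Num.truncn (t / mesh m)) (euler (mesh m)) r0.

(** The first term accumulates the refinement errors up to time [T]; the second pays for the half
    step by which the truncated step counts of two consecutive levels can differ. *)
Definition erate : R := (T * K ^+ 2 * expR (T * K) + K).

Lemma mesh_gt0 m : 0 < mesh m.
Proof. by rewrite divr_gt0// ?exprn_gt0// invr_gt0 ltr_wpDl. Qed.

Lemma meshS m : mesh m.+1 = mesh m / 2.
Proof. by rewrite /mesh exprS; field; rewrite expf_neq0//= gt_eqF// ltr_wpDl. Qed.

Lemma mesh_cvg : mesh m @[m --> \oo] --> (0 : R).
Proof.
rewrite -(mulr0 (K + 1)^-1); apply: cvgM; first exact: cvg_cst.
under eq_fun do rewrite -exprVn.
by apply: cvg_expr; rewrite ger0_norm ?invr_ge0// invf_lt1// ltr1n.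
Qed.

Lemma mesh_K m : mesh m * K <= 1.
Proof.
rewrite /mesh mulrAC ler_pdivrMr ?exprn_gt0// mul1r mulrC ler_pdivrMr ?ltr_wpDl//.
have : 1 <= 2 ^+ m :> R by rewrite exprn_ege1// ler1n.
by move=> h; rewrite (@le_trans _ _ (1 * (K + 1)))// ?mul1r ?lerDl//; rewrite ler_peMl// addr_ge0.
Qed.

Lemma epath_simplex m t : simplex (epath m t).
Proof. by apply: iter_euler_simplex => //; [exact/ltW/mesh_gt0|exact: mesh_K]. Qed.

Lemma erate_ge0 : 0 <= erate.
Proof. by rewrite /erate addr_ge0// !mulr_ge0 ?sqr_ge0 ?expR_ge0. Qed.

Lemma erate_mesh_ge0 m : 0 <= 2 * erate * mesh m.
Proof. exact: mulr_ge0 (mulr_ge0 (ler0n _ 2) erate_ge0) (ltW (mesh_gt0 m)). Qed.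

Lemma trunc_mesh m t : 0 <= t ->
  (Num.truncn (t / mesh m))%:R * mesh m <= t < (Num.truncn (t / mesh m)).+1%:R * mesh m.
Proof.
move=> t0; have := truncn_itv (divr_ge0 t0 (ltW (mesh_gt0 m))).
by rewrite ler_pdivlMr ?mesh_gt0// ltr_pdivrMr ?mesh_gt0.
Qed.

Lemma trunc_double (y : R) : 0 <= y ->
  Num.truncn (2 * y) = ((2 * y - (Num.truncn y).*2%:R >= 1)%R + (Num.truncn y).*2)%N.
Proof.
move=> y0; have /andP[] := truncn_itv y0; set i := Num.truncn y => h1 h2.
apply: truncn_def; rewrite -natr1 !natrD -muln2 natrM; case: (leP 1) => /= h3.
  by rewrite -natr1 in h2; apply/andP; split; lra.
by rewrite -natr1 in h2; apply/andP; split; lra.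
Qed.

Lemma epath_refine m t : 0 <= t <= T ->
  l1le (fun j => epath m t j - epath m.+1 t j) (erate * mesh m).
Proof.
move=> /andP[t0 tT]; rewrite /epath meshS.
have m0 := mesh_gt0 m.
have -> : t / (mesh m / 2) = 2 * (t / mesh m) by field; rewrite gt_eqF.
rewrite trunc_double; last by rewrite divr_ge0// ltW.
have /andP[] := trunc_mesh m t0; set i := Num.truncn _ => h1 h2.
set b := nat_of_bool _; have b1 : (b <= 1)%N by rewrite /b; case: (_ <= _).
have mm0 : 0 <= mesh m / 2 by rewrite divr_ge0// ltW.
have mmK : mesh m / 2 * K <= 1.
  by have := mesh_K m; have := mulr_ge0 (ltW m0) K_ge0; lra.
have a1 := euler_refine i (ltW m0) (mesh_K m) r0_simplex.
have a2 := iter_euler_dist i.*2 b mm0 mmK r0_simplex.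
have := l1leB a1 a2.
move=> H; apply: (l1le_sub H).
  by move=> j; ring.
rewrite /erate mulrDl lerD//.
  have iT : i%:R * mesh m <= T by exact: le_trans tT.
  rewrite (_ : T * K ^+ 2 * expR (T * K) * mesh m =
    (T * (mesh m * K ^+ 2)) * expR (T * K)); last by ring.
  rewrite (_ : i%:R * (mesh m * K) ^+ 2 = i%:R * mesh m * (mesh m * K ^+ 2)); last by ring.
  apply: ler_pM; rewrite ?expR_ge0//.
  - exact: mulr_ge0 (mulr_ge0 _ (ltW m0)) (mulr_ge0 (ltW m0) (sqr_ge0 K)).
  - by apply: ler_wpM2r => //; exact: mulr_ge0 (ltW m0) (sqr_ge0 K).
  - by rewrite ler_expR mulrA ler_wpM2r.
have bb : b%:R <= 1 :> R by rewrite lern1.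
apply: le_trans (_ : 1 * (mesh m / 2 * K) <= _); first by rewrite ler_wpM2r// mulr_ge0.
by have := mulr_ge0 (ltW m0) K_ge0; lra.
Qed.

(** The right-hand side is the summed geometric series of the bounds in [epath_refine]; the exact
    difference makes the induction close. *)
Lemma epath_cauchy m p t : 0 <= t <= T ->
  l1le (fun j => epath m t j - epath (m + p) t j) (2 * erate * (mesh m - mesh (m + p))).
Proof.
move=> tT; elim: p => [|p IH].
  rewrite addn0 subrr mulr0.
  by apply: (@eq_l1le _ (fun=> 0)); [move=> j; rewrite subrr|exact: l1le0].
have := l1leD IH (epath_refine (m + p) tT); rewrite addnS meshS.
move=> H; by apply: (l1le_sub H) => [j|]; [ring|rewrite (_ : _ + _ = 2 * erate * (mesh m - mesh (m + p) / 2))//; field].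
Qed.

Lemma epath_is_cvg t j : 0 <= t <= T -> cvgn (fun m => epath m t j).
Proof.
move=> tT.
(* Adding the remaining error budget makes the sequence nonincreasing, so monotone convergence
   yields the limit. *)
have nd : {homo (fun m => epath m t j + 2 * erate * mesh m) : n m / (n <= m)%N >-> m <= n}.
  move=> n m nm; have := l1le_coord j (epath_cauchy n (m - n) tT).
  by rewrite subnKC// ler_norml => /andP[h _]; lra.
have lb : has_lbound (range (fun m => epath m t j + 2 * erate * mesh m)).
  exists 0 => _ [m _ <-]; apply: addr_ge0 (erate_mesh_ge0 m).
  exact: simplex_ge0 (epath_simplex _ _).
have /cvg_ex[/= l hl] := nonincreasing_is_cvgn nd lb.
apply/cvg_ex; exists (l - 2 * erate * 0).
have -> : (fun m => epath m t j) =
   (fun m => (epath m t j + 2 * erate * mesh m) - 2 * erate * mesh m).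
  by apply/funext => m; ring.
by apply: cvgB => //; apply: cvgM; [exact: cvg_cst|exact: mesh_cvg].
Qed.

Definition flow (t : R) : nat -> R := fun j => lim (epath m t j @[m --> \oo]).

Lemma epath_flow m t : 0 <= t <= T ->
  l1le (fun j => epath m t j - flow t j) (2 * erate * mesh m).
Proof.
move=> tT.
apply: (@l1le_cvg _ (fun p j => epath m t j - epath (m + p) t j)
  (fun=> 2 * erate * mesh m)) => [p|j|]; last exact: cvg_cst.
- apply: l1le_trans (epath_cauchy m p tT) _.
  by apply: ler_wpM2l; [rewrite mulr_ge0 ?erate_ge0|rewrite gerBl ltW ?mesh_gt0].
- apply: cvgB; first exact: cvg_cst.
  have : epath p t j @[p --> \oo] --> flow t j by exact: epath_is_cvg.
  rewrite -(cvg_shiftn m); apply: cvg_trans; apply: near_eq_cvg; near=> p.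
  by rewrite /= addnC.
Unshelve. all: by end_near. Qed.

Lemma erate_mesh_cvg (c : R) : c * mesh m @[m --> \oo] --> (0 : R).
Proof. by rewrite -(mulr0 c); apply: cvgM; [exact: cvg_cst|exact: mesh_cvg]. Qed.

(** A coordinatewise limit could lose mass at infinity; the l1 distance to [epath m] prevents it. *)
Lemma flow_simplex t : 0 <= t <= T -> simplex (flow t).
Proof.
move=> tT; split.
  move=> j; apply: limr_ge; first exact: epath_is_cvg.
  by apply: nearW => m; exact: simplex_ge0 (epath_simplex _ _).
apply/cvgrPdist_le => e e0.
have e2 : 0 < e / 2 by rewrite divr_gt0.
have /cvgrPdist_le/(_ _ e2)[m _ /(_ m (leqnn m))] := erate_mesh_cvg (2 * erate).
rewrite /= sub0r normrN => hm.
have /cvgrPdist_le/(_ _ e2)[N _ hN] := cumul_cvg (epath_simplex m t).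
exists N => // J NJ.
have := hN J NJ; rewrite /= !ler_norml.
have := l1le_cumul J (epath_flow m tT); rewrite cumulB ler_norml => /andP[h1 h2].
move: hm; rewrite ler_norml => /andP[h3 h4] /andP[h5 h6].
change (series (flow t) J) with (cumul (flow t) J).
by apply/andP; split; lra.
Qed.

Lemma flow0 : flow 0 = r0.
Proof.
apply/funext => j; rewrite /flow; apply: cvg_lim => //.
under eq_fun do rewrite /epath mul0r truncn0 /=.
exact: cvg_cst.
Qed.

(** After [p] further steps the iterate is within [p h K] of [s], so freezing [F] at [s] costs at
    most [h K] times that in the next step. *)
Lemma iter_euler_drift h r i p : 0 <= h -> h * K <= 1 -> simplex r ->
  l1le (fun j => iter (p + i) (euler h) r j - iter i (euler h) r j
     - p%:R * h * F (iter i (euler h) r) j) ((p%:R * (h * K)) ^+ 2).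
Proof.
move=> h0 hK rS; set s := iter i _ r.
have hK0 : 0 <= h * K by exact: mulr_ge0.
have sS : simplex s by exact: iter_euler_simplex.
elim: p => [|p IH].
  by apply: (@eq_l1le _ (fun=> 0)); [move=> j; rewrite /s; ring|apply: l1le0; rewrite sqr_ge0].
have d := F_lp (iter_euler_simplex (p + i) h0 hK rS) sS (iter_euler_dist i p h0 hK rS).
have := l1leD IH (l1leZ h d).
move=> H; apply: (l1le_sub H) => [j|].
  by rewrite addSn iterS -natr1 /euler -/s; ring.
rewrite ger0_norm// (_ : h * (K * (p%:R * (h * K))) = p%:R * (h * K) ^+ 2); last by ring.
rewrite !(exprMn 2 _ (h * K)) -mulrDl ler_wpM2r ?sqr_ge0// -natr1.
have : 0 <= p%:R :> R by [].
by rewrite sqrrD; lra.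
Qed.

(** This quadratic remainder is the form in which the flow is used afterwards: it yields the Bochner
    integral through Riemann sums and the comparison with the chain. *)
Lemma flow_drift t h : 0 <= t -> 0 <= h -> t + h <= T ->
  l1le (fun j => flow (t + h) j - flow t j - h * F (flow t) j) ((K * h) ^+ 2).
Proof.
move=> t0 h0 thT.
have tT : 0 <= t <= T by apply/andP; split=> //; lra.
have th : 0 <= t + h <= T by apply/andP; split=> //; lra.
pose b m : R := ((h + mesh m) * K) ^+ 2 + mesh m * K + 2 * erate * mesh m +
  2 * erate * mesh m + h * (K * (2 * erate * mesh m)).
apply: (@l1le_cvg _ (fun=> (fun j => flow (t + h) j - flow t j - h * F (flow t) j)) b).
- move=> m; have e0 := mesh_gt0 m.
  pose i := Num.truncn (t / mesh m); pose i' := Num.truncn ((t + h) / mesh m).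
  have /andP[a1 a2] := trunc_mesh m t0.
  have /andP[a3 a4] := @trunc_mesh m (t + h) (addr_ge0 t0 h0).
  rewrite -/i -/i' -!natr1 in a1 a2 a3 a4.
  have ii' : (i <= i')%N.
    by apply: le_truncn; rewrite ler_wpM2r ?invr_ge0 ?(ltW e0)// lerDl.
  pose p := (i' - i)%N; have pE : i' = (p + i)%N by rewrite subnK.
  have ph : `|p%:R * mesh m - h| <= mesh m.
    by rewrite pE natrD in a3 a4; rewrite ler_norml; apply/andP; split; lra.
  have c1 := iter_euler_drift i p (ltW e0) (mesh_K m) r0_simplex.
  rewrite -pE in c1.
  have c2 := l1leZ (p%:R * mesh m - h) (F_bd (epath_simplex m t)).
  have c3 := epath_flow m th.
  have c4 := epath_flow m tT.
  have c5 := l1leZ h (F_lp (epath_simplex m t) (flow_simplex tT) c4).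
  have := l1leD (l1leD (l1leB (l1leD c1 c2) c3) c4) c5.
  move=> H; apply: (l1le_sub H) => [j|].
    by rewrite /epath -/i -/i'; ring.
  rewrite /b (ger0_norm h0) !lerD//; last by rewrite ler_wpM2r.
  rewrite mulrA; apply: lerXn2r; rewrite ?nnegrE.
  + exact: mulr_ge0 (mulr_ge0 (ler0n _ _) (ltW e0)) K_ge0.
  + exact: mulr_ge0 (addr_ge0 h0 (ltW e0)) K_ge0.
  + by rewrite ler_wpM2r//; move: ph; rewrite ler_norml => /andP[_]; lra.
- by move=> j; exact: cvg_cst.
- have -> : (K * h) ^+ 2 = ((h + 0) * K) ^+ 2 + 0 * K + 2 * erate * 0 +
    2 * erate * 0 + h * (K * (2 * erate * 0)) by ring.
  have c c' : c' * mesh m @[m --> \oo] --> c' * 0.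
    by apply: cvgM; [exact: cvg_cst|exact: mesh_cvg].
  apply: cvgD; last first.
    by apply: cvgM; [exact: cvg_cst|apply: cvgM; [exact: cvg_cst|exact: c]].
  apply: cvgD; last exact: c.
  apply: cvgD; last exact: c.
  apply: cvgD; last by apply: cvgM; [exact: mesh_cvg|exact: cvg_cst].
  apply: cvgM; apply: cvgM; try exact: cvg_cst;
    by apply: cvgD; [exact: cvg_cst|exact: mesh_cvg].
Qed.

End Euler.

(** * Bochner integrals of Lipschitz paths *)

Section SequenceNorms.
Context {R : realType}.
Implicit Types (r s : nat -> R) (c : R).

Lemma l1norm_ge0 r : (0 <= l1norm r)%E.
Proof. by apply: nneseries_ge0 => j _ _; rewrite lee_fin. Qed.

Lemma l1norm_le r c : l1le r c -> (l1norm r <= c%:E)%E.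
Proof.
move=> rc; apply: lime_le; first by apply: is_cvg_nneseries => j _ _; rewrite lee_fin.
by apply: nearW => J; rewrite sumEFin lee_fin.
Qed.

Lemma l1norm_coord r j : (`|r j|%:E <= l1norm r)%E.
Proof.
apply: le_trans (nneseries_lim_ge (P := xpredT) (m := 0) j.+1 _); last by move=> *; rewrite lee_fin.
by rewrite sumEFin lee_fin big_nat_recr//= lerDr sumr_ge0.
Qed.

Lemma measurable_l1norm {d} {Omega : measurableType d} (D : set Omega)
    (f : Omega -> nat -> R) :
  (forall j, measurable_fun D (fun w => f w j)) ->
  measurable_fun D (fun w => l1norm (f w)).
Proof.
move=> mf; apply: (ge0_emeasurable_sum (P := xpredT)).
  by move=> j s _ _; rewrite lee_fin.
move=> j _; apply/measurable_EFinP.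
by apply: measurableT_comp.
Qed.

Lemma l1norm_squeeze (f : nat -> nat -> R) (b : nat -> R) :
  (forall m, l1le (f m) (b m)) -> b @ \oo --> (0 : R) ->
  l1norm (f m) @[m --> \oo] --> (0 : \bar R)%E.
Proof.
move=> fb b0; apply: (@squeeze_cvge _ _ _ _ (cst 0%E) _ (EFin \o b)).
- by apply: nearW => m /=; rewrite l1norm_ge0/=; exact: l1norm_le.
- exact: cvg_cst.
- by apply: cvg_EFin => //; exact: nearW.
Qed.

Lemma d0_cvg r s c : l1le (fun j => r j - s j) c ->
  cvgn (fun J => \sum_(0 <= j < J) (2 ^- j * `|r j - s j|)).
Proof.
move=> rs; apply: nondecreasing_is_cvgn.
  apply/nondecreasing_seqP => J.
  by rewrite big_nat_recr//= lerDl mulr_ge0// invr_ge0 exprn_ge0.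
exists c => _ [J _ <-]; apply: le_trans (rs J); apply: ler_sum => j _.
by rewrite ler_piMl// invf_le1 ?exprn_gt0// exprn_ege1// ler1n.
Qed.

Lemma d0_le r s c : l1le (fun j => r j - s j) c -> d0 r s <= c.
Proof.
move=> rs; apply: limr_le; first exact: d0_cvg rs.
apply: nearW => J; apply: le_trans (rs J); apply: ler_sum => j _.
by rewrite ler_piMl// invf_le1 ?exprn_gt0// exprn_ege1// ler1n.
Qed.

Lemma simplex_l1dist r s : simplex r -> simplex s -> l1le (fun j => r j - s j) 2.
Proof. by move=> rS sS; exact: l1leB (l1le_simplex rS) (l1le_simplex sS). Qed.

Lemma d0_ge r s j : simplex r -> simplex s -> 2 ^- j * `|r j - s j| <= d0 r s.
Proof.
move=> rS sS; have h := d0_cvg (simplex_l1dist rS sS).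
apply: le_trans (nondecreasing_cvgn_le _ h j.+1).
  by rewrite big_nat_recr//= lerDr sumr_ge0// => i _; rewrite mulr_ge0// invr_ge0 exprn_ge0.
apply/nondecreasing_seqP => J.
by rewrite big_nat_recr//= lerDl mulr_ge0// invr_ge0 exprn_ge0.
Qed.

Lemma d0_ge0 r s : simplex r -> simplex s -> 0 <= d0 r s.
Proof.
by move=> rS sS; apply: le_trans (d0_ge 0 rS sS); rewrite mulr_ge0// invr_ge0 exprn_ge0.
Qed.

Lemma d0_cumul {X : Type} {FF : set_system X} {_ : ProperFilter FF} (r : X -> nat -> R) s j :
  (\forall x \near FF, simplex (r x)) -> simplex s ->
  d0 (r x) s @[x --> FF] --> (0 : R) -> cumul (r x) j @[x --> FF] --> cumul s j.
Proof.
move=> rS sS h; elim: j => [|j IH].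
  by under eq_fun do rewrite cumul0; rewrite cumul0; exact: cvg_cst.
under eq_fun do rewrite cumulS; rewrite cumulS; apply: cvgD => //.
apply/cvgrPdist_le => e e0.
have p0 : 0 < (2 ^- j : R) by rewrite invr_gt0 exprn_gt0.
have := mulr_gt0 p0 e0; move/cvgrPdist_le : h => /[apply] h.
near=> x; rewrite -(ler_pM2l p0) distrC (le_trans (d0_ge _ _ _))//.
  by near: x.
by have : `|0 - d0 (r x) s| <= 2 ^- j * e by [near: x]; rewrite sub0r normrN; exact/le_trans/ler_norm.
Unshelve. all: by end_near. Qed.

Lemma sum_geom_half N : \sum_(0 <= j < N) (2 ^- j : R) <= 2.
Proof.
suff -> : \sum_(0 <= j < N) (2 ^- j : R) = 2 - 2 * 2 ^- N.
  by rewrite gerBl mulr_ge0// invr_ge0 exprn_ge0.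
elim: N => [|N IH]; first by rewrite big_nil expr0 invr1 mulr1 subrr.
by rewrite big_nat_recr//= IH exprS; field; rewrite expf_neq0.
Qed.

(** Below [J] a coordinate is a difference of two cumulative masses, hence off by at most [2 a], and
    the weights have total at most 2. From [J] on, the weight is at most [2^-J] and the l1 distance
    at most 2. *)
Lemma d0_le_cumul r s a J : simplex r -> simplex s ->
  (forall j, (j <= J)%N -> `|cumul r j - cumul s j| <= a) ->
  d0 r s <= 4 * a + 2 * 2 ^- J.
Proof.
move=> rS sS h.
have a0 : 0 <= a by apply: le_trans (h 0 (leq0n _)).
apply: limr_le; first exact: d0_cvg (simplex_l1dist rS sS).
apply: nearW => N.
have pw0 i : 0 <= (2 ^- i : R) by rewrite invr_ge0 exprn_ge0.
apply: (@le_trans _ _ (\sum_(0 <= j < N) (2 ^- j * (2 * a) + 2 ^- J * `|r j - s j|))).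
  apply: ler_sum => j _; have [jJ|Jj] := ltnP j J.
    apply: ler_wpDr; first by rewrite mulr_ge0.
    rewrite ler_wpM2l//.
    have -> : r j - s j = (cumul r j.+1 - cumul s j.+1) - (cumul r j - cumul s j).
      by rewrite !cumulS; ring.
    rewrite (le_trans (ler_normB _ _))// mulr2n mulrDl mul1r lerD ?h//.
    exact: ltnW.
  apply: ler_wpDl; first by rewrite !mulr_ge0.
  by rewrite ler_wpM2r// lef_pV2 ?posrE ?exprn_gt0// ler_weXn2l// ler1n.
rewrite big_split/= -mulr_suml -mulr_sumr lerD//.
  have -> : 4 * a = 2 * (2 * a) by ring.
  by rewrite ler_wpM2r ?mulr_ge0// sum_geom_half.
by rewrite mulrC ler_wpM2r//; exact: simplex_l1dist.
Qed.

End SequenceNorms.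

(** * Left-endpoint Riemann sums as simple functions *)

Section RiemannBochner.
Context {R : realType}.
Implicit Types (s t : R).

Definition cell (m i : nat) : set R :=
  [set` `[(i%:R * m.+1%:R^-1 : R), i.+1%:R * m.+1%:R^-1[].

Definition cell_count (t : R) (m : nat) : nat := (Num.truncn (t * m.+1%:R)).+1.

(** Capping at [t] gives the last cell, which may overshoot, its true length inside [[0, t]]. *)
Definition node (t : R) (m i : nat) : R := Num.min (i%:R * m.+1%:R^-1) t.

Lemma cellP m i s : 0 <= s -> (s \in cell m i) = (i == Num.truncn (s * m.+1%:R)).
Proof.
move=> s0; rewrite /cell mem_setE in_itv/= eq_sym truncn_eq ?mulr_ge0//.
by rewrite ler_pdivrMr// ltr_pdivlMr.
Qed.

Lemma step_fun_cells t m (c : nat -> nat -> R) s j : 0 <= s <= t ->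
  step_fun (cell_count t m) (cell m) c s j = c (Num.truncn (s * m.+1%:R)) j.
Proof.
move=> /andP[s0 st]; rewrite /step_fun; set i0 := Num.truncn _.
rewrite (bigD1_seq i0) ?mem_index_iota ?iota_uniq//=.
  rewrite indicE cellP// eqxx mul1r big1_seq ?addr0// => i /andP[ii0 _].
  by rewrite indicE cellP// (negbTE ii0) mul0r.
by rewrite ltnS le_truncn// ler_wpM2r.
Qed.

Lemma node_trunc t m s : 0 <= s <= t ->
  node t m (Num.truncn (s * m.+1%:R)) <= s <=
  node t m (Num.truncn (s * m.+1%:R)) + m.+1%:R^-1.
Proof.
move=> /andP[s0 st]; have /andP[] := truncn_itv (mulr_ge0 s0 (ler0n R m.+1)).
set i := Num.truncn _.
rewrite -ler_pdivrMr// -ltr_pdivlMr// -(natr1 i) mulrDl mul1r => h1 h2.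
by rewrite /node min_l; [rewrite h1 ltW|exact: le_trans h1 st].
Qed.

Lemma node_itv t m i : 0 <= t -> 0 <= node t m i <= t.
Proof. by move=> t0; rewrite /node ge_min lexx orbT le_min t0 mulr_ge0. Qed.

Lemma nodeS t m i : 0 <= t -> node t m i <= node t m i.+1 <= node t m i + m.+1%:R^-1.
Proof.
move=> t0; rewrite /node -(natr1 i) mulrDl mul1r.
have h : 0 <= (m.+1%:R^-1 : R) by [].
have key a b : 0 <= b -> Num.min a t <= Num.min (a + b) t <= Num.min a t + b.
  by case: (leP a t); case: (leP (a + b) t) => h1 h2 h3; apply/andP; split; lra.
exact: key.
Qed.

Lemma node_last t m : 0 <= t -> node t m (cell_count t m) = t.
Proof.
move=> t0; rewrite /node min_r//.
by rewrite ler_pdivlMr// ltW// truncnS_gt.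
Qed.

Lemma measure_cell t m i : 0 <= t -> (i < cell_count t m)%N ->
  fine (lebesgue_measure (([set` `[0, t]] : set R) `&` cell m i)) = node t m i.+1 - node t m i.
Proof.
move=> t0; rewrite ltnS => iN.
have it : i%:R * m.+1%:R^-1 <= t.
  have /andP[h _] := truncn_itv (mulr_ge0 t0 (ler0n R m.+1)).
  by rewrite ler_pdivrMr//; apply: le_trans h; rewrite ler_nat.
have i0 : 0 <= (i%:R * m.+1%:R^-1 : R) by rewrite mulr_ge0.
have m0 : 0 < (m.+1%:R^-1 : R) by [].
have [h|h] := leP (i.+1%:R * m.+1%:R^-1) t.
  have -> : [set` `[0, t]] `&` cell m i = cell m i.
    apply/setIidPr => s; rewrite /cell/= !in_itv/= => /andP[a b].
    by rewrite (le_trans i0 a)/= ltW// (lt_le_trans b).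
  have lt : (i%:R * m.+1%:R^-1 : R) < i.+1%:R * m.+1%:R^-1 by rewrite ltr_pM2r// ltr_nat.
  by rewrite /cell lebesgue_measure_itv/= lte_fin lt /node !min_l.
have -> : [set` `[0, t]] `&` cell m i = [set` `[i%:R * m.+1%:R^-1, t]].
  apply/seteqP; split => s; rewrite /cell/= !in_itv/=.
    by case=> /andP[_ ->] /andP[->].
  by move=> /andP[a b]; rewrite a b (le_trans i0 a) (le_lt_trans b h).
rewrite lebesgue_measure_itv/= lte_fin.
rewrite /node (min_l it) min_r ?(ltW h)//.
case: ltP => //= h'; apply/esym/eqP; rewrite subr_eq0; apply/eqP/le_anti.
by rewrite it h'.
Qed.

Lemma measurable_step_fun (D : set R) N (A : nat -> set R) (c : nat -> nat -> R) j :
  (forall i, measurable (A i : set (measurableTypeR R))) ->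
  measurable_fun (D : set (measurableTypeR R)) (fun s => step_fun N A c s j).
Proof.
move=> mA; apply: measurable_sum => i; exact: measurable_funM.
Qed.

Lemma inv_nat_cvg (c : R) : c * m.+1%:R^-1 @[m --> \oo] --> (0 : R).
Proof.
rewrite -(mulr0 c); apply: cvgM; first exact: cvg_cst.
exact: cvg_harmonic.
Qed.

(** The simple functions freeze [g] at the left end of each cell. The Lipschitz bound makes them
    uniformly close to [g], and the quadratic remainders of [x] make the Riemann sums converge to
    its increment. *)
Lemma bochner_of_drift (g x : R -> nat -> R) (c b t : R) : 0 <= t -> 0 <= c ->
  (forall s, 0 <= s <= t -> l1le (g s) b) ->
  (forall s s', 0 <= s -> s <= s' -> s' <= t ->
     l1le (fun j => g s' j - g s j) (c * (s' - s))) ->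
  (forall s s', 0 <= s -> s <= s' -> s' <= t ->
     l1le (fun j => x s' j - x s j - (s' - s) * g s j) (c * (s' - s) ^+ 2)) ->
  bochner_integral_l1 [set` `[0, t]] g (fun j => x t j - x 0 j).
Proof.
move=> t0 c0 gb gl xd.
pose cc m i := g (node t m i).
have near_step m s : 0 <= s <= t -> l1le (fun j => g s j -
    step_fun (cell_count t m) (cell m) (cc m) s j) (c * m.+1%:R^-1).
  move=> st; have /andP[n1 n2] := node_trunc m st.
  have /andP[n3 n4] := node_itv m (Num.truncn (s * m.+1%:R)) t0.
  have /andP[_ s2] := st.
  apply: l1le_sub (gl _ _ n3 n1 s2) _ _ => [j|]; first by rewrite step_fun_cells.
  by rewrite ler_wpM2l// lerBlDl.
have mg j : measurable_fun [set` `[0, t]] (fun s => g s j).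
  apply: (measurable_fun_cvg (h := fun m s => step_fun (cell_count t m) (cell m) (cc m) s j)).
    by move=> m; apply: measurable_step_fun => i; exact: measurable_itv.
  move=> s; rewrite /= in_itv/= => st; apply/cvgrPdist_le => e e0.
  move/cvgrPdist_le : (inv_nat_cvg c) => /(_ _ e0); apply: filterS => m.
  rewrite sub0r normrN => h; rewrite (le_trans (l1le_coord j (near_step m s st)))//.
  exact: le_trans (ler_norm _) h.
exists (cell_count t), cell, cc; split.
- move=> m i; split; first exact: measurable_itv.
  apply: le_lt_trans (l1norm_le (gb _ _)) _; last exact: ltry.
  exact: node_itv.
- move=> s; rewrite /= in_itv/= => st.
  exact: l1norm_squeeze (fun m => near_step m s st) (inv_nat_cvg c).
- apply: (@squeeze_cvge _ _ _ _ (cst 0%E) _ (fun m => (c * t * m.+1%:R^-1)%:E)).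
  + apply: nearW => m /=; rewrite integral_ge0 => [/=|s _]; last exact: l1norm_ge0.
    have -> : (c * t * m.+1%:R^-1)%:E =
      (\int[lebesgue_measure]_(s in [set` `[0%R, t]]) (cst (c * m.+1%:R^-1)%:E s))%E.
      rewrite integral_cst//= lebesgue_measure_itv/= lte_fin.
      case: ltP => [_|h]; first by rewrite sube0 -EFinM mulrAC.
      have -> : t = 0 by apply: le_anti; rewrite h t0.
      by rewrite mulr0 mul0r mule0.
    apply: ge0_le_integral => //.
    * by move=> s _; exact: l1norm_ge0.
    * apply: measurable_l1norm => j; apply: measurable_funB; first exact: mg.
      by apply: measurable_step_fun => i; exact: measurable_itv.
    * by move=> s; rewrite /= in_itv/= => st; exact/l1norm_le/near_step.
  + exact: cvg_cst.
  + by apply: cvg_EFin; [exact: nearW|exact: inv_nat_cvg].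
- apply: (l1norm_squeeze (b := fun m => c * t * m.+1%:R^-1)); last exact: inv_nat_cvg.
  move=> m.
  (* Each squared cell length is at most the mesh times the length, so the errors add up to the mesh
     times the elapsed time. *)
  have step n : l1le (fun j => x (node t m n) j - x 0 j -
      \sum_(0 <= i < n) (node t m i.+1 - node t m i) * cc m i j)
      (c * m.+1%:R^-1 * node t m n).
    elim: n => [|n IH].
      have -> : node t m 0 = 0 by rewrite /node mul0r min_l.
      by apply: (@eq_l1le _ (fun=> 0)); [move=> j; rewrite big_nil; ring|apply: l1le0; rewrite mulr0].
    have /andP[n1 n2] := node_itv m n t0; have /andP[n3 n4] := node_itv m n.+1 t0.
    have /andP[n5 n6] := nodeS m n t0.
    have H := l1leD IH (xd _ _ n1 n5 n4).
    apply: (l1le_sub H) => [j|]; first by rewrite big_nat_recr//= /cc; ring.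
    rewrite -lerBrDl -mulrBr expr2 -mulrA ler_wpM2l// ler_wpM2r ?subr_ge0//.
    by rewrite lerBlDl.
  apply: (l1le_sub (step (cell_count t m))) => [j|]; rewrite node_last//.
    congr (_ - _); rewrite /step_int big_nat [RHS]big_nat; apply: eq_bigr => i /andP[_ iN].
    by rewrite measure_cell.
  by rewrite mulrAC.
Qed.

End RiemannBochner.

(** * The gap functional *)

Section Lyapunov.
Context {R : realType}.

Definition gap (J : nat) (p a : nat -> R) : R :=
  \sum_(0 <= j < J) 2 ^- j * (p j - a j) ^+ 2.

Lemma half_pow_gt0 j : 0 < (2 ^- j : R).
Proof. by rewrite invr_gt0 exprn_gt0. Qed.

Lemma half_powS j : (2 ^- j.+1 : R) = 2 ^- j / 2.
Proof. by rewrite exprS; field; rewrite expf_neq0. Qed.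

Lemma half_pow_cvg (c : R) : c * 2 ^- J @[J --> \oo] --> (0 : R).
Proof.
rewrite -(mulr0 c); apply: cvgM; first exact: cvg_cst.
under eq_fun do rewrite -exprVn.
by apply: cvg_expr; rewrite ger0_norm ?invr_ge0// invf_lt1// ltr1n.
Qed.

Lemma gap_ge0 J p a : 0 <= gap J p a.
Proof. by apply: sumr_ge0 => j _; rewrite mulr_ge0 ?sqr_ge0// ltW// half_pow_gt0. Qed.

Lemma gap_coord J p a j : (j < J)%N -> 2 ^- j * (p j - a j) ^+ 2 <= gap J p a.
Proof.
move=> jJ; rewrite /gap big_mkord (bigD1 (Ordinal jJ))//= lerDl sumr_ge0// => i _.
by rewrite mulr_ge0 ?sqr_ge0// ltW// half_pow_gt0.
Qed.

(** Summing the shifted terms gives at most [1/2 + 4 + 2] copies of each [D j], rounded up to 7; the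
    level [J] just outside the range leaves the boundary term [2 * D J]. *)
Lemma neighbour_sum (c : R) (D X : nat -> R) J : 0 <= c -> (forall j, 0 <= D j) ->
  X 0 <= 0 -> (forall j, X j.+1 <= c * (D j / 2 + 4 * D j.+1 + 2 * D j.+2)) ->
  \sum_(0 <= j < J) X j <= c * (7 * \sum_(0 <= j < J) D j + 2 * D J).
Proof.
move=> c0 D0 X0 XS; case: J => [|J].
  by rewrite !big_nil mulr0 add0r !mulr_ge0.
(* Strengthened for the induction: the slack [- D J / 2] absorbs the half of [D J] contributed by
   the next index. *)
apply: (@le_trans _ _ (c * (7 * \sum_(0 <= j < J.+1) D j + 2 * D J.+1 - D J / 2))); last first.
  by rewrite ler_wpM2l// gerBl divr_ge0.
elim: J => [|J IH].
  rewrite !big_nat1; apply: le_trans X0 _; rewrite mulr_ge0//.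
  by have := D0 0; have := D0 1; lra.
rewrite [leLHS]big_nat_recr//= [X in 7 * X]big_nat_recr//=.
apply: le_trans (lerD IH (XS J)) _; rewrite -mulrDr ler_wpM2l//.
by have := D0 J; have := D0 J.+1; have := D0 J.+2; lra.
Qed.

Lemma gronwall (a : nat -> R) (c b : R) N : 0 <= c -> 0 <= b -> 0 <= a 0 ->
  (forall i, (i < N)%N -> a i.+1 <= (1 + c) * a i + b) ->
  a N <= expR (N%:R * c) * (a 0 + N%:R * b).
Proof.
move=> c0 b0 a0 aS.
suff : forall i, (i <= N)%N -> a i <= expR (i%:R * c) * (a 0 + i%:R * b) by apply.
elim=> [|i IH iN]; first by rewrite !mul0r expR0 mul1r addr0.
have {}IH := IH (ltnW iN).
apply: le_trans (aS i iN) _.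
have e1 : 1 <= expR (i.+1%:R * c) by rewrite -[1]expR0 ler_expR mulr_ge0.
have m0 : 0 <= a 0 + i%:R * b by rewrite addr_ge0// mulr_ge0.
have -> : a 0 + i.+1%:R * b = (a 0 + i%:R * b) + b by rewrite -natr1; ring.
rewrite mulrDr lerD//; last by rewrite ler_peMl.
apply: le_trans (_ : (1 + c) * (expR (i%:R * c) * (a 0 + i%:R * b)) <= _).
  by rewrite ler_wpM2l// addr_ge0.
have -> : expR (i.+1%:R * c) = expR c * expR (i%:R * c).
  by rewrite -natr1 mulrDl mul1r addrC expRD.
by rewrite -mulrA ler_wpM2r ?expR_ge1Dx// mulr_ge0 ?expR_ge0.
Qed.

(* [p'] and [a'] are the Euler steps [p + h P] and [a + h A], up to errors [e]. *)
Lemma gap_step J (p a p' a' P A : nat -> R) (h K e : R) : 0 <= h -> 0 <= K -> 0 <= e ->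
  (forall j, (j < J)%N -> `|p j - a j| <= 1) ->
  (forall j, (j < J)%N -> `|P j| <= K) -> (forall j, (j < J)%N -> `|A j| <= K) ->
  (forall j, (j < J)%N -> `|p' j - p j - h * P j| <= e) ->
  (forall j, (j < J)%N -> `|a' j - a j - h * A j| <= e) ->
  gap J p' a' <= gap J p a
    + h * (\sum_(0 <= j < J) 2 ^- j * (2 * (p j - a j) * (P j - A j)))
    + 2 * (4 * e + (2 * K * h + 2 * e) ^+ 2).
Proof.
move=> h0 K0 e0 pa PK AK pe ae.
set E := 4 * e + _ ^+ 2.
have E0 : 0 <= E by apply: addr_ge0; [rewrite mulr_ge0|exact: sqr_ge0].
apply: (@le_trans _ _ (gap J p a
    + h * (\sum_(0 <= j < J) 2 ^- j * (2 * (p j - a j) * (P j - A j)))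
    + \sum_(0 <= j < J) 2 ^- j * E)); last first.
  by rewrite lerD2l -mulr_suml ler_wpM2r// sum_geom_half.
rewrite /gap mulr_sumr -!big_split/= big_nat [leRHS]big_nat; apply: ler_sum => j /andP[_ jJ].
rewrite (_ : h * (2 ^- j * _) = 2 ^- j * (h * (2 * (p j - a j) * (P j - A j)))); last by ring.
rewrite -!mulrDr ler_wpM2l ?(ltW (half_pow_gt0 _))//.
move: (pa j jJ) (PK j jJ) (AK j jJ) (pe j jJ) (ae j jJ).
set d := p j - a j => d1 P1 A1 p1 a1.
set r := p' j - p j - h * P j in p1; set s := a' j - a j - h * A j in a1.
have -> : p' j - a' j = d + (h * (P j - A j) + (r - s)) by rewrite /d /r /s; ring.
set z := h * (P j - A j) + (r - s).
have z1 : `|z| <= 2 * K * h + 2 * e.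
  rewrite (le_trans (ler_normD _ _))// lerD//.
    rewrite normrM (ger0_norm h0) mulrC ler_wpM2r// (le_trans (ler_normB _ _))//; lra.
  rewrite (le_trans (ler_normB _ _))//; lra.
have z2 : z ^+ 2 <= (2 * K * h + 2 * e) ^+ 2.
  by rewrite -[z ^+ 2]real_normK ?num_real// lerXn2r ?nnegrE// (le_trans _ z1).
have d2 : 2 * d * (r - s) <= 4 * e.
  have : `|d * (r - s)| <= 1 * (2 * e).
    rewrite normrM ler_pM// (le_trans (ler_normB _ _))//; lra.
  by rewrite ler_norml => /andP[_]; lra.
have -> : (d + z) ^+ 2 = d ^+ 2 + 2 * d * (h * (P j - A j)) + (2 * d * (r - s) + z ^+ 2).
  by rewrite /z; ring.
rewrite (_ : h * (2 * d * (P j - A j)) = 2 * d * (h * (P j - A j))); last by ring.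
by rewrite lerD2l /E lerD.
Qed.

End Lyapunov.

(** * The drift inequality for the gap *)

Section CumulDrift.
Context {R : realType} (k L : nat) (lambda : R) (lambda_ge0 : 0 <= lambda).
Implicit Types r s : nat -> R.
Local Notation drift := (cdrift k L lambda).
Local Notation K := (Fcst k L lambda).

Lemma cumul_dist r s j : simplex r -> simplex s -> `|cumul r j - cumul s j| <= 1.
Proof.
move=> rS sS; have [/andP[? ?] _ _] := unit_coords j rS.
by have [/andP[? ?] _ _] := unit_coords j sS; rewrite ler_norml; apply/andP; split; lra.
Qed.

Lemma cdrift_bound r j : simplex r -> `|drift j r| <= K.
Proof.
move=> rS; rewrite -cumul_F; apply: l1le_cumul; exact: F_bound.
Qed.

Lemma cdrift_lip r s j : simplex r -> simplex s ->
  `|drift j.+1 r - drift j.+1 s| <= K * (`|cumul r j - cumul s j| +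
    `|cumul r j.+1 - cumul s j.+1| + `|cumul r j.+2 - cumul s j.+2|).
Proof.
move=> rS sS; rewrite /cdrift /=.
have coord i : `|r i - s i| <= `|cumul r i - cumul s i| + `|cumul r i.+1 - cumul s i.+1|.
  rewrite [leRHS]addrC; have -> : r i - s i = (cumul r i.+1 - cumul s i.+1) - (cumul r i - cumul s i).
    by rewrite !cumulS; ring.
  exact: ler_normB.
have := zeta_lip k L j rS sS; have := coord j; have := coord j.+1.
set a := `|cumul r j - _|; set b := `|cumul r j.+1 - _|; set c := `|cumul r j.+2 - _|.
have [a0 b0 c0] : [/\ 0 <= a, 0 <= b & 0 <= c] by rewrite !normr_ge0.
move=> rs1 rs0 z1.
have z2 : `|zeta k L j r - zeta k L j s| <= @zcst R k L * (2 * (a + b)).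
  apply: le_trans z1 _; rewrite ler_wpM2l ?zcst_ge0//.
  have : s j * (a + b) <= 1 * (a + b) by rewrite ler_wpM2r ?simplex_le1// addr_ge0.
  by move=> *; lra.
have -> : - (lambda * L`!%:R * zeta k L j r) + k%:R * r j.+1 -
  (- (lambda * L`!%:R * zeta k L j s) + k%:R * s j.+1) =
  - (lambda * L`!%:R) * (zeta k L j r - zeta k L j s) + k%:R * (r j.+1 - s j.+1) by ring.
rewrite (le_trans (ler_normD _ _))// !normrM normrN.
rewrite (ger0_norm (mulr_ge0 lambda_ge0 (ler0n _ _))) (ger0_norm (ler0n _ _)).
have h1 : lambda * L`!%:R * `|zeta k L j r - zeta k L j s| <=
  lambda * L`!%:R * (@zcst R k L * (2 * (a + b))) by rewrite ler_wpM2l// mulr_ge0.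
have h2 : k%:R * `|r j.+1 - s j.+1| <= k%:R * (b + c) by rewrite ler_wpM2l.
have q0 : 0 <= lambda * L`!%:R * @zcst R k L by rewrite !mulr_ge0// zcst_ge0.
have qa : 0 <= lambda * L`!%:R * @zcst R k L * a by rewrite mulr_ge0.
have qb : 0 <= lambda * L`!%:R * @zcst R k L * b by rewrite mulr_ge0.
have qc : 0 <= lambda * L`!%:R * @zcst R k L * c by rewrite mulr_ge0.
have ka : 0 <= k%:R * a by rewrite mulr_ge0.
have kb : 0 <= k%:R * b by rewrite mulr_ge0.
have kc : 0 <= k%:R * c by rewrite mulr_ge0.
rewrite /Fcst; lra.
Qed.

(** Seen from level [j + 1], the weight [2^-(j+1)] turns the squares at [j], [j + 1], [j + 2] into
    [D j / 2], [D j.+1] and [2 * D j.+2], as [neighbour_sum] expects. The boundary term is at most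
    [2^-J] because cumulative masses lie in [[0, 1]]. *)
Lemma gap_drift r s J : simplex r -> simplex s ->
  \sum_(0 <= j < J) 2 ^- j *
    (2 * (cumul r j - cumul s j) * (drift j r - drift j s)) <=
  K * (7 * gap J (cumul r) (cumul s) + 2 * 2 ^- J).
Proof.
move=> rS sS; have K0 : 0 <= K by exact: Fcst_ge0.
pose D j := 2 ^- j * (cumul r j - cumul s j) ^+ 2.
have D0 j : 0 <= D j by rewrite mulr_ge0 ?sqr_ge0// ltW// half_pow_gt0.
apply: le_trans (_ : K * (7 * \sum_(0 <= j < J) D j + 2 * D J) <= _); last first.
  rewrite ler_wpM2l// lerD2l ler_wpM2l// ler_piMr ?(ltW (half_pow_gt0 _))//.
  have := cumul_dist J rS sS; rewrite -real_normK ?num_real// => h.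
  by rewrite exprn_ile1.
apply: neighbour_sum => //.
  by rewrite !cumul0 !subrr !(mulr0, mul0r).
move=> j; rewrite /D !half_powS.
have := cdrift_lip j rS sS.
set a := cumul r j - _; set b := cumul r j.+1 - _; set c := cumul r j.+2 - _.
set X := _ - _ => hX.
(* Young's inequality on the products [|a| |b|] and [|c| |b|] gives the coefficient 4 of
   [b ^+ 2]. *)
have h1 : 2 * b * X <= K * (a ^+ 2 + 4 * b ^+ 2 + c ^+ 2).
  apply: (@le_trans _ _ (2 * `|b| * `|X|)).
    by rewrite -2!mulrA ler_wpM2l// -normrM ler_norm.
  apply: (@le_trans _ _ (2 * `|b| * (K * (`|a| + `|b| + `|c|)))).
    by rewrite ler_wpM2l// mulr_ge0.
  rewrite mulrCA ler_wpM2l//.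
  rewrite -[a ^+ 2]real_normK ?num_real// -[b ^+ 2]real_normK ?num_real//.
  rewrite -[c ^+ 2]real_normK ?num_real//.
  have := sqr_ge0 (`|a| - `|b|); have := sqr_ge0 (`|c| - `|b|).
  by rewrite !expr2; lra.
have w0 := half_pow_gt0 (R := R) j.
apply: (@le_trans _ _ (2 ^- j / 2 * (K * (a ^+ 2 + 4 * b ^+ 2 + c ^+ 2)))).
  by rewrite ler_wpM2l// divr_ge0// ltW.
rewrite le_eqVlt; apply/orP; left; apply/eqP; field.
by rewrite expf_neq0.
Qed.

End CumulDrift.

(** * Uniqueness for the differential equation *)

Section BochnerCoordinates.
Context {R : realType}.
Local Notation mu := (@lebesgue_measure R).

Lemma bounded_integrable {d} {Omega : measurableType d} (nu : {measure set Omega -> \bar R})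
    (D : set Omega) (f : Omega -> R) (b : R) :
  measurable D -> (nu D < +oo)%E -> measurable_fun D f ->
  (forall w, D w -> `|f w| <= b) -> nu.-integrable D (EFin \o f).
Proof.
move=> mD nuD mf fb; apply: measurable_bounded_integrable => //.
exists b; split; first exact: num_real.
by move=> x bx w Dw /=; rewrite (le_trans (fb w Dw))// ltW.
Qed.

Lemma itv_finite (a b : R) c d : (mu [set` Interval (BSide c a) (BSide d b)] < +oo)%E.
Proof. by rewrite lebesgue_measure_itv; case: ifP => _ //=; rewrite -EFinB ltry. Qed.

Lemma step_integrable (D : set R) N (A : nat -> set R) (c : nat -> nat -> R) j :
  measurable (D : set (measurableTypeR R)) -> (mu D < +oo)%E ->
  (forall i, measurable (A i : set (measurableTypeR R))) ->
  mu.-integrable D (EFin \o (fun s => step_fun N A c s j)) /\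
  \int[mu]_(s in D) step_fun N A c s j = step_int D N A c j.
Proof.
move=> mD fD mA; rewrite /step_fun /step_int; elim: N => [|N [IH1 IH2]].
  rewrite big_nil; split; last by under eq_Rintegral do rewrite big_nil; rewrite Rintegral_cst// mul0r.
  apply: (bounded_integrable (b := 0)) => //.
    by under eq_fun do rewrite big_nil; exact: measurable_cst.
  by move=> w _; rewrite big_nil normr0.
have i1 : mu.-integrable D (EFin \o (\1_(A N) : R -> R)).
  apply: (bounded_integrable (b := 1)) => //.
  by move=> w _; rewrite indicE; case: (_ \in _); rewrite ?normr1 ?normr0.
have i2 : mu.-integrable D (EFin \o (fun s => \1_(A N) s * c N j)).
  apply: (bounded_integrable (b := `|c N j|)) => //.
    exact: measurable_funM.
  by move=> w _; rewrite indicE; case: (_ \in _); rewrite ?mul1r// mul0r normr0.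
split.
  have := integrableD mD IH1 i2; apply: eq_integrable => // s _ /=.
  by rewrite big_nat_recr//= EFinD.
rewrite big_nat_recr//= -IH2.
transitivity (\int[mu]_(s in D) (\sum_(0 <= i < N) \1_(A i) s * c i j + \1_(A N) s * c N j)).
  by apply: eq_Rintegral => s _; rewrite big_nat_recr.
rewrite RintegralD//; congr (_ + _).
rewrite RintegralZr//; congr (_ * _).
by rewrite /Rintegral integral_indic// setIC.
Qed.

(** A coordinate is dominated by the l1 norm, so the error against the Lebesgue integral is at most
    the sum of the two quantities that tend to 0 in the definition. *)
Lemma bochner_coord (D : set R) (g : R -> nat -> R) (v : nat -> R) (b : R) j :
  measurable (D : set (measurableTypeR R)) -> (mu D < +oo)%E -> bochner_integral_l1 D g v ->
  (forall s, D s -> `|g s j| <= b) ->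
  mu.-integrable D (EFin \o (g ^~ j)) /\ v j = \int[mu]_(s in D) g s j.
Proof.
move=> mD fD [N [A [c [mA pw mean lim]]]] gb.
have mAi m i : measurable (A m i : set (measurableTypeR R)) by have [] := mA m i.
have mg i : measurable_fun D (fun s => g s i).
  apply: (measurable_fun_cvg (h := fun m s => step_fun (N m) (A m) (c m) s i)).
    by move=> m; exact: measurable_step_fun.
  move=> s Ds; apply/cvgrPdist_lt => e e0.
  have /fine_cvgP[fin /cvgrPdist_lt/(_ _ e0)] := pw s Ds.
  apply: filterS2 fin => m fm; rewrite /= sub0r normrN => hm.
  apply: le_lt_trans (le_lt_trans (ler_norm _) hm); rewrite -lee_fin fineK//.
  exact: (l1norm_coord (fun j => g s j - _) i).
have ig : mu.-integrable D (EFin \o (g ^~ j)) by apply: (bounded_integrable (b := b)) => //; exact: mg.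
split => //.
pose I := \int[mu]_(s in D) g s j.
have bound m : (`|v j - I|%:E <=
    l1norm (fun i => (v i - step_int D (N m) (A m) (c m) i)%R) +
    \int[mu]_(s in D) l1norm (fun i => (g s i - step_fun (N m) (A m) (c m) s i)%R))%E.
  have [sI sIE] := step_integrable (N m) (c m) j mD fD (mAi m).
  have -> : v j - I = (v j - step_int D (N m) (A m) (c m) j) -
     \int[mu]_(s in D) (g s j - step_fun (N m) (A m) (c m) s j).
    by rewrite RintegralB// sIE -/I; ring.
  apply: (@le_trans _ _ (`|v j - step_int D (N m) (A m) (c m) j|%R%:E +
     `|\int[mu]_(s in D) (g s j - step_fun (N m) (A m) (c m) s j)|%R%:E)%E).
    by rewrite -EFinD lee_fin ler_normB.
  apply: leeD; first exact: (l1norm_coord (fun i => v i - _) j).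
  have ib : mu.-integrable D (EFin \o (fun s => g s j - step_fun (N m) (A m) (c m) s j)).
    by have := integrableB mD ig sI; apply: eq_integrable.
  rewrite EFin_normr_Rintegral//.
  apply: le_trans (le_abse_integral _ _ _) _ => //; first by case/integrableP: ib.
  apply: ge0_le_integral => //.
  - by apply: measurableT_comp => //; case/integrableP: ib.
  - apply: measurable_l1norm => i; apply: measurable_funB; first exact: mg.
    exact: measurable_step_fun.
  - by move=> s _; exact: (l1norm_coord (fun i => g s i - _) j).
have : (`|v j - I|%:E <= 0)%E.
  have c1 : (l1norm (fun i => (v i - step_int D (N m) (A m) (c m) i)%R) +
      \int[mu]_(s in D) l1norm (fun i => (g s i - step_fun (N m) (A m) (c m) s i)%R))%E
      @[m --> \oo] --> (0 + 0 : \bar R)%E.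
    by apply: cvgeD; [|exact: lim|exact: mean].
  rewrite -[X in (_ <= X)%E]adde0; apply: cvge_to_ge c1 _.
  by apply: nearW => m; exact: bound.
by rewrite lee_fin normr_le0 subr_eq0 => /eqP.
Qed.

Lemma Rintegral_near_cst (g : R -> R) (s t c b : R) : s <= t ->
  mu.-integrable [set` `]s, t]] (EFin \o g) ->
  (forall u, s < u <= t -> `|g u - c| <= b) ->
  `|\int[mu]_(u in [set` `]s, t]]) g u - (t - s) * c| <= (t - s) * b.
Proof.
move=> st ig gc.
have fi := @itv_finite s t false false.
have mI : measurable ([set` `]s, t]] : set (measurableTypeR R)) by exact: measurable_itv.
have ic (a : R) : mu.-integrable [set` `]s, t]] (EFin \o (cst a : R -> R)).
  by apply: (bounded_integrable (b := `|a|)) => //; exact: measurable_cst.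
have mst : fine (mu [set` `]s, t]]) = t - s.
  rewrite lebesgue_measure_itv/= lte_fin; case: ltP => //= ts.
  by apply/esym/eqP; rewrite subr_eq0; apply/eqP/le_anti; rewrite ts st.
have cE a : \int[mu]_(u in [set` `]s, t]]) (cst a u) = (t - s) * a.
  by rewrite Rintegral_cst// mst mulrC.
have ib : mu.-integrable [set` `]s, t]] (EFin \o (fun u => g u - cst c u)).
  by have := integrableB mI ig (ic c); apply: eq_integrable.
rewrite -!cE -RintegralB//.
apply: le_trans (le_normr_Rintegral _ _) _ => //.
apply: le_Rintegral => //.
  by have := integrable_norm ib.
Qed.

End BochnerCoordinates.

Section ODE.
Context {R : realType} (k L : nat) (lambda T : R).
Hypotheses (lambda_ge0 : 0 <= lambda) (T_ge0 : 0 <= T).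
Context (r0 : nat -> R) (r0_simplex : simplex r0).
Local Notation F := (Defs.F k L lambda).
Local Notation K := (Fcst k L lambda).

Lemma ode_coord y s t j : ode_solution k L lambda T r0 y -> 0 <= s -> s <= t -> t <= T ->
  [/\ (@lebesgue_measure R).-integrable [set` `]s, t]] (EFin \o (fun u => F (y u) j)) &
  y t j - y s j = \int[@lebesgue_measure R]_(u in [set` `]s, t]]) F (y u) j].
Proof.
move=> [yc yb] s0 st tT.
have coord u : 0 <= u <= T ->
    (@lebesgue_measure R).-integrable [set` `[0, u]] (EFin \o (fun v => F (y v) j)) /\
    y u j - r0 j = \int[@lebesgue_measure R]_(v in [set` `[0, u]]) F (y v) j.
  move=> /andP[u0 uT].
  apply: (bochner_coord (g := fun v => F (y v)) (v := fun j => y u j - r0 j) (b := K)).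
  - exact: measurable_itv.
  - exact: itv_finite.
  - by apply: yb; rewrite u0 uT.
  - move=> v; rewrite /= in_itv/= => /andP[v0 vu].
    apply: l1le_coord; apply: F_bound => //; apply: (yc v _).1.
    by rewrite v0 (le_trans vu).
have t0 := le_trans s0 st.
have [it yt] := coord t (introT andP (conj t0 tT)).
have [_ ys] := coord s (introT andP (conj s0 (le_trans st tT))).
split.
  apply: integrableS it => //; last by move=> u; rewrite /= !in_itv/= => /andP[/ltW/(le_trans s0)-> ->].
have -> : y t j - y s j = (y t j - r0 j) - (y s j - r0 j) by ring.
by rewrite yt ys Rintegral_itvB// bnd_simp.
Qed.

(** The constant may depend on [J]: for an arbitrary continuous solution it comes from
    coordinatewise estimates summed over the first levels, and [gap J] sees no others. *)
Definition has_drift (x : R -> nat -> R) : Prop := forall J, exists2 M : R, 0 <= M &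
  forall s t j, 0 <= s -> s <= t -> t <= T -> (j <= J)%N ->
    `|cumul (x t) j - cumul (x s) j - (t - s) * cdrift k L lambda j (x s)| <=
      M * (t - s) ^+ 2.

(** Bootstrap: boundedness of [F] makes the coordinates Lipschitz in time, hence also the first
    cumulative masses and the drift; integrating the Lipschitz drift leaves a quadratic
    remainder. *)
Lemma ode_has_drift y : ode_solution k L lambda T r0 y -> has_drift y.
Proof.
move=> yode; have K0 : 0 <= K by exact: Fcst_ge0.
have yS t : 0 <= t -> t <= T -> simplex (y t) by move=> t0 tT; apply: (yode.1 t _).1; rewrite t0.
have y_lip s t i : 0 <= s -> s <= t -> t <= T -> `|y t i - y s i| <= (t - s) * K.
  move=> s0 st tT; have [iF ->] := ode_coord i yode s0 st tT.
  rewrite -[X in `|X|]subr0 -(mulr0 (t - s)); apply: Rintegral_near_cst => //.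
  move=> u /andP[su ut]; rewrite subr0; apply: l1le_coord; apply: F_bound => //.
  by apply: yS; [rewrite (le_trans s0)// ltW|exact: le_trans tT].
have cum_lip s t i : 0 <= s -> s <= t -> t <= T ->
    `|cumul (y t) i - cumul (y s) i| <= i%:R * ((t - s) * K).
  move=> s0 st tT; rewrite -cumulB (le_trans (ler_norm_sum _ _ _))//.
  apply: le_trans (ler_sum _ (fun m _ => y_lip s t m s0 st tT)) _.
  by rewrite sumr_const_nat subn0 mulr_natl.
(* The 3 counts the neighbours in [cdrift_lip], [J.+2] covers the levels they reach, and the 2
   arises because a coordinate of [F] is a difference of two drifts. *)
move=> J; pose M := 2 * (K * (3 * (J.+2%:R * K))).
have M0 : 0 <= M by rewrite !mulr_ge0.
have cd_lip s t j : 0 <= s -> s <= t -> t <= T -> (j <= J)%N ->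
    `|cdrift k L lambda j (y t) - cdrift k L lambda j (y s)| <= (t - s) * (M / 2).
  move=> s0 st tT; case: j => [|j] jJ.
    by rewrite subrr normr0 mulr_ge0 ?subr_ge0// divr_ge0.
  apply: le_trans (cdrift_lip _ _ _ _ _ _) _ => //.
  - by apply: yS => //; exact: le_trans st.
  - by apply: yS => //; exact: le_trans tT.
  have c i : (i <= J.+2)%N -> `|cumul (y t) i - cumul (y s) i| <= J.+2%:R * ((t - s) * K).
    move=> iJ; apply: le_trans (cum_lip _ _ _ _ _ _) _ => //.
    by rewrite ler_wpM2r ?ler_nat// mulr_ge0// subr_ge0.
  have -> : (t - s) * (M / 2) = K * (J.+2%:R * ((t - s) * K) + J.+2%:R * ((t - s) * K)
     + J.+2%:R * ((t - s) * K)) by rewrite /M; field.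
  rewrite ler_wpM2l// !lerD//; apply: c.
  - exact: leqW (leqW (ltnW jJ)).
  - exact: leqW (leqW jJ).
  - exact: leqW jJ.
have F_lipy s t i : 0 <= s -> s <= t -> t <= T -> (i < J)%N ->
    `|F (y t) i - F (y s) i| <= (t - s) * M.
  move=> s0 st tT iJ.
  have FE r : F r i = cdrift k L lambda i.+1 r - cdrift k L lambda i r.
    by rewrite -!cumul_F cumulS addrAC subrr add0r.
  have -> : F (y t) i - F (y s) i =
    (cdrift k L lambda i.+1 (y t) - cdrift k L lambda i.+1 (y s)) -
    (cdrift k L lambda i (y t) - cdrift k L lambda i (y s)) by rewrite !FE; ring.
  rewrite (le_trans (ler_normB _ _))//.
  have := cd_lip s t i.+1 s0 st tT iJ; have := cd_lip s t i s0 st tT (ltnW iJ).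
  have : (t - s) * M = (t - s) * (M / 2) + (t - s) * (M / 2) by field.
  by move=> *; lra.
exists (J%:R * M); first by rewrite mulr_ge0.
move=> s t j s0 st tT jJ.
rewrite -cumul_F -cumulB /cumul mulr_sumr -sumrB.
rewrite (le_trans (ler_norm_sum _ _ _))//.
apply: (@le_trans _ _ (\sum_(0 <= i < j) M * (t - s) ^+ 2)).
  rewrite big_nat [leRHS]big_nat; apply: ler_sum => i /andP[_ ij].
  have [iF ->] := ode_coord i yode s0 st tT.
  rewrite (_ : M * _ = (t - s) * ((t - s) * M)); last by ring.
  apply: Rintegral_near_cst => // u /andP[su ut].
  apply: le_trans (F_lipy _ _ _ _ _ _ _) _ => //.
  - exact: ltW.
  - exact: le_trans tT.
  - exact: leq_trans ij jJ.
  - by rewrite ler_wpM2r// lerD2r.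
rewrite sumr_const_nat subn0 -[leLHS]mulr_natl -[leRHS]mulrA.
by rewrite ler_wpM2r ?ler_nat// mulr_ge0// sqr_ge0.
Qed.

(** With [J] fixed, both paths are compared on a grid of [N + 1] steps: the one-step errors
    [E * h ^+ 2] disappear as [N --> oo], even though [E] depends on [J]. What remains is the
    boundary term, with a constant independent of [J]. *)
Lemma has_drift_unique x y : has_drift x -> has_drift y ->
  (forall t, 0 <= t -> t <= T -> simplex (x t) /\ simplex (y t)) -> x 0 = y 0 ->
  forall t, 0 <= t <= T -> y t = x t.
Proof.
move=> xd yd xyS xy0 t /andP[t0 tT].
have K0 : 0 <= K by exact: Fcst_ge0.
pose C := expR (t * (7 * K)) * (t * (2 * K)).
have gapC J : gap J (cumul (x t)) (cumul (y t)) <= C * 2 ^- J.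
  have [M1 M10 xdM] := xd J; have [M2 M20 ydM] := yd J.
  pose M := M1 + M2; pose E := 2 * (4 * M + (2 * K + 2 * M * t) ^+ 2).
  have M0 : 0 <= M by exact: addr_ge0.
  have E0 : 0 <= E.
    by apply: mulr_ge0 => //; apply: addr_ge0; [exact: mulr_ge0|exact: sqr_ge0].
  suff bound N : gap J (cumul (x t)) (cumul (y t)) <=
      C * 2 ^- J + (expR (t * (7 * K)) * (t * E * t)) * N.+1%:R^-1.
    have c : C * 2 ^- J + (expR (t * (7 * K)) * (t * E * t)) * N.+1%:R^-1
        @[N --> \oo] --> C * 2 ^- J + 0.
      by apply: cvgD; [exact: cvg_cst|exact: inv_nat_cvg].
    rewrite -[leRHS]addr0; apply: cvgr_to_ge c _.
    by apply: nearW => N; exact: bound.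
  pose h := t * N.+1%:R^-1.
  have h0 : 0 <= h by rewrite mulr_ge0.
  have ht : h <= t by rewrite /h ler_piMr// invf_le1// ler1n.
  have Nh : N.+1%:R * h = t by rewrite /h; field.
  pose a i := gap J (cumul (x (i%:R * h))) (cumul (y (i%:R * h))).
  have aS i : (i < N.+1)%N ->
      a i.+1 <= (1 + h * (7 * K)) * a i + (h * (2 * K) * 2 ^- J + E * h ^+ 2).
    move=> iN.
    have i0 : 0 <= i%:R * h by rewrite mulr_ge0.
    have ii : i%:R * h <= i.+1%:R * h by rewrite ler_wpM2r// ler_nat.
    have iT : i.+1%:R * h <= T.
      by apply: le_trans tT; rewrite -Nh ler_wpM2r// ler_nat.
    have dh : i.+1%:R * h - i%:R * h = h by rewrite -natr1; ring.
    have [xS yS] := xyS _ i0 (le_trans ii iT).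
    have Mh : 0 <= M * h ^+ 2 by rewrite mulr_ge0// sqr_ge0.
    have step := @gap_step R J (cumul (x (i%:R * h))) (cumul (y (i%:R * h)))
      (cumul (x (i.+1%:R * h))) (cumul (y (i.+1%:R * h)))
      (fun j => cdrift k L lambda j (x (i%:R * h)))
      (fun j => cdrift k L lambda j (y (i%:R * h))) h K (M * h ^+ 2) h0 K0 Mh.
    apply: le_trans (step _ _ _ _ _) _ => [j jJ|j jJ|j jJ|j jJ|j jJ|].
    - exact: cumul_dist.
    - exact: cdrift_bound.
    - exact: cdrift_bound.
    - have := xdM _ _ j i0 ii iT (ltnW jJ); rewrite dh => hh.
      by apply: le_trans hh _; rewrite ler_wpM2r ?sqr_ge0// /M lerDl.
    - have := ydM _ _ j i0 ii iT (ltnW jJ); rewrite dh => hh.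
      by apply: le_trans hh _; rewrite ler_wpM2r ?sqr_ge0// /M lerDr.
    have gd := gap_drift k L lambda_ge0 J xS yS.
    have gd' := ler_wpM2l h0 gd.
    rewrite -/(a i) in gd' *.
    have e1 : 2 * (4 * (M * h ^+ 2) + (2 * K * h + 2 * (M * h ^+ 2)) ^+ 2) <= E * h ^+ 2.
      have -> : 2 * (4 * (M * h ^+ 2) + (2 * K * h + 2 * (M * h ^+ 2)) ^+ 2) =
        2 * (4 * M + (2 * K + 2 * M * h) ^+ 2) * h ^+ 2 by ring.
      rewrite ler_wpM2r ?sqr_ge0// /E ler_wpM2l// lerD2l lerXn2r ?nnegrE ?addr_ge0 ?mulr_ge0//.
      by rewrite lerD2l ler_wpM2l// mulr_ge0.
    apply: le_trans (lerD (lerD (lexx _) gd') e1) _.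
    by rewrite le_eqVlt; apply/orP; left; apply/eqP; ring.
  have b0 : 0 <= h * (2 * K) * 2 ^- J + E * h ^+ 2.
    apply: addr_ge0; last by apply: mulr_ge0 => //; exact: sqr_ge0.
    by apply: mulr_ge0; [rewrite !mulr_ge0|exact/ltW/half_pow_gt0].
  have c0 : 0 <= h * (7 * K) by rewrite !mulr_ge0.
  have := gronwall c0 b0 (gap_ge0 _ _ _) aS.
  have -> : a 0 = 0.
    by rewrite /a /gap mul0r xy0 big1// => i _; rewrite subrr expr0n mulr0.
  have -> : a N.+1 = gap J (cumul (x t)) (cumul (y t)) by rewrite /a Nh.
  rewrite add0r (mulrA _ h (7 * K)) Nh => g; apply: le_trans g _.
  rewrite le_eqVlt; apply/orP; left; apply/eqP; rewrite /C.
  have -> : N.+1%:R * (h * (2 * K) * 2 ^- J + E * h ^+ 2) =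
    (N.+1%:R * h) * (2 * K * 2 ^- J + E * h) by ring.
  by rewrite Nh /h; ring.
have same j : cumul (y t) j = cumul (x t) j.
  have w0 := half_pow_gt0 (R := R) j.
  set d := cumul (x t) j - cumul (y t) j.
  suff : 2 ^- j * d ^+ 2 <= 0.
    rewrite pmulr_rle0// => d2; have : d ^+ 2 == 0 by rewrite eq_le d2 sqr_ge0.
    by rewrite sqrf_eq0 subr_eq0 => /eqP.
  apply: cvgr_to_ge (half_pow_cvg C) _; exists j.+1 => // J /= jJ.
  exact: le_trans (gap_coord _ _ jJ) (gapC J).
apply/funext => j.
have := same j.+1; rewrite !cumulS same => /addrI; exact.
Qed.

End ODE.

(** * Existence for the differential equation *)

Section ODEExistence.
Context {R : realType} (k L : nat) (lambda T : R).
Hypotheses (lambda_ge0 : 0 <= lambda) (T_ge0 : 0 <= T).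
Context (r0 : nat -> R) (r0_simplex : simplex r0).
Local Notation F := (Defs.F k L lambda).
Local Notation K := (Fcst k L lambda).

Lemma drift_lip (x : R -> nat -> R) :
  (forall t, 0 <= t <= T -> simplex (x t)) ->
  (forall s t, 0 <= s -> s <= t -> t <= T ->
    l1le (fun j => x t j - x s j - (t - s) * F (x s) j) ((K * (t - s)) ^+ 2)) ->
  forall s t, 0 <= s -> s <= t -> t <= T ->
    l1le (fun j => x t j - x s j) ((K + K ^+ 2 * T) * (t - s)).
Proof.
move=> xS xd s t s0 st tT; have K0 : 0 <= K by exact: Fcst_ge0.
have sS : simplex (x s) by apply: xS; rewrite s0 (le_trans st).
have H := l1leD (xd s t s0 st tT) (l1leZ (t - s) (F_bound k L lambda_ge0 sS)).
apply: (l1le_sub H) => [j|]; first by ring.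
have ts : 0 <= t - s by rewrite subr_ge0.
have h : K ^+ 2 * ((t - s) * (t - s)) <= K ^+ 2 * (T * (t - s)).
  by rewrite ler_wpM2l ?sqr_ge0// ler_wpM2r//; lra.
rewrite (ger0_norm ts) exprMn expr2 -expr2 [(t - s) ^+ 2]expr2; lra.
Qed.

Lemma ode_exists : exists x : R -> nat -> R,
  [/\ x 0 = r0, forall t, 0 <= t <= T -> simplex (x t),
      ode_solution k L lambda T r0 x &
      forall s t, 0 <= s -> s <= t -> t <= T ->
        l1le (fun j => x t j - x s j - (t - s) * F (x s) j) ((K * (t - s)) ^+ 2)].
Proof.
have K0 : 0 <= K by exact: Fcst_ge0.
have Fb := @F_bound R k L lambda lambda_ge0.
have Fl := @F_lip R k L lambda lambda_ge0.
have Fg := @F_ge R k L lambda lambda_ge0.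
have Fc := @cumul_F_cvg R k L lambda lambda_ge0.
pose x := flow F K r0.
have x0 : x 0 = r0 by exact: flow0.
have xS t : 0 <= t <= T -> simplex (x t).
  exact: (flow_simplex K0 Fb Fl Fg Fc T_ge0 r0_simplex).
have xd s t : 0 <= s -> s <= t -> t <= T ->
    l1le (fun j => x t j - x s j - (t - s) * F (x s) j) ((K * (t - s)) ^+ 2).
  move=> s0 st tT; have ts : 0 <= t - s by rewrite subr_ge0.
  have tE : s + (t - s) = t by ring.
  have := @flow_drift R F K K0 Fb Fl Fg Fc T T_ge0 r0 r0_simplex s (t - s) s0 ts.
  by rewrite tE; exact.
have xl := drift_lip xS xd.
exists x; split => //; split.
- move=> t tT; split; first exact: xS.
  have /andP[t0 tT'] := tT.
  pose C := K + K ^+ 2 * T.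
  have C0 : 0 <= C by rewrite addr_ge0// mulr_ge0// sqr_ge0.
  have dl s : 0 <= s <= T -> d0 (x s) (x t) <= C * `|t - s|.
    move=> /andP[s0 sT]; apply: d0_le; have [st|/ltW ts] := leP s t.
      rewrite ger0_norm ?subr_ge0//.
      by apply: (l1le_dom _ (xl s t s0 st tT')) => j; rewrite distrC.
    by rewrite distrC ger0_norm ?subr_ge0//; exact: xl.
  apply/cvgrPdist_le => e e0; rewrite near_withinE; apply/nbhs_ballP.
  exists (e / (C + 1)); first by rewrite /= divr_gt0// ltr_wpDl.
  move=> s; rewrite /ball/= => sb; rewrite in_itv/= => sT.
  rewrite sub0r normrN ger0_norm; last by apply: d0_ge0; exact: xS.
  apply: le_trans (dl s sT) _.
  apply: (@le_trans _ _ ((C + 1) * `|t - s|)); first by rewrite ler_wpM2r// lerDl.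
  by rewrite mulrC -ler_pdivlMr ?ltr_wpDl// ltW.
- move=> t /andP[t0 tT].
  have -> : (fun j => x t j - r0 j) = (fun j => x t j - x 0 j) by rewrite x0.
  apply: (@bochner_of_drift _ _ _ (K * (K + K ^+ 2 * T) + K ^+ 2) K) => //.
  + apply: addr_ge0; last exact: sqr_ge0.
    by apply: mulr_ge0 => //; apply: addr_ge0 => //; apply: mulr_ge0 => //; exact: sqr_ge0.
  + by move=> s /andP[s0 st]; apply: Fb; apply: xS; rewrite s0 (le_trans st).
  + move=> s s' s0 ss' s't.
    have s'T := le_trans s't tT.
    have sS : simplex (x s) by apply: xS; rewrite s0 (le_trans ss').
    have s'S : simplex (x s') by apply: xS; rewrite s'T (le_trans s0).
    apply: l1le_trans (Fl _ _ _ s'S sS (xl _ _ s0 ss' s'T)) _.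
    by rewrite mulrA ler_wpM2r ?subr_ge0// lerDl sqr_ge0.
  + move=> s s' s0 ss' s't.
    apply: l1le_trans (xd s s' s0 ss' (le_trans s't tT)) _.
    rewrite exprMn ler_wpM2r ?sqr_ge0// lerDr.
    by apply: mulr_ge0 => //; apply: addr_ge0 => //; apply: mulr_ge0 => //; exact: sqr_ge0.
Qed.

(** The l1 estimate controls all levels at once, so the constant does not depend on [j], unlike in
    [has_drift]. *)
Lemma has_drift_of_l1 (x : R -> nat -> R) :
  (forall s t, 0 <= s -> s <= t -> t <= T ->
    l1le (fun j => x t j - x s j - (t - s) * F (x s) j) ((K * (t - s)) ^+ 2)) ->
  forall s t j, 0 <= s -> s <= t -> t <= T ->
    `|cumul (x t) j - cumul (x s) j - (t - s) * cdrift k L lambda j (x s)| <=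
      K ^+ 2 * (t - s) ^+ 2.
Proof.
move=> xd s t j s0 st tT; rewrite -exprMn -cumul_F -cumulB.
have := l1le_cumul j (xd s t s0 st tT); congr (`|_| <= _).
by rewrite (cumulB (fun i => x t i - x s i)); congr (_ - _); rewrite /cumul mulr_sumr.
Qed.

Lemma ode_unique x y :
  ode_solution k L lambda T r0 x -> ode_solution k L lambda T r0 y ->
  forall t, 0 <= t <= T -> y t = x t.
Proof.
move=> xo yo; apply: (has_drift_unique (k := k) (L := L) lambda_ge0).
- exact: ode_has_drift xo.
- exact: ode_has_drift yo.
- by move=> t t0 tT; split; [apply: (xo.1 t _).1|apply: (yo.1 t _).1]; rewrite t0.
(* The equation at time 0 integrates over a single point, which fixes the initial value. *)
have at0 z : ode_solution k L lambda T r0 z -> z 0 = r0.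
  move=> [zc zb]; apply/funext => j.
  have T00 : 0 <= (0 : R) <= T by rewrite lexx.
  have [||||_] := @bochner_coord R [set` `[0, 0]] (fun s => F (z s)) (fun j => z 0 j - r0 j) K j.
  - exact: measurable_itv.
  - exact: itv_finite.
  - exact: zb.
  - move=> s; rewrite /= in_itv/= => /andP[s0 s0'].
    apply: l1le_coord; apply: F_bound => //; apply: (zc s _).1.
    by rewrite s0 (le_trans s0').
  by rewrite set_itv1 Rintegral_set1 => /eqP; rewrite subr_eq0 => /eqP.
by rewrite (at0 _ xo) (at0 _ yo).
Qed.

End ODEExistence.

(** * Sampling servers without replacement *)

(** Reindexing by fibres, used twice: sorted tuples against sets of servers, and queue lengths
    against servers. *)
Lemma fsbig_fibers {R : realType} (T : choiceType) (J : finType) (h : J -> T)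
    (Q : pred J) (A : set T) (w G : T -> R) :
  (forall j, Q j -> A (h j)) ->
  (forall l, A l -> w l = \sum_(j | Q j) (h j == l)%:R) ->
  \sum_(l \in A) (w l * G l) = \sum_(j | Q j) G (h j).
Proof.
move=> hA wE; pose r := undup [seq h j | j <- enum Q].
have ru : uniq r by exact: undup_uniq.
rewrite (@fsbigE _ _ _ _ _ r)//; last first.
- move=> l Al lr; rewrite wE// big1 ?mul0r// => j Qj.
  by case: eqP => // jl; move: lr; rewrite mem_undup -jl map_f// mem_enum.
- by move=> l /=; rewrite mem_undup => /mapP[j]; rewrite mem_enum => Qj ->; exact: hA.
rewrite big_seq_cond.
rewrite (eq_bigr (fun l => \sum_(j | Q j) (h j == l)%:R * G l)); last first.
  by move=> l /andP[_]; rewrite inE => Al; rewrite wE// mulr_suml.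
rewrite exchange_big/=; apply: eq_bigr => j Qj.
have jr : h j \in r by rewrite mem_undup map_f// mem_enum.
rewrite -big_seq_cond big_mkcond (bigD1_seq (h j))//= big1_seq ?addr0.
  case: ifPn => [_|]; first by rewrite eqxx mul1r.
  by move=> /negP[]; apply/mem_set/hA.
move=> l /andP[lj _]; case: ifP => // _.
by rewrite eq_sym (negbTE lj) mul0r.
Qed.

Section Sampling.

(** A subset amounts to an independent choice of a subset inside each class, so the counts
    multiply. *)
Lemma card_subsets_by_class (T I : finType) (c : T -> I) (m : I -> nat) :
  #|[set B : {set T} | [forall i, #|[set s in B | c s == i]%SET| == m i]]%SET| =
  (\prod_i 'C(#|[set s | c s == i]%SET|, m i))%N.
Proof.
pose f (B : {set T}) : {ffun I -> {set T}} := [ffun i => [set s in B | c s == i]%SET].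
have f_inj : injective f.
  move=> A B /ffunP AB; apply/setP => s; have := AB (c s); rewrite !ffunE => /setP/(_ s).
  by rewrite !inE eqxx !andbT.
pose G i := [pred B : {set T} | (B \subset [set s | c s == i]%SET) && (#|B| == m i)].
rewrite -(card_imset _ f_inj).
transitivity #|(family G : simpl_pred {ffun I -> {set T}})|.
  apply: eq_card => g; apply/imsetP/familyP => [[B] | gG].
    rewrite inE => /forallP Bm -> i; rewrite inE ffunE Bm andbT.
    by apply/fintype.subsetP => s; rewrite !inE => /andP[].
  have gs s i : (s \in g i) = (s \in g (c s)) && (c s == i).
    have := gG i; rewrite inE => /andP[/fintype.subsetP/(_ s) h _].
    apply/idP/andP => [sg|[sg /eqP<-]//]; have := h sg; rewrite inE => /eqP ci.
    by rewrite ci eqxx.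
  exists [set s | s \in g (c s)]%SET.
    rewrite inE; apply/forallP => i; have := gG i; rewrite inE => /andP[_ /eqP<-].
    by apply/eqP; apply: eq_card => s; rewrite !inE -gs.
  by apply/ffunP => i; apply/setP => s; rewrite ffunE !inE -gs.
rewrite card_family foldrE big_map big_enum/=; apply: eq_bigr => i _.
by rewrite -cards_draws cardsE.
Qed.

Context (n : nat) (q : 'I_n -> nat).
Implicit Types (B : {set 'I_n}) (i j : nat).

Definition class_size (i : nat) : nat := #|[set s | q s == i]%SET|.

Definition less_size (i : nat) : nat := #|[set s | (q s < i)%N]%SET|.

Definition sampled B : seq nat := sort leq [seq q s | s <- enum B].

Lemma size_sampled B : size (sampled B) = #|B|.
Proof. by rewrite size_sort size_map -cardE. Qed.

Lemma count_sampled (p : pred nat) B : count p (sampled B) = #|[set s in B | p (q s)]%SET|.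
Proof.
rewrite count_sort count_map -sum1_count big_enum_cond/= -sum1_card.
by apply: eq_bigl => s; rewrite inE.
Qed.

Lemma sampled_sorted B : sorted leq (sampled B).
Proof. exact: sort_sorted leq_total _. Qed.

(** The combinatorial factor of the generator counts the sets of servers whose sorted queue lengths
    are [l], since a sorted list is determined by its multiplicities. *)
Lemma sampled_fiber (l : seq nat) : sorted leq l ->
  \big[muln/1%N]_(i \in [set: nat]) 'C(class_size i, count_mem i l) =
  #|[set B | sampled B == l]%SET|.
Proof.
move=> l_sorted.
(* From [M] on, no server and no entry of [l] occurs, so every further binomial is 1 and [M] classes
   suffice. *)
pose M := (\max_(s < n) q s + \max_(i <- l) i).+1.
have qM s : (q s < M)%N by rewrite ltnS (leq_trans (leq_bigmax s))// leq_addr.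
have lM i : i \in l -> (i < M)%N.
  by move=> il; rewrite ltnS (leq_trans (@leq_bigmax_seq _ l xpredT id i il isT))// leq_addl.
have out i : (M <= i)%N -> count_mem i l = 0%N.
  move=> Mi; apply/eqP; rewrite -leqn0 leqNgt -has_count has_pred1.
  by apply/negP => /lM; rewrite ltnNge Mi.
pose c s : 'I_M := Ordinal (qM s).
rewrite -(@fsbig_widen _ _ _ _ `I_M)//; last first.
  by move=> i /= [_ /negP]; rewrite -leqNgt => /out->; rewrite bin0.
rewrite -fsbig_ord -(card_subsets_by_class c (fun i : 'I_M => count_mem (i : nat) l)).
apply: eq_card => B; rewrite !inE; apply/forallP/eqP => [h | <- i]; last first.
  by rewrite count_sampled.
apply: (sorted_eq leq_trans anti_leq) (sampled_sorted B) l_sorted _.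
apply/permP => p; have : perm_eq (sampled B) l; last by move=> /permP.
apply/allP => i _ /=; rewrite count_sampled.
have [iM|Mi] := ltnP i M; first by rewrite -(eqP (h (Ordinal iM))).
rewrite out// cards_eq0; apply/eqP/setP => s; rewrite !inE.
by apply/negbTE; rewrite negb_and; apply/orP; right; rewrite /= ltn_eqF// (leq_trans (qM s)).
Qed.

Context {R : realType} (L : nat).

(** If [B] does not have [L] elements the list is truncated or padded with 0; only sets of size [L]
    enter the sums. *)
Definition stuple B : L.-tuple nat := [tuple nth 0%N (sampled B) i | i < L].

Lemma stupleE B : #|B| = L -> stuple B = sampled B :> seq nat.
Proof.
move=> BL; apply: (@eq_from_nth _ 0%N); first by rewrite size_tuple size_sampled.
move=> i; rewrite size_tuple => iL.
by rewrite -(tnth_nth 0%N _ (Ordinal iL)) tnth_mktuple.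
Qed.

Lemma sum_sorted_tuples (G : L.-tuple nat -> R) :
  \sum_(l \in [set l : L.-tuple nat | sorted leq l])
    ((\big[muln/1%N]_(i \in [set: nat]) 'C(class_size i, rho i l))%:R * G l) =
  \sum_(B : {set 'I_n} | #|B| == L) G (stuple B).
Proof.
apply: fsbig_fibers => [B /eqP BL|l ls].
  by rewrite /= stupleE//; exact: sampled_sorted.
have := sampled_fiber ls; rewrite /rho => ->.
rewrite -sum1_card natr_sum big_mkcond [RHS]big_mkcond/=; apply: eq_bigr => B _.
rewrite !inE; have [BL|BL] := eqVneq #|B| L.
  have -> : (stuple B == l) = (sampled B == l).
    by rewrite -val_eqE (_ : val (stuple B) = sampled B)//; exact: stupleE.
  by case: (_ == _).
by case: eqP => // Bl; move: BL; rewrite -(size_sampled B) Bl size_tuple eqxx.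
Qed.

Lemma count_lt_take (k j : nat) (l : seq nat) : sorted leq l ->
  count (fun a => (a < j)%N) (take k l) = minn k (count (fun a => (a < j)%N) l).
Proof.
elim: l k => [|x l IH] [|k] //=; rewrite ?min0n ?minn0// => xl.
have ls := path_sorted xl.
have [xj|jx] := ltnP x j; first by rewrite !add1n minnSS IH.
have l0 : count (fun a => (a < j)%N) l = 0%N.
  apply/eqP; rewrite -leqn0 leqNgt -has_count; apply/hasPn => y yl.
  by rewrite -leqNgt (leq_trans jx)//; exact: (allP (order_path_min leq_trans xl)).
by rewrite IH// l0 !minn0.
Qed.

Lemma count_ltS (j : nat) (l : seq nat) :
  count (fun a => (a < j.+1)%N) l = (count (fun a => (a < j)%N) l + count_mem j l)%N.
Proof. by elim: l => //= x l ->; rewrite ltnS leq_eqVlt; case: ltngtP => _ /=; lia. Qed.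

(** On a sorted sample [take k] selects the [k] shortest queues; level [j] gets the places left by
    shorter ones, up to its multiplicity. This is the origin of the minimum in [zeta]. *)
Lemma count_mem_take (k j : nat) (l : seq nat) : sorted leq l ->
  count_mem j (take k l) = minn (count_mem j l) (k - count (fun a => (a < j)%N) l).
Proof.
move=> ls; have := count_lt_take k j.+1 ls; rewrite !count_ltS count_lt_take//; lia.
Qed.

Lemma sum_nat_delta (a m p : nat) (f : nat -> R) :
  \sum_(m <= i < p) (a == i)%:R * f i = (m <= a < p)%:R * f a.
Proof.
have [/andP[ma ap]|h] := boolP (m <= a < p)%N.
  rewrite (bigD1_seq a) ?mem_index_iota ?ma ?ap ?iota_uniq//= eqxx mul1r big1 ?addr0//.
  by move=> i ia; rewrite eq_sym (negbTE ia) mul0r.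
rewrite mul0r big_nat big1// => i imp; case: eqP => [ai|]; last by rewrite mul0r.
by rewrite ai imp in h.
Qed.

Lemma card_samples : #|[set B : {set 'I_n} | #|B| == L]%SET| = 'C(n, L).
Proof. by rewrite card_draws card_ord. Qed.

Lemma size_split (j : nat) (l : seq nat) :
  size l = (count (fun a => (a < j)%N) l + count_mem j l + count (fun a => (j < a)%N) l)%N.
Proof. by elim: l => //= x l ->; case: ltngtP => _ /=; lia. Qed.

Lemma card_split (j : nat) B : #|B| = (#|[set s in B | (q s < j)%N]%SET| +
  #|[set s in B | q s == j]%SET| + #|[set s in B | (j < q s)%N]%SET|)%N.
Proof. by rewrite -size_sampled (size_split j) !count_sampled. Qed.

(* The total number, over all samples of [L] servers, of jobs sent to queues of
   length [j]. *)
Lemma sum_hits (k j : nat) :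
  \sum_(B : {set 'I_n} | #|B| == L) (count_mem j (take k (sampled B)))%:R =
  \sum_(0 <= i1 < k) \sum_(1 <= i2 < (L - i1).+1) (minn i2 (k - i1))%:R *
    ('C(less_size j, i1) * 'C(class_size j, i2) *
     'C(n - less_size j - class_size j, L - i1 - i2))%:R :> R.
Proof.
pose a B := #|[set s in B | (q s < j)%N]%SET|.
pose b B := #|[set s in B | q s == j]%SET|.
have abL B : (a B + b B <= #|B|)%N.
  by rewrite (card_split j B) leq_addr.
(* Samples are sorted by the numbers [i1] of shorter queues and [i2] of queues of length [j];
   outside the two ranges the contribution is 0. *)
transitivity (\sum_(B : {set 'I_n} | #|B| == L)
    \sum_(0 <= i1 < k) (a B == i1)%:R * \sum_(1 <= i2 < (L - i1).+1)
      (b B == i2)%:R * (minn i2 (k - i1))%:R : R).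
  apply: eq_bigr => B /eqP BL; rewrite count_mem_take ?sampled_sorted// !count_sampled.
  rewrite -/(a B) -/(b B) sum_nat_delta sum_nat_delta; have := abL B; rewrite BL => ab.
  case: (ltnP (a B) k) => ak /=; last by rewrite mul0r (eqP ak) minn0.
  case: (posnP (b B)) => b0 /=; first by rewrite b0 min0n mul0r mulr0.
  by rewrite ltnS leq_subRL ?(leq_trans (leq_addr _ _) ab)// ab !mul1r.
rewrite exchange_big/=; apply: eq_bigr => i1 _.
under eq_bigr do rewrite mulr_sumr.
rewrite exchange_big/= big_nat [RHS]big_nat; apply: eq_bigr => i2 i2L.
under eq_bigr do rewrite mulrA.
rewrite -mulr_suml mulrC; congr (_ * _).
(* Three classes of servers, shorter, equal and longer, to which [card_subsets_by_class] applies. *)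
pose o1 : 'I_3 := lift ord0 ord0; pose o2 : 'I_3 := lift ord0 (lift ord0 ord0).
pose c s := if (q s < j)%N then ord0 else if q s == j then o1 else o2.
have c0 s : (c s == ord0) = (q s < j)%N by rewrite /c; case: ltngtP.
have c1 s : (c s == o1) = (q s == j) by rewrite /c; case: ltngtP.
have c2 s : (c s == o2) = (j < q s)%N by rewrite /c; case: ltngtP.
pose m (i : 'I_3) := nth 0%N [:: i1; i2; (L - i1 - i2)%N] i.
have more : (n - less_size j - class_size j)%N = #|[set s | (j < q s)%N]%SET|.
  have := card_split j [set: 'I_n]%SET; rewrite cardsT card_ord.
  have e p : #|[set s in [set: 'I_n]%SET | p s]%SET| = #|[set s | p s]%SET|.
    by apply: eq_card => s; rewrite !inE.
  by rewrite !e /less_size /class_size => {1}->; rewrite -addnA !addKn.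
have := card_subsets_by_class c m; rewrite !big_ord_recl big_ord0 muln1 -/o1 -/o2.
have s0 : [set s | c s == ord0]%SET = [set s | (q s < j)%N]%SET.
  by apply/setP => s; rewrite !inE c0.
have s1 : [set s | c s == o1]%SET = [set s | q s == j]%SET.
  by apply/setP => s; rewrite !inE c1.
have s2 : [set s | c s == o2]%SET = [set s | (j < q s)%N]%SET.
  by apply/setP => s; rewrite !inE c2.
rewrite s0 s1 s2 -more /m /= mulnA => <-.
rewrite -sum1_card natr_sum big_mkcond [RHS]big_mkcond/=; apply: eq_bigr => B _.
have aB : #|[set s in B | c s == ord0]%SET| = a B by apply: eq_card => s; rewrite !inE c0.
have bB : #|[set s in B | c s == o1]%SET| = b B by apply: eq_card => s; rewrite !inE c1.
have tB : #|[set s in B | c s == o2]%SET| = #|[set s in B | (j < q s)%N]%SET|.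
  by apply: eq_card => s; rewrite !inE c2.
have i12 : (i1 + i2 <= L)%N.
  by case/andP: i2L => h1 h2; lia.
rewrite inE.
have -> : [forall i, #|[set s in B | c s == i]%SET| == m i] =
    [&& #|B| == L, a B == i1 & b B == i2].
  apply/forallP/and3P => [h|[/eqP BL /eqP aE /eqP bE] i].
    have := h ord0; have := h o1; have := h o2; rewrite aB bB tB /m /=.
    move=> /eqP h2 /eqP h1 /eqP h0; rewrite (card_split j B) -/(a B) -/(b B) h0 h1 h2 !eqxx.
    by split => //; apply/eqP; rewrite -subnDA addnC subnK.
  have := card_split j B; rewrite -/(a B) -/(b B) BL aE bE => LE.
  have [->|[->|->]] : i = ord0 \/ i = o1 \/ i = o2.
    case: i => -[|[|[|//]]] p; [left|right; left|right; right]; exact: val_inj.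
  - by rewrite aB aE.
  - by rewrite bB bE.
  - by rewrite tB /m /= {1}LE -addnA !addKn.
by case: (#|B| == L) => //; case: (a B == i1); case: (b B == i2); rewrite ?mulr1 ?mulr0.
Qed.

End Sampling.

(** * Hypergeometric against multinomial probabilities *)

Section FallingFactorial.
Context {R : realType}.

(** The next factor [(A - i) / n] is within [i / n] of [A / n], also when the subtraction truncates
    to 0 because then [A <= i]. *)
Lemma ffact_pow_dist (n A i : nat) : (0 < n)%N -> (A <= n)%N ->
  0 <= ((A ^_ i)%:R / n%:R ^+ i : R) <= 1 /\
  `|(A ^_ i)%:R / n%:R ^+ i - (A%:R / n%:R) ^+ i| <= (i * i)%:R / n%:R :> R.
Proof.
move=> n0 An; have n0' : 0 < n%:R :> R by rewrite ltr0n.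
have unit_frac (m : nat) : (m <= n)%N -> 0 <= (m%:R / n%:R : R) <= 1.
  by move=> mn; rewrite divr_ge0//= ler_pdivrMr// mul1r ler_nat.
elim: i => [|i [IH1 IH2]].
  by rewrite ffactn0 !expr0 divr1 ler01 lexx subrr normr0 mul0n mul0r.
have E : (A ^_ i.+1)%:R / n%:R ^+ i.+1 =
    ((A ^_ i)%:R / n%:R ^+ i) * ((A - i)%:R / n%:R) :> R.
  by rewrite ffactnSr natrM exprSr; field; rewrite gt_eqF//= expf_neq0// gt_eqF.
have Ai := unit_frac (A - i)%N (leq_trans (leq_subr _ _) An).
split; first by rewrite E; exact: mul_unit.
rewrite E exprSr (le_trans (dist_mul_unit _ _ _ _))// ?expr_unit ?unit_frac//.
have : `|(A - i)%:R / n%:R - A%:R / n%:R| <= i%:R / n%:R :> R.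
  rewrite -mulrBl normrM [X in _ * X]ger0_norm ?invr_ge0// ler_wpM2r ?invr_ge0//.
  have [iA|/ltnW Ai'] := leqP i A.
    by rewrite natrB// addrAC subrr sub0r normrN ger0_norm.
  by rewrite (eqP Ai') sub0r normrN ger0_norm// ler_nat.
move=> h; rewrite (le_trans (lerD IH2 h))// -mulrDl -natrD ler_wpM2r ?invr_ge0//.
by rewrite ler_nat mulSn mulnS; lia.
Qed.

Lemma ratio_identity (x y z w p1 p2 p3 f1 f2 f3 f : R) :
  w != 0 -> p1 != 0 -> p2 != 0 -> p3 != 0 -> f1 != 0 -> f2 != 0 -> f3 != 0 -> f != 0 ->
  (x / f1 * (y / f2) * (z / f3)) / (w / f) =
  f / (f1 * f2 * f3) * ((x / p1 * (y / p2) * (z / p3)) / (w / (p1 * p2 * p3))).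
Proof. by move=> *; field; do ?[apply/andP; split]. Qed.

(** Dividing by powers of [n] reduces to products of ratios in [[0, 1]]. The lower bound on [n]
    keeps the normaliser [q] above 1/2; the 8 is 4, from three numerator factors and [q], times the
    bound 2 on [q^-1]. *)
Lemma hypergeometric_multinomial (n A B C i1 i2 i3 L : nat) :
  (0 < n)%N -> (2 * (L * L) <= n)%N -> (A + B + C)%N = n -> (i1 + i2 + i3)%N = L ->
  `|('C(A, i1) * 'C(B, i2) * 'C(C, i3))%:R / 'C(n, L)%:R -
    L`!%:R / (i1`!%:R * i2`!%:R * i3`!%:R) *
      ((A%:R / n%:R) ^+ i1 * (B%:R / n%:R) ^+ i2 * (C%:R / n%:R) ^+ i3)|
  <= 8 * L`!%:R * (L * L)%:R / n%:R :> R.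
Proof.
move=> n0 nL ABC iL.
have [An Bn Cn] : [/\ (A <= n)%N, (B <= n)%N & (C <= n)%N] by split; lia.
have [i1L i2L i3L] : [/\ (i1 <= L)%N, (i2 <= L)%N & (i3 <= L)%N] by split; lia.
have n0' : 0 < n%:R :> R by rewrite ltr0n.
have nn0 : n%:R != 0 :> R by rewrite gt_eqF.
have [A1 A2] := @ffact_pow_dist n A i1 n0 An.
have [B1 B2] := @ffact_pow_dist n B i2 n0 Bn.
have [C1 C2] := @ffact_pow_dist n C i3 n0 Cn.
have [q1 q2] := @ffact_pow_dist n n L n0 (leqnn n).
rewrite divff// expr1n in q2.
have Ln i : (i <= L)%N -> (i * i)%:R / n%:R <= (L * L)%:R / n%:R :> R.
  by move=> iL'; rewrite ler_wpM2r ?invr_ge0// ler_nat leq_mul.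
have L1 := Ln i1 i1L; have L2 := Ln i2 i2L; have L3 := Ln i3 i3L.
move: A1 A2 B1 B2 C1 C2 q1 q2.
set a := _ / n%:R ^+ i1; set b := _ / n%:R ^+ i2; set c := _ / n%:R ^+ i3.
set q := _ / n%:R ^+ L.
set a' := _ ^+ i1; set b' := (B%:R / n%:R) ^+ i2; set c' := (C%:R / n%:R) ^+ i3.
move=> A1 A2 B1 B2 C1 C2 q1 q2.
have frac (m : nat) i : (m <= n)%N -> 0 <= ((m%:R / n%:R) ^+ i : R) <= 1.
  by move=> mn; apply: expr_unit; rewrite divr_ge0//= ler_pdivrMr// mul1r ler_nat.
have a'u : 0 <= a' <= 1 by exact: frac.
have b'u : 0 <= b' <= 1 by exact: frac.
have c'u : 0 <= c' <= 1 by exact: frac.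
have f0 m : m`!%:R != 0 :> R by rewrite pnatr_eq0 -lt0n fact_gt0.
have binE N m : 'C(N, m)%:R = (N ^_ m)%:R / m`!%:R :> R.
  by rewrite -bin_ffact natrM mulfK.
have Lq : (L * L)%:R / n%:R <= 1 / 2 :> R.
  by rewrite ler_pdivrMr// mulrAC mul1r ler_pdivlMr// mulrC -natrM ler_nat.
have qh : 1 / 2 <= q by move: q2; rewrite ler_norml => /andP[h _]; lra.
have q0 : 0 < q by lra.
pose M : R := L`!%:R / (i1`!%:R * i2`!%:R * i3`!%:R).
have M0 : 0 <= M by rewrite divr_ge0// !mulr_ge0.
have ML : M <= L`!%:R.
  have den : 0 < i1`!%:R * i2`!%:R * i3`!%:R :> R.
    by rewrite -!natrM ltr0n !muln_gt0 !fact_gt0.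
  by rewrite ler_pdivrMr// ler_peMr// -!natrM ler1n !muln_gt0 !fact_gt0.
have -> : ('C(A, i1) * 'C(B, i2) * 'C(C, i3))%:R / 'C(n, L)%:R = M * ((a * b * c) / q) :> R.
  rewrite !natrM !binE /M /a /b /c /q -[in n%:R ^+ L]iL !exprD.
  apply: ratio_identity; rewrite ?expf_neq0//.
  by move: (q0); rewrite /q; apply: contraTneq => ->; rewrite mul0r ltxx.
rewrite -/M -mulrBr normrM (ger0_norm M0).
move: (le_trans A2 L1) (le_trans B2 L2) (le_trans C2 L3) q2 Lq.
set e := (L * L)%:R / n%:R => A3 B3 C3 q3 e1.
have e0 : 0 <= e by exact: divr_ge0.
have p1 : `|a * b * c - a' * b' * c'| <= 3 * e.
  apply: le_trans (dist_mul_unit (mul_unit A1 B1) C1 (mul_unit a'u b'u) c'u) _.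
  apply: le_trans (lerD (le_trans (dist_mul_unit A1 B1 a'u b'u) (lerD A3 B3)) C3) _.
  by rewrite le_eqVlt; apply/orP; left; apply/eqP; ring.
have p'u : 0 <= a' * b' * c' <= 1 by exact: mul_unit (mul_unit a'u b'u) c'u.
have -> : a * b * c / q - a' * b' * c' =
    ((a * b * c - a' * b' * c') - (q - 1) * (a' * b' * c')) / q.
  by field; rewrite gt_eqF.
have qi0 : 0 <= q^-1 by rewrite invr_ge0 ltW.
rewrite normrM (ger0_norm qi0).
have num : `|a * b * c - a' * b' * c' - (q - 1) * (a' * b' * c')| <= 4 * e.
  rewrite (le_trans (ler_normB _ _))//.
  have q4 : `|(q - 1) * (a' * b' * c')| <= e.
    rewrite normrM (le_trans _ q3)// ler_piMr//.
    by case/andP: p'u => h1 h2; rewrite ger0_norm.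
  apply: le_trans (lerD p1 q4) _.
  by rewrite le_eqVlt; apply/orP; left; apply/eqP; ring.
have qi : q^-1 <= 2 by rewrite -[leRHS]invrK lef_pV2 ?posrE ?invr_gt0//; lra.
have h : `|a * b * c - a' * b' * c' - (q - 1) * (a' * b' * c')| * q^-1 <=
    4 * e * 2.
  by rewrite ler_pM// invr_ge0 ltW.
have h0 : 0 <= `|a * b * c - a' * b' * c' - (q - 1) * (a' * b' * c')| * q^-1.
  by rewrite mulr_ge0// invr_ge0 ltW.
apply: le_trans (ler_pM M0 h0 ML h) _.
by rewrite le_eqVlt; apply/orP; left; apply/eqP; rewrite /e; field.
Qed.

End FallingFactorial.

(** * The generator as a finite sum over transitions *)

Section Transitions.
Context {R : realType}.
Implicit Types (r : nat -> R) (n : nat).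

Lemma simplex_n_natr n r i : (0 < n)%N -> simplex_n n r ->
  (Num.truncn (n%:R * r i))%:R = n%:R * r i.
Proof.
move=> n0 [_ /(_ i)[m ->]].
by rewrite mulrCA divff ?mulr1 ?natrK// pnatr_eq0 -lt0n.
Qed.

Lemma simplex_n_finite n r : (0 < n)%N -> simplex_n n r ->
  exists M, forall i, (M <= i)%N -> r i = 0.
Proof.
move=> n0 rn; have n0' : 0 < n%:R :> R by rewrite ltr0n.
have /cvgrPdist_lt/(_ n%:R^-1) := simplex_cvg0 rn.1; rewrite invr_gt0 => /(_ n0')[M _ hM].
exists M => i Mi; have := hM i Mi; rewrite /= sub0r normrN ger0_norm; last first.
  exact: simplex_ge0 rn.1.
have [_ /(_ i)[m ->]] := rn.
rewrite -[X in _ < X]mul1r ltr_pM2r ?invr_gt0// (ltr_nat _ m 1) ltnS leqn0 => /eqP->.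
by rewrite mul0r.
Qed.

Fixpoint level_list (N : nat -> nat) (M : nat) : seq nat :=
  if M is M'.+1 then level_list N M' ++ nseq (N M') M' else [::].

Lemma size_level_list N M : size (level_list N M) = (\sum_(0 <= i < M) N i)%N.
Proof.
elim: M => [|M IH]; first by rewrite big_nil.
by rewrite /= size_cat size_nseq IH big_nat_recr.
Qed.

Lemma count_level_list N M i : count_mem i (level_list N M) = if (i < M)%N then N i else 0%N.
Proof.
elim: M => [//|M IH] /=; rewrite count_cat count_nseq IH /= ltnS.
case: ltngtP => [iM|Mi|->]; by rewrite ?mul1n ?mul0n ?addn0.
Qed.

(** Realising [r] by actual queue lengths turns the generator into a finite sum over servers and
    sets of servers, to which counting applies. *)
Lemma server_config n r : (0 < n)%N -> simplex_n n r ->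
  exists q : 'I_n -> nat, forall i, class_size q i = Num.truncn (n%:R * r i).
Proof.
move=> n0 rn; pose N i := Num.truncn (n%:R * r i).
have NE i : (N i)%:R = n%:R * r i by exact: simplex_n_natr.
have [M hM] := simplex_n_finite n0 rn.
have cM : cumul r M = 1.
  have cJ J : cumul r (J + M) = cumul r M.
    by elim: J => [//|J IH]; rewrite addSn cumulS IH hM ?addr0// leq_addl.
  have := cumul_cvg rn.1; rewrite -(cvg_shiftn M).
  under eq_fun do rewrite cJ.
  by move=> /cvg_lim <- //; apply/esym/cvg_lim => //; exact: cvg_cst.
have sz : size (level_list N M) = n.
  apply/eqP; rewrite -(eqr_nat R) size_level_list natr_sum.
  under eq_bigr do rewrite NE.
  by rewrite -mulr_sumr -/(cumul r M) cM mulr1.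
exists (fun s => nth 0%N (level_list N M) s) => i.
rewrite /class_size -/(N i).
transitivity (count_mem i (level_list N M)).
  rewrite -[in RHS](mkseq_nth 0%N (level_list N M)) sz /mkseq -val_enum_ord -map_comp count_map.
  rewrite -sum1_count big_enum_cond/= -sum1_card.
  by apply: eq_bigl => s; rewrite inE.
rewrite count_level_list; case: ltnP => // Mi.
by rewrite /N hM// mulr0 truncn0.
Qed.

Lemma less_size_natr n r (q : 'I_n -> nat) j : (0 < n)%N -> simplex_n n r ->
  (forall i, class_size q i = Num.truncn (n%:R * r i)) ->
  (less_size q j)%:R = n%:R * cumul r j.
Proof.
move=> n0 rn qr.
have e p : #|[set s | p (q s)]%SET| = count p (sampled q [set: 'I_n]%SET).
  by rewrite count_sampled; apply: eq_card => s; rewrite !inE.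
elim: j => [|j IH].
  rewrite cumul0 mulr0 /less_size; have -> : [set s | (q s < 0)%N]%SET = finset.set0.
    by apply/setP => s; rewrite !inE.
  by rewrite cards0.
rewrite /less_size (e (fun a => (a < j.+1)%N)) count_ltS natrD -(e (fun a => (a < j)%N)).
rewrite -/(less_size q j) IH -(e (pred1 j)) -/(class_size q j) qr simplex_n_natr//.
by rewrite cumulS mulrDr.
Qed.

Lemma cumul_unit (a j : nat) : cumul (@unit_vec R a) j = (a < j)%:R.
Proof.
elim: j => [|j IH]; first by rewrite cumul0.
rewrite cumulS IH /unit_vec ltnS; case: ltngtP => _; by rewrite ?addr0 ?add0r.
Qed.

Lemma sum_take (k L : nat) (l : L.-tuple nat) (f : nat -> R) : (k <= L)%N ->
  \sum_(i < L | (i < k)%N) f (tnth l i) = \sum_(a <- take k l) f a.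
Proof.
move=> kL; rewrite (big_nth 0%N) size_take size_tuple.
have -> : (if (k < L)%N then k else L) = k by case: ltngtP kL.
rewrite (eq_bigr (fun i : 'I_L => f (nth 0%N l i))); last by move=> i _; rewrite (tnth_nth 0%N).
rewrite (big_ord_narrow (F := fun i : 'I_L => f (nth 0%N l i)) kL) big_mkord.
by apply: eq_bigr => i _; rewrite nth_take.
Qed.

Lemma Delta_count (k L : nat) (l : L.-tuple nat) j : (k <= L)%N ->
  Delta k l j = (count (fun a => a.+1 == j) (take k l))%:R - (count_mem j (take k l))%:R :> R.
Proof.
move=> kL; rewrite /Delta (sum_take l (fun a => unit_vec a.+1 j) kL).
rewrite (sum_take l (fun a => unit_vec a j) kL) -!sum1_count !natr_sum.
by congr (_ - _); rewrite [RHS]big_mkcond; apply: eq_bigr => a _; rewrite /unit_vec /=;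
  case: eqP.
Qed.

(** A job that joins a queue of length [a] only removes that queue from those shorter than [a + 1];
    every other cumulative count is unchanged. *)
Lemma cumul_Delta (k L : nat) (l : L.-tuple nat) j : (k <= L)%N ->
  cumul (@Delta R k L l) j = - (count (fun a => a.+1 == j) (take k l))%:R.
Proof.
move=> kL; elim: j => [|j IH].
  by rewrite cumul0 (_ : count _ _ = 0%N) ?oppr0//; elim: (take k l).
by rewrite cumulS IH Delta_count//; ring.
Qed.

Lemma cumul_shift n r (D : nat -> R) j :
  cumul (fun i => r i + n%:R^-1 * D i) j = cumul r j + n%:R^-1 * cumul D j.
Proof. by rewrite /cumul big_split/= mulr_sumr. Qed.

Lemma simplex_n_shift n r (D : nat -> R) M : (0 < n)%N -> simplex_n n r ->
  (forall i, exists m : nat, n%:R * r i + D i = m%:R) ->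
  (forall J, (M <= J)%N -> cumul D J = 0) ->
  simplex_n n (fun i => r i + n%:R^-1 * D i).
Proof.
move=> n0 rn Dn DM; have n0' : n%:R != 0 :> R by rewrite pnatr_eq0 -lt0n.
have yE i : exists m : nat, r i + n%:R^-1 * D i = m%:R / n%:R.
  by have [m mE] := Dn i; exists m; rewrite -mE; field.
split => //; split; first by move=> i; have [m ->] := yE i; rewrite divr_ge0.
have := cumul_cvg rn.1; apply: cvg_trans; apply: near_eq_cvg; near=> J.
have MJ : (M <= J)%N by near: J; exact: nbhs_infty_ge.
change (cumul r J = cumul (fun i => r i + n%:R^-1 * D i) J).
by rewrite cumul_shift DM// mulr0 addr0.
Unshelve. all: by end_near. Qed.

End Transitions.

Section GeneratorRepresentation.
Context {R : realType} (k L : nat) (lambda : R).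
Hypotheses (lambda_ge0 : 0 <= lambda) (k_gt0 : (0 < k)%N) (k_le_L : (k <= L)%N).

(** The errors of [hypergeometric_multinomial], without the factor [1/n], summed with the
    multiplicities of [zeta]. *)
Definition hit_cst : R := \sum_(0 <= i1 < k) \sum_(1 <= i2 < (L - i1).+1)
  (minn i2 (k - i1))%:R * (8 * L`!%:R * (L * L)%:R).

Lemma hit_cst_ge0 : 0 <= hit_cst.
Proof. by rewrite sumr_ge0// => i1 _; rewrite sumr_ge0// => i2 _; rewrite !mulr_ge0. Qed.

Lemma count_succ (j : nat) (s : seq nat) :
  count (fun a => a.+1 == j) s = if j is j'.+1 then count_mem j' s else 0%N.
Proof. by case: j => [|j]; elim: s => //= a s ->. Qed.

Lemma split_index (M i1 i2 : nat) : (0 < i2)%N -> (i2 < (M - i1).+1)%N ->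
  (i1 + i2 + (M - i1 - i2))%N = M.
Proof. by move=> *; lia. Qed.

(* The generator at [r] as a finite sum over transitions [e], of rate [c e] and
   target [y e]; [inl B] is a request sampling the servers in [B] and [inr s]
   a service completion at server [s]. *)
Lemma generator_rep (n : nat) (r : nat -> R) :
  (0 < n)%N -> (2 * (L * L) <= n)%N -> (L <= n)%N -> simplex_n n r ->
  exists (TT : finType) (c : TT -> R) (y : TT -> nat -> R),
  [/\ forall f, generator k L lambda n f r = \sum_e c e * (f (y e) - f r),
      forall e, 0 <= c e,
      \sum_e c e <= n%:R * (lambda + k%:R),
      forall e, c e != 0 -> simplex_n n (y e) &
      forall j, `|\sum_e c e * (cumul (y e) j - cumul r j) - cdrift k L lambda j r|
          <= lambda * hit_cst / n%:R /\
        forall e, `|cumul (y e) j - cumul r j| <= L%:R / n%:R].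
Proof.
move=> n0 nL2 nL rn; have n0' : 0 < n%:R :> R by rewrite ltr0n.
have nn0 : n%:R != 0 :> R by rewrite gt_eqF.
have [q qr] := server_config n0 rn.
have qrR i : (class_size q i)%:R = n%:R * r i by rewrite qr simplex_n_natr.
pose C : R := 'C(n, L)%:R.
have C0 : 0 < C by rewrite ltr0n bin_gt0.
(* Impossible transitions, samples of the wrong size and services at empty queues, stay in the index
   type with rate 0. *)
pose c (e : {set 'I_n} + 'I_n) : R := match e with
  | inl B => if #|B| == L then n%:R * lambda / C else 0
  | inr s => if (0 < q s)%N then k%:R else 0 end.
pose D (e : {set 'I_n} + 'I_n) : nat -> R := match e with
  | inl B => Delta k (stuple q L B)
  | inr s => fun j => unit_vec (q s).-1 j - unit_vec (q s) j end.
pose y e : nat -> R := fun j => r j + n%:R^-1 * D e j.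
have cumulD e j : cumul (D e) j = match e with
  | inl B => - (count (fun a => a.+1 == j) (take k (stuple q L B)))%:R
  | inr s => ((q s).-1 < j)%N%:R - (q s < j)%N%:R end.
  by case: e => [B|s] /=; [exact: cumul_Delta|rewrite cumulB !cumul_unit].
have yD e j : cumul (y e) j - cumul r j = n%:R^-1 * cumul (D e) j.
  by rewrite /y cumul_shift addrAC subrr add0r.
have split_sum (G : {set 'I_n} + 'I_n -> R) : \sum_e c e * G e =
    n%:R * lambda / C * (\sum_(B : {set 'I_n} | #|B| == L) G (inl B)) +
    k%:R * \sum_(s | (0 < q s)%N) G (inr s).
  rewrite big_sumType/=; congr (_ + _); rewrite mulr_sumr [RHS]big_mkcond;
    by apply: eq_bigr => e _; case: ifP => _; rewrite ?mul0r.
exists ({set 'I_n} + 'I_n)%type, c, y; split.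
- move=> f; rewrite split_sum /generator; congr (_ * _ + _ * _).
    rewrite -(sum_sorted_tuples q (fun l => f (fun j => r j + n%:R^-1 * Delta k l j) - f r)).
    apply: eq_fsbigr => l _; congr (_%:R * _); apply: eq_fsbigr => i _.
    by rewrite qr.
  rewrite -(@fsbig_fibers R nat 'I_n q (fun s => (0 < q s)%N) [set i | (0 < i)%N]
    (fun i => n%:R * r i)
    (fun i => f (fun j => r j + n%:R^-1 * (unit_vec i.-1 j - unit_vec i j)) - f r))//.
  move=> i /= i0; rewrite -qrR /class_size -sum1_card natr_sum big_mkcond [RHS]big_mkcond.
  apply: eq_bigr => s _; rewrite inE; case: eqP => [->|_]; first by rewrite i0.
  by case: ifP.
- move=> [B|s] /=; case: ifP => // _.
  by apply: divr_ge0; [exact: mulr_ge0|exact: ltW].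
- have := split_sum (fun=> 1); under eq_bigr do rewrite mulr1.
  move=> ->; rewrite mulrDr lerD//.
    rewrite (_ : \sum_(B | _) _ = C) ?divfK ?gt_eqF//.
    rewrite /C -(card_samples n L) -sum1_card natr_sum.
    by apply: eq_bigl => B; rewrite inE.
  rewrite mulrC ler_wpM2r//.
  rewrite (_ : \sum_(s | _) _ = #|[set s | (0 < q s)%N]%SET|%:R); last first.
    by rewrite -sum1_card natr_sum; apply: eq_bigl => s; rewrite inE.
  by rewrite ler_nat (leq_trans (max_card _))// card_ord.
- have natD (a b : nat) : (b <= a)%N -> exists m : nat, a%:R - b%:R = m%:R :> R.
    by move=> ba; exists (a - b)%N; rewrite natrB.
  case=> [B|s] /=.
    case: ifP => [/eqP BL _|_]; last by rewrite eqxx.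
    pose l := stuple q L B.
    have lE : l = sampled q B :> seq nat by exact: stupleE.
    apply: (@simplex_n_shift _ _ _ _ (\max_(a <- l) a).+2) => // [i|J MJ].
      rewrite /D Delta_count// -qrR.
      have h : (count_mem i (take k l) <= class_size q i)%N.
        apply: (@leq_trans (count_mem i l)).
          by rewrite -[X in (_ <= count_mem i X)%N](cat_take_drop k) count_cat leq_addr.
        rewrite lE count_sampled /class_size; apply/subset_leq_card/fintype.subsetP => s.
        by rewrite !inE => /andP[].
      exists (class_size q i - count_mem i (take k l) +
        count (fun a => a.+1 == i) (take k l))%N.
      by rewrite natrD natrB//; rewrite /l; ring.
    rewrite /D cumul_Delta// count_succ; case: J MJ => // J MJ.
    rewrite (_ : count_mem J _ = 0%N) ?oppr0//.
    apply/eqP; rewrite -leqn0 leqNgt -has_count has_pred1; apply/negP => /mem_take Jl.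
    by have := @leq_bigmax_seq _ l xpredT id J Jl isT; rewrite leqNgt => /negP; apply.
  case: ifP => [qs _|]; last by rewrite eqxx.
  apply: (@simplex_n_shift _ _ _ _ (q s).+1) => // [i|J MJ].
    (* The server [s] itself lies in its class, so the decreased count is still a natural number. *)
    have N1 : (0 < class_size q (q s))%N.
      by rewrite card_gt0; apply/set0Pn; exists s; rewrite inE.
    rewrite /D -qrR /unit_vec; case: (eqVneq (q s) i) => [<-|qi].
      rewrite (_ : ((q s).-1 == q s) = false); last by case: (q s) qs => //= a _; rewrite ltn_eqF.
      by exists (class_size q (q s) - 1)%N; rewrite natrB// add0r.
    by rewrite subr0 -natrD; eexists.
  by rewrite cumulD (leq_ltn_trans (leq_pred _) MJ) MJ subrr.
- move=> j; split; last first.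
    move=> e; rewrite yD normrM [X in X * _]ger0_norm ?invr_ge0// mulrC ler_wpM2r ?invr_ge0//.
    rewrite cumulD; case: e => [B|s].
      rewrite normrN ger0_norm// ler_nat (leq_trans (count_size _ _))//.
      by rewrite size_take size_tuple; case: ltnP => // _.
    have : 1 <= L%:R :> R by rewrite ler1n (leq_trans k_gt0).
    by case: (_ < _)%N; case: (_ < _)%N => /= h; rewrite ?subrr ?subr0 ?sub0r ?normrN ?normr0 ?normr1// (le_trans _ h).
  under eq_bigr do rewrite yD.
  rewrite split_sum -!mulr_sumr.
  under eq_bigr do rewrite cumulD count_succ.
  under [X in _ + _ * (_ * X)]eq_bigr do rewrite cumulD.
  (* Only a departure from a queue of length exactly [j] creates a queue shorter than [j]. *)
  have dep : \sum_(s | (0 < q s)%N) (((q s).-1 < j)%N%:R - (q s < j)%N%:R) =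
      (if j is 0 then 0 else n%:R * r j) :> R.
    case: j => [|j]; first by rewrite big1// => s _; rewrite subrr.
    rewrite -qrR /class_size -sum1_card natr_sum big_mkcond [RHS]big_mkcond.
    apply: eq_bigr => s _; rewrite inE; case: (q s) => [//|a] /=.
    rewrite !ltnS eqSS; case: ltngtP => _ /=; by rewrite ?subrr ?subr0.
  rewrite dep; case: j {dep} => [|j].
    rewrite big1; last by move=> *; rewrite oppr0.
    rewrite !mulr0 addr0 /= subrr normr0.
    by rewrite divr_ge0// mulr_ge0// hit_cst_ge0.
  rewrite /cdrift sumrN.
  rewrite (eq_bigr (fun B => (count_mem j (take k (sampled q B)))%:R)); last first.
    by move=> B /eqP BL; rewrite stupleE.
  rewrite sum_hits.
  (* [S / C] is the mean number of jobs that a request sends to queues of length [j]; it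
     approximates [L! * zeta j r] term by term. *)
  set S := \sum_(0 <= i1 < k) _.
  have -> : n%:R * lambda / C * (n%:R^-1 * - S) + k%:R * (n%:R^-1 * (n%:R * r j.+1)) -
    (- (lambda * L`!%:R * zeta_pred k L j.+1 r) + k%:R * r j.+1) =
    lambda * - (S / C - L`!%:R * zeta k L j r).
    by rewrite /=; field; rewrite nn0 gt_eqF.
  rewrite normrM ger0_norm// normrN -mulrA ler_wpM2l//.
  rewrite zetaE; last exact: rn.1.
  rewrite /zt mulr_sumr /S mulr_suml -sumrB /hit_cst mulr_suml.
  rewrite (le_trans (ler_norm_sum _ _ _))//; apply: ler_sum => i1 _.
  rewrite mulr_sumr mulr_suml -sumrB mulr_suml.
  rewrite (le_trans (ler_norm_sum _ _ _))// big_nat [leRHS]big_nat; apply: ler_sum => i2 /andP[i20 i2L].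
  rewrite /zcoef.
  have cE : cumul r j = (less_size q j)%:R / n%:R.
    by rewrite (less_size_natr j n0 rn qr) mulrAC divff ?mul1r.
  have rE : r j = (class_size q j)%:R / n%:R by rewrite qrR mulrAC divff ?mul1r.
  pose C3 := (n - less_size q j - class_size q j)%N.
  have tot : (less_size q j + class_size q j + C3)%N = n.
    have h : (less_size q j.+1 <= n)%N by rewrite -[X in (_ <= X)%N]card_ord max_card.
    rewrite /C3 -subnDA subnKC// -(ler_nat R) natrD (less_size_natr j n0 rn qr) qrR -mulrDr.
    by rewrite -cumulS -(less_size_natr j.+1 n0 rn qr) ler_nat.
  have c3E : 1 - cumul r j.+1 = C3%:R / n%:R.
    have nE : n%:R = (less_size q j)%:R + (class_size q j)%:R + C3%:R :> R.
      by rewrite -!natrD tot.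
    rewrite cumulS cE rE (_ : C3%:R = n%:R - (less_size q j)%:R - (class_size q j)%:R); last first.
      by rewrite nE; ring.
    by field.
  rewrite c3E cE rE.
  have i123 : (i1 + i2 + (L - i1 - i2))%N = L.
    exact: split_index i20 i2L.
  have H := @hypergeometric_multinomial R n _ _ _ i1 i2 (L - i1 - i2)%N L n0 nL2 tot i123.
  rewrite -/C3 -[X in `|X|](_ : (minn i2 (k - i1))%:R *
    (('C(less_size q j, i1) * 'C(class_size q j, i2) * 'C(C3, L - i1 - i2))%:R / C -
     L`!%:R / (i1`!%:R * i2`!%:R * (L - i1 - i2)`!%:R) *
     (((less_size q j)%:R / n%:R) ^+ i1 * ((class_size q j)%:R / n%:R) ^+ i2 *
      (C3%:R / n%:R) ^+ (L - i1 - i2))) = _).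
    by rewrite normrM (ger0_norm (ler0n _ _)) -[leRHS]mulrA ler_wpM2l.
  rewrite mulrBr; congr (_ - _); first by rewrite mulrA.
  by rewrite !mulrA; congr (_ * _ * _ * _); rewrite -!mulrA mulrCA.
Qed.

End GeneratorRepresentation.

(** * One step of the chain *)

Section ExpSemigroup.
Context {R : realType}.

Lemma fact_ge_pow2 i : (2 ^ i.+1 <= i.+2`!)%N.
Proof.
elim: i => [//|i IH]; rewrite factS expnS leq_mul//.
Qed.

Lemma exp_tail_sum (z : R) N : 0 <= z <= 1 ->
  \sum_(0 <= i < N) (z ^+ i.+2 / i.+2`!%:R) <= z ^+ 2.
Proof.
move=> /andP[z0 z1].
apply: (@le_trans _ _ (\sum_(0 <= i < N) 2 ^- i * (z ^+ 2 / 2))).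
  apply: ler_sum => i _.
  have h1 : z ^+ i.+2 <= z ^+ 2 by rewrite -addn2 exprD ler_piMl ?sqr_ge0// exprn_ile1.
  have h2 : (i.+2`!%:R)^-1 <= 2 ^- i / 2 :> R.
    rewrite -invfM -exprSr lef_pV2 ?posrE ?exprn_gt0 ?ltr0n ?fact_gt0//.
    by rewrite -natrX ler_nat fact_ge_pow2.
  apply: le_trans (ler_pM _ _ h1 h2) _; rewrite ?exprn_ge0 ?invr_ge0//.
  by rewrite le_eqVlt; apply/orP; left; apply/eqP; ring.
rewrite -mulr_suml.
apply: (@le_trans _ _ (2 * (z ^+ 2 / 2))).
  by rewrite ler_wpM2r ?sum_geom_half// divr_ge0// sqr_ge0.
by rewrite mulrC divfK.
Qed.

Lemma exp_semigroup_approx (A : ((nat -> R) -> R) -> (nat -> R) -> R) (t c M : R)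
    (f : (nat -> R) -> R) (r : nat -> R) :
  0 <= t -> 0 <= c -> t * c <= 1 -> (forall m, `|iter m A f r| <= c ^+ m * M) ->
  `|exp_semigroup A t f r - (f r + t * A f r)| <= (t * c) ^+ 2 * M.
Proof.
move=> t0 c0 tc aM.
have M0 : 0 <= M by have := le_trans (normr_ge0 _) (aM 0%N); rewrite expr0 mul1r.
pose u m := t ^+ m / m`!%:R * iter m A f r.
have uM m : `|u m| <= (t * c) ^+ m / m`!%:R * M.
  rewrite /u normrM ger0_norm ?divr_ge0 ?exprn_ge0//.
  apply: le_trans (ler_wpM2l _ (aM m)) _; first by rewrite divr_ge0 ?exprn_ge0.
  by rewrite exprMn le_eqVlt; apply/orP; left; apply/eqP; ring.
have z01 : 0 <= t * c <= 1 by rewrite mulr_ge0.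
have tail N : \sum_(0 <= i < N) `|u i.+2| <= (t * c) ^+ 2 * M.
  apply: le_trans (ler_sum _ (fun i _ => uM i.+2)) _.
  by rewrite -mulr_suml ler_wpM2r// exp_tail_sum.
have part (v : nat -> R) N : \sum_(0 <= i < N.+2) v i = v 0 + v 1 + \sum_(0 <= i < N) v i.+2.
  by rewrite big_nat_recl// big_nat_recl// addrA.
have cv : cvgn (series u).
  apply: normed_cvg; apply: nondecreasing_is_cvgn.
    by apply/nondecreasing_seqP => N; rewrite /series/= [leRHS]big_nat_recr//= lerDl.
  exists (`|u 0| + `|u 1| + (t * c) ^+ 2 * M) => _ [N _ <-].
  apply: (@le_trans _ _ (\sum_(0 <= i < N.+2) `|u i|)).
    by rewrite /series/= big_nat_recr//= big_nat_recr//= -addrA lerDl addr_ge0.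
  by rewrite (part (fun i => `|u i|)) lerD2l.
have E : f r + t * A f r = u 0 + u 1.
  by rewrite /u /= fact0 expr0 expr1 !divr1 mul1r.
have bnd N : `|\sum_(0 <= i < N.+2) u i - (f r + t * A f r)| <= (t * c) ^+ 2 * M.
  rewrite part -E addrAC subrr add0r.
  by apply: le_trans (ler_norm_sum _ _ _) (tail N).
have near_bnd : \forall N \near \oo, `|\sum_(0 <= i < N) u i - (f r + t * A f r)| <= (t * c) ^+ 2 * M.
  by exists 2 => // -[|[|N]] //= _; exact: bnd.
rewrite ler_norml /exp_semigroup; apply/andP; split.
  rewrite lerBrDr; apply: limr_ge => //; apply: filterS near_bnd => N.
  by rewrite ler_norml => /andP[+ _]; rewrite lerBrDr.
rewrite lerBlDr; apply: limr_le => //; apply: filterS near_bnd => N.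
by rewrite ler_norml => /andP[_]; rewrite lerBlDr.
Qed.

End ExpSemigroup.

(** * Growth of the mean gap over one time step *)

Section OneStep.
Context {R : realType} (k L : nat) (lambda : R).
Hypotheses (lambda_ge0 : 0 <= lambda) (k_gt0 : (0 < k)%N) (k_le_L : (k <= L)%N).
Context (n : nat) (n_gt0 : (0 < n)%N) (n_large : (2 * (L * L) <= n)%N) (L_le_n : (L <= n)%N).
Local Notation K := (Fcst k L lambda).
Local Notation A := (generator k L lambda n).

(** Bound on the generator in supremum norm: the total jump rate, times 2 for a difference of two
    values. Its growth with [n] is why time steps must shrink before [n] grows. *)
Definition rate_cst : R := 2 * (n%:R * (lambda + k%:R)).

Lemma rate_cst_ge0 : 0 <= rate_cst.
Proof. by rewrite !mulr_ge0// addr_ge0. Qed.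

Lemma generator_bound f M r : (forall s, simplex_n n s -> `|f s| <= M) ->
  simplex_n n r -> `|A f r| <= rate_cst * M.
Proof.
move=> fM rn.
have [TT [c [y [fE c0 cs yn _]]]] := generator_rep lambda_ge0 k_gt0 k_le_L n_gt0 n_large L_le_n rn.
have M0 : 0 <= M by apply: le_trans (fM r rn).
rewrite fE (le_trans (ler_norm_sum _ _ _))//.
apply: (@le_trans _ _ (\sum_e c e * (2 * M))).
  apply: ler_sum => e _; rewrite normrM (ger0_norm (c0 e)).
  have [->|ce] := eqVneq (c e) 0; first by rewrite !mul0r.
  rewrite ler_wpM2l// (le_trans (ler_normB _ _))// mulr2n mulrDl mul1r lerD ?fM//.
  exact: yn.
rewrite -mulr_suml (le_trans (ler_wpM2r _ cs))// ?mulr_ge0//.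
by rewrite /rate_cst le_eqVlt; apply/orP; left; apply/eqP; ring.
Qed.

Lemma iter_generator_bound f M r m : (forall s, simplex_n n s -> `|f s| <= M) ->
  simplex_n n r -> `|iter m A f r| <= rate_cst ^+ m * M.
Proof.
move=> fM; elim: m r => [|m IH] r rn; first by rewrite expr0 mul1r fM.
by rewrite iterS exprS -mulrA; apply: generator_bound.
Qed.

(** The first summand is the drift error of [generator_rep], doubled by the derivative of the
    square; the second is the rate [n * (lambda + k)] times squared jumps [(L / n) ^+ 2]. The outer
    2 bounds the sum of the weights. *)
Definition noise_cst : R := 2 * (2 * (lambda * hit_cst k L) + (lambda + k%:R) * (L * L)%:R).

Lemma noise_cst_ge0 : 0 <= noise_cst.
Proof. by rewrite /noise_cst mulr_ge0// addr_ge0// !mulr_ge0// ?hit_cst_ge0// addr_ge0. Qed.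

Lemma generator_gap J r s : simplex_n n r -> simplex s ->
  A (fun r' => gap J (cumul r') (cumul s)) r <=
  \sum_(0 <= j < J) 2 ^- j * (2 * (cumul r j - cumul s j) * cdrift k L lambda j r)
    + noise_cst / n%:R.
Proof.
move=> rn sS; have n0' : 0 < n%:R :> R by rewrite ltr0n.
have [TT [c [y [fE c0 cs yn yd]]]] := generator_rep lambda_ge0 k_gt0 k_le_L n_gt0 n_large L_le_n rn.
rewrite fE.
have E e : gap J (cumul (y e)) (cumul s) - gap J (cumul r) (cumul s) =
  \sum_(0 <= j < J) 2 ^- j * (2 * (cumul r j - cumul s j) * (cumul (y e) j - cumul r j) +
     (cumul (y e) j - cumul r j) ^+ 2).
  by rewrite /gap -sumrB; apply: eq_bigr => j _; ring.
under eq_bigr do rewrite E mulr_sumr.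
rewrite exchange_big/=.
apply: (@le_trans _ _ (\sum_(0 <= j < J) (2 ^- j * (2 * (cumul r j - cumul s j) * cdrift k L lambda j r)
   + 2 ^- j * (noise_cst / 2 / n%:R)))); last first.
  rewrite big_split/= lerD2l -mulr_suml.
  apply: le_trans (ler_wpM2r _ (sum_geom_half _)) _.
    by rewrite !divr_ge0// noise_cst_ge0.
  by rewrite le_eqVlt; apply/orP; left; apply/eqP; field; rewrite gt_eqF.
apply: ler_sum => j _; have [yd1 yd2] := yd j.
under eq_bigr do rewrite mulrCA.
rewrite -mulr_sumr -mulrDr ler_wpM2l ?(ltW (half_pow_gt0 _))//.
under eq_bigr do rewrite mulrDr mulrCA.
rewrite big_split/= -mulr_sumr.
set d := cumul r j - cumul s j.
have d1 : `|d| <= 1 by apply: cumul_dist => //; exact: rn.1.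
set S := \sum_e _ in yd1 *.
have h1 : 2 * d * S <= 2 * d * cdrift k L lambda j r + 2 * (lambda * hit_cst k L / n%:R).
  rewrite -lerBlDl -mulrBr -[leLHS]mulrA ler_wpM2l//.
  apply: le_trans (ler_norm _) _; rewrite normrM.
  by apply: le_trans (ler_wpM2l (normr_ge0 _) yd1) _; rewrite ler_piMl// (le_trans _ yd1).
have h2 : \sum_e c e * (cumul (y e) j - cumul r j) ^+ 2 <= (lambda + k%:R) * (L * L)%:R / n%:R.
  apply: (@le_trans _ _ (\sum_e c e * (L%:R / n%:R) ^+ 2)).
    apply: ler_sum => e _; rewrite ler_wpM2l// -real_normK ?num_real//.
    by rewrite lerXn2r ?nnegrE// divr_ge0.
  rewrite -mulr_suml; apply: le_trans (ler_wpM2r _ cs) _; first exact: sqr_ge0.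
  by rewrite natrM le_eqVlt; apply/orP; left; apply/eqP; field; rewrite gt_eqF.
apply: le_trans (lerD h1 h2) _.
by rewrite -addrA lerD2l /noise_cst le_eqVlt; apply/orP; left; apply/eqP; field; rewrite gt_eqF.
Qed.

Lemma gap_le2 J (r s : nat -> R) : simplex r -> simplex s -> gap J (cumul r) (cumul s) <= 2.
Proof.
move=> rS sS; apply: le_trans (sum_geom_half J); apply: ler_sum => j _.
rewrite ler_piMr ?(ltW (half_pow_gt0 _))// -real_normK ?num_real//.
by rewrite exprn_ile1// cumul_dist.
Qed.

(** Collects the coefficients of [h ^+ 2]: the error of [gap_step] with [e = K ^+ 2 * h ^+ 2] and
    [h <= T], and the semigroup remainder for a function bounded by 2. It depends on [n] through
    [rate_cst], which is harmless because the grid is refined first. *)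
Definition step_cst (T : R) : R :=
  2 * (4 * K ^+ 2 + (2 * K + 2 * K ^+ 2 * T) ^+ 2) + 2 * rate_cst ^+ 2.

Lemma step_cst_ge0 T : 0 <= step_cst T.
Proof.
rewrite /step_cst addr_ge0//; apply: mulr_ge0 => //; last exact: sqr_ge0.
by apply: addr_ge0; [apply: mulr_ge0 => //; exact: sqr_ge0|exact: sqr_ge0].
Qed.

(** The second estimate is the approximate supermartingale property; the crude bound 6 serves
    integrability. *)
Lemma one_step T J h r s0 s1 : 0 <= h -> h <= T -> h * rate_cst <= 1 ->
  simplex_n n r -> simplex s0 -> simplex s1 ->
  (forall j, `|cumul s1 j - cumul s0 j - h * cdrift k L lambda j s0| <= K ^+ 2 * h ^+ 2) ->
  let f r' := gap J (cumul r') (cumul s1) in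
  `|exp_semigroup A h f r| <= 6 /\
  exp_semigroup A h f r <= (1 + h * (7 * K)) * gap J (cumul r) (cumul s0)
    + h * (2 * K * 2 ^- J + noise_cst / n%:R) + h ^+ 2 * step_cst T.
Proof.
move=> h0 hT hc rn s0S s1S sd f.
have K0 : 0 <= K by exact: Fcst_ge0.
have c0 := rate_cst_ge0.
have fM r' : simplex_n n r' -> `|f r'| <= 2.
  by move=> [r'S _]; rewrite ger0_norm ?gap_ge0// gap_le2.
have ap := exp_semigroup_approx h0 c0 hc (fun m => iter_generator_bound m fM rn).
have z1 : (h * rate_cst) ^+ 2 <= 1 by rewrite exprn_ile1// mulr_ge0.
split.
  have Af := generator_bound fM rn.
  have h1 : `|h * A f r| <= 2.
    rewrite normrM (ger0_norm h0); apply: le_trans (ler_wpM2l h0 Af) _.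
    by rewrite mulrA ler_piMl.
  have := fM r rn.
  rewrite (_ : exp_semigroup A h f r = (exp_semigroup A h f r - (f r + h * A f r)) +
    (f r + h * A f r)); last by ring.
  move=> h2; apply: le_trans (ler_normD _ _) _.
  apply: le_trans (lerD ap (ler_normD _ _)) _; lra.
have {ap} ap : exp_semigroup A h f r <= f r + h * A f r + (h * rate_cst) ^+ 2 * 2.
  by move: ap; rewrite ler_norml => /andP[_]; lra.
apply: le_trans ap _.
have gg := ler_wpM2l h0 (generator_gap J rn s1S).
have Kh0 : 0 <= K ^+ 2 * h ^+ 2 by apply: mulr_ge0; exact: sqr_ge0.
(* The chain is replaced by the virtual point [r + h * drift], whose Euler error is 0, and compared
   with the solution over the same step. *)
have step := @gap_step R J (cumul r) (cumul s0)
  (fun j => cumul r j + h * cdrift k L lambda j r) (cumul s1)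
  (fun j => cdrift k L lambda j r) (fun j => cdrift k L lambda j s0) h K (K ^+ 2 * h ^+ 2)
  h0 K0 Kh0.
have {}step : gap J (fun j => cumul r j + h * cdrift k L lambda j r) (cumul s1) <=
    gap J (cumul r) (cumul s0)
    + h * (K * (7 * gap J (cumul r) (cumul s0) + 2 * 2 ^- J))
    + 2 * (4 * (K ^+ 2 * h ^+ 2) + (2 * K * h + 2 * (K ^+ 2 * h ^+ 2)) ^+ 2).
  apply: le_trans (step _ _ _ _ _) _ => [j _|j _|j _|j _|j _|].
  - by apply: cumul_dist => //; exact: rn.1.
  - by apply: cdrift_bound => //; exact: rn.1.
  - exact: cdrift_bound.
  - by rewrite (_ : _ - _ = 0) ?normr0//; ring.
  - exact: sd.
  - by rewrite lerD2r lerD2l ler_wpM2l// gap_drift//; exact: rn.1.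
(* The generator term is linear in the drift at [r]; adding the nonnegative square completes it to
   the gap of the virtual point. *)
have low : f r + h * (\sum_(0 <= j < J) 2 ^- j *
      (2 * (cumul r j - cumul s1 j) * cdrift k L lambda j r)) <=
    gap J (fun j => cumul r j + h * cdrift k L lambda j r) (cumul s1).
  rewrite /f /gap mulr_sumr -big_split/=; apply: ler_sum => j _.
  rewrite [X in _ + X <= _]mulrCA -mulrDr ler_wpM2l ?(ltW (half_pow_gt0 _))//.
  have := sqr_ge0 (h * cdrift k L lambda j r).
  have -> : (cumul r j + h * cdrift k L lambda j r - cumul s1 j) ^+ 2 =
    (cumul r j - cumul s1 j) ^+ 2 +
    h * (2 * (cumul r j - cumul s1 j) * cdrift k L lambda j r) +
    (h * cdrift k L lambda j r) ^+ 2 by ring.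
  by lra.
have err : 2 * (4 * (K ^+ 2 * h ^+ 2) + (2 * K * h + 2 * (K ^+ 2 * h ^+ 2)) ^+ 2) +
    (h * rate_cst) ^+ 2 * 2 <= h ^+ 2 * step_cst T.
  rewrite (_ : _ + _ = h ^+ 2 * (2 * (4 * K ^+ 2 + (2 * K + 2 * K ^+ 2 * h) ^+ 2) +
     2 * rate_cst ^+ 2)); last by ring.
  rewrite ler_wpM2l ?sqr_ge0// lerD2r ler_wpM2l// lerD2l.
  have K20 : 0 <= 2 * K ^+ 2 by apply: mulr_ge0 => //; exact: sqr_ge0.
  apply: lerXn2r; rewrite ?nnegrE.
  - by apply: addr_ge0; [exact: mulr_ge0|exact: mulr_ge0].
  - by apply: addr_ge0; [exact: mulr_ge0|apply: mulr_ge0 => //; exact: le_trans hT].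
  - by rewrite lerD2l ler_wpM2l.
move: gg low step err.
set a := \sum_(0 <= j < J) _; set g := gap J (cumul r) (cumul s0); set x := f r.
set b := A f r; set v := noise_cst / n%:R; set w := 2 ^- J; set y := gap J _ _.
set z := 2 * (4 * _ + _); set rc := (h * rate_cst) ^+ 2; set sc := step_cst T.
move: a g x b v w y z rc sc => a g x b v w y z rc sc *; lra.
Qed.

End OneStep.

(** * The maximal inequality *)

Section Countability.
Context {R : realType}.

(** Enumerates, through lists of numerators, a countable set containing [simplex_n n]. *)
Definition decode_state (n m : nat) : nat -> R := fun i =>
  (nth 0%N (odflt [::] (unpickle m : option (seq nat))) i)%:R / n%:R.

Lemma simplex_n_countable n (r : nat -> R) : (0 < n)%N -> simplex_n n r ->
  exists m, r = decode_state n m.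
Proof.
move=> n0 rn; have [M hM] := simplex_n_finite n0 rn.
exists (pickle (mkseq (fun i => Num.truncn (n%:R * r i)) M)).
apply/funext => i; rewrite /decode_state pickleK /=.
have nn0 : n%:R != 0 :> R by rewrite pnatr_eq0 -lt0n.
have [iM|Mi] := ltnP i M; last by rewrite nth_default ?size_mkseq// mul0r hM.
by rewrite nth_mkseq// simplex_n_natr// mulrAC divff// mul1r.
Qed.

End Countability.

Section ChainMeasurability.
Context {R : realType} {d} {Omega : measurableType d} (P : probability Omega R).
Context (n : nat) (n_gt0 : (0 < n)%N) (A : ((nat -> R) -> R) -> (nat -> R) -> R).
Context (r0 : nat -> R) (X : R -> Omega -> nat -> R).
Hypothesis X_chain : markov_chain P (simplex_n n) A r0 X.

(** The states visited are countable, so any predicate on [X t] gives a countable union of the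
    generating events. *)
Lemma history_event (Q : (nat -> R) -> Prop) (t s : R) : 0 <= t -> t <= s ->
  history X s [set w | Q (X t w)].
Proof.
move=> t0 ts; have [_ XE _ _ _] := X_chain.
have -> : [set w | Q (X t w)] = \bigcup_m [set w | X t w = decode_state n m /\ Q (decode_state n m)].
  apply/seteqP; split => w /=.
    by move=> Qw; have [m mE] := simplex_n_countable n_gt0 (XE t w t0); exists m => //=; rewrite -mE.
  by move=> [m _ /= [-> ]].
pose S := [set B | exists (u : R) r, 0 <= u <= s /\ B = [set w | X u w = r]].
suff : forall m, @measurable _ (g_sigma_algebraType S)
    [set w | X t w = decode_state n m /\ Q (decode_state n m)].
  exact: bigcupT_measurable.
move=> m; have [Qm|nQm] := pselect (Q (decode_state n m)).
  rewrite (_ : [set w | _] = [set w | X t w = decode_state n m]).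
    by apply: sub_sigma_algebra; exists t, (decode_state n m); rewrite t0 ts.
  by apply/seteqP; split => w /= [].
rewrite (_ : [set w | _] = set0); first exact: measurable0.
by apply/seteqP; split => w /= [].
Qed.

Lemma history_measurable s (B : set Omega) : history X s B -> measurable B.
Proof.
apply: smallest_sub; first exact: sigma_algebra_measurable.
move=> _ [u [r [/andP[u0 _] ->]]]; have [_ _ Xm _ _] := X_chain.
exact: Xm.
Qed.

Lemma event_measurable (Q : (nat -> R) -> Prop) (t : R) : 0 <= t ->
  measurable [set w | Q (X t w)].
Proof. by move=> t0; apply: (@history_measurable t); exact: history_event. Qed.

Lemma chain_integrable (g : (nat -> R) -> R) (b t : R) (B : set Omega) : 0 <= t ->
  measurable B -> (forall r, simplex_n n r -> `|g r| <= b) ->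
  P.-integrable B (EFin \o (fun w => g (X t w))).
Proof.
move=> t0 mB gb; have [_ XE _ _ _] := X_chain.
apply: (bounded_integrable (b := b)) => //.
- by apply: le_lt_trans (probability_le1 _ mB) _; rewrite ltry.
- move=> _ Y mY; apply: measurableI => //.
  exact: (event_measurable (fun r => Y (g r)) t0).
- by move=> w _; apply: gb; exact: XE.
Qed.

Lemma chain_markov (f : (nat -> R) -> R) (b s t : R) (B : set Omega) :
  0 <= s -> 0 <= t -> history X s B -> (forall r, simplex_n n r -> `|f r| <= b) ->
  \int[P]_(w in B) f (X (s + t) w) = \int[P]_(w in B) exp_semigroup A t f (X s w).
Proof.
move=> s0 t0 sB fb; have [_ _ _ _ mk] := X_chain.
by rewrite /Rintegral mk//; exists b.
Qed.

Lemma fine_probability (B : set Omega) : measurable B -> (fine (P B))%:E = P B.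
Proof. by move=> mB; rewrite fineK// fin_num_measure. Qed.

Lemma fine_probability_itv (B : set Omega) : measurable B -> 0 <= fine (P B) <= 1.
Proof.
move=> mB; rewrite fine_ge0//= -lee_fin fine_probability//.
exact: probability_le1.
Qed.

End ChainMeasurability.

(** * First exit of the gap on a time grid *)

Section MaximalInequality.
Context {R : realType} (k L : nat) (lambda T : R).
Hypotheses (lambda_ge0 : 0 <= lambda) (T_ge0 : 0 <= T).
Hypotheses (k_gt0 : (0 < k)%N) (k_le_L : (k <= L)%N).
Context (n : nat) (n_gt0 : (0 < n)%N) (n_large : (2 * (L * L) <= n)%N) (L_le_n : (L <= n)%N).
Context {d} {Omega : measurableType d} (P : probability Omega R).
Context (r0 : nat -> R) (X : R -> Omega -> nat -> R).
Hypothesis X_chain : markov_chain P (simplex_n n) (generator k L lambda n) r0 X.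
Context (x : R -> nat -> R).
Local Notation K := (Fcst k L lambda).
Hypothesis x_simplex : forall t : R, 0 <= t <= T -> simplex (x t).
Hypothesis x_drift : forall (s t : R) j, 0 <= s -> s <= t -> t <= T ->
    `|cumul (x t) j - cumul (x s) j - (t - s) * cdrift k L lambda j (x s)| <=
      K ^+ 2 * (t - s) ^+ 2.
Context (J N : nat) (e : R) (e_gt0 : 0 < e) (N_gt0 : (0 < N)%N).
Local Notation h := (T / N%:R).
Hypothesis h_small : h * rate_cst k lambda n <= 1.

Definition fluct (t : R) (w : Omega) : R := gap J (cumul (X t w)) (cumul (x t)).

Definition quiet (i : nat) : set Omega :=
  [set w | forall i', (i' <= i)%N -> fluct (i'%:R * h) w < e].

Lemma h_ge0 : 0 <= h. Proof. by rewrite divr_ge0. Qed.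

Lemma grid_ge0 i : 0 <= i%:R * h. Proof. by rewrite mulr_ge0// h_ge0. Qed.

Lemma grid_le i : (i <= N)%N -> i%:R * h <= T.
Proof.
move=> iN; apply: (@le_trans _ _ (N%:R * h)).
  by rewrite ler_wpM2r ?h_ge0// ler_nat.
by rewrite mulrC divfK// pnatr_eq0 -lt0n.
Qed.

Lemma quiet_history i : history X (i%:R * h) (quiet i).
Proof.
pose S := [set B | exists (u : R) r, 0 <= u <= i%:R * h /\ B = [set w | X u w = r]].
have -> : quiet i = \bigcap_(i' in [set i' | (i' <= i)%N]) [set w | fluct (i'%:R * h) w < e].
  by apply/seteqP; split => w.
suff : @measurable _ (g_sigma_algebraType S)
  (\bigcap_(i' in [set i' | (i' <= i)%N]) [set w | fluct (i'%:R * h) w < e]) by [].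
apply: bigcap_measurable; first by exists 0%N.
move=> i' /= ii'.
apply: (history_event n_gt0 X_chain
  (fun r => gap J (cumul r) (cumul (x (i'%:R * h))) < e)); first exact: grid_ge0.
by rewrite ler_wpM2r ?h_ge0// ler_nat.
Qed.

Lemma quiet_measurable i : measurable (quiet i).
Proof. by apply: (history_measurable X_chain (s := i%:R * h)); exact: quiet_history. Qed.

Lemma fluct_bound i r : (i <= N)%N -> simplex_n n r ->
  `|gap J (cumul r) (cumul (x (i%:R * h)))| <= 2.
Proof.
move=> iN [rS _]; rewrite ger0_norm ?gap_ge0// gap_le2//.
by apply: x_simplex; rewrite grid_ge0 grid_le.
Qed.

Lemma fluct_integrable i B : (i <= N)%N -> measurable B ->
  P.-integrable B (EFin \o fluct (i%:R * h)).
Proof.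
move=> iN mB.
apply: (chain_integrable n_gt0 X_chain (g := fun r => gap J (cumul r) (cumul (x (i%:R * h))))) => //.
  exact: grid_ge0.
by move=> r; exact: fluct_bound.
Qed.

(* The mean of [fluct] stopped when it first reaches [e], its value then being
   lowered to [e]. *)
Definition balance (i : nat) : R :=
  \int[P]_(w in quiet i) fluct (i%:R * h) w + e * (1 - fine (P (quiet i))).

Definition step_noise : R :=
  h * (2 * K * 2 ^- J + noise_cst k L lambda / n%:R) + h ^+ 2 * step_cst k L lambda n T.

Lemma step_noise_ge0 : 0 <= step_noise.
Proof.
have K0 : 0 <= K by exact: Fcst_ge0.
apply: addr_ge0; apply: mulr_ge0; rewrite ?h_ge0 ?sqr_ge0 ?step_cst_ge0//.
apply: addr_ge0; last by rewrite divr_ge0// noise_cst_ge0.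
by apply: mulr_ge0; [exact: mulr_ge0|exact/ltW/half_pow_gt0].
Qed.

Lemma balance0 : balance 0 <= gap J (cumul r0) (cumul (x 0)).
Proof.
have [X0 _ _ _ _] := X_chain.
have V0 w : fluct (0%:R * h) w = gap J (cumul r0) (cumul (x 0)).
  by rewrite /fluct mul0r X0.
have PT : fine (P setT) = 1 by rewrite probability_setT.
rewrite /balance; have [lt|ge] := ltP (gap J (cumul r0) (cumul (x 0))) e.
  have -> : quiet 0 = setT.
    by apply/seteqP; split => w // _ i'; rewrite leqn0 => /eqP->; rewrite V0.
  rewrite PT subrr mulr0 addr0.
  under eq_Rintegral do rewrite V0.
  by rewrite Rintegral_cst// PT mulr1.
have -> : quiet 0 = set0.
  apply/seteqP; split => w //= /(_ 0%N (leqnn _)); rewrite V0.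
  by rewrite ltNge ge.
by rewrite Rintegral_set0 measure0 subr0 mulr1 add0r.
Qed.

(** The Markov property on [quiet i] gives the growth of the mean. On [loud], where the level [e] is
    first reached, the integral is at least [e] times the probability, which pays for the increase
    of [e * (1 - P (quiet _))]. *)
Lemma balanceS i : (i < N)%N -> balance i.+1 <= (1 + h * (7 * K)) * balance i + step_noise.
Proof.
move=> iN; have K0 : 0 <= K by exact: Fcst_ge0.
have [_ XE _ _ _] := X_chain.
pose V i := fluct (i%:R * h).
pose loud := quiet i `&` [set w | e <= V i.+1 w].
have mQ := quiet_measurable.
have mloud : measurable loud.
  apply: measurableI => //.
  by apply: (event_measurable n_gt0 X_chain (fun r => e <= gap J (cumul r) (cumul (x (i.+1%:R * h)))));
    exact: grid_ge0.
have split_quiet : quiet i = quiet i.+1 `|` loud.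
  apply/seteqP; split => w.
    move=> qw; have [lt|ge] := ltP (V i.+1 w) e; last by right.
    by left => i'; rewrite leq_eqVlt ltnS => /orP[/eqP->//|]; exact: qw.
  by case=> [qw i' ii'|[]//]; apply: qw; exact: leqW.
have disj : quiet i.+1 `&` loud = set0.
  apply/seteqP; split => w //= [/(_ i.+1 (leqnn _)) lt [_]]; rewrite /= leNgt.
  by rewrite /V lt.
have iV B j : (j <= N)%N -> measurable B -> P.-integrable B (EFin \o V j) by exact: fluct_integrable.
have Psplit : fine (P (quiet i)) = fine (P (quiet i.+1)) + fine (P loud).
  by rewrite split_quiet measureU// fineD// fin_num_measure.
have Isplit : \int[P]_(w in quiet i) V i.+1 w =
    \int[P]_(w in quiet i.+1) V i.+1 w + \int[P]_(w in loud) V i.+1 w.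
  rewrite split_quiet Rintegral_setU//; last by apply/disj_setPS; rewrite disj.
  by apply: iV => //; exact: measurableU.
have loud_low : e * fine (P loud) <= \int[P]_(w in loud) V i.+1 w.
  rewrite -(Rintegral_cst P mloud e); apply: le_Rintegral => //.
  - apply: (bounded_integrable (b := `|e|)) => //.
    by apply: le_lt_trans (probability_le1 _ mloud) _; rewrite ltry.
  - exact: iV.
  - by move=> w [].
have tS : i.+1%:R * h = i%:R * h + h by rewrite -natr1 mulrDl mul1r.
have iT := grid_le iN; rewrite tS in iT.
have h0 := h_ge0; have t0 := grid_ge0 i.
pose f r := gap J (cumul r) (cumul (x (i.+1%:R * h))).
have OS r : simplex_n n r -> `|exp_semigroup (generator k L lambda n) h f r| <= 6 /\
    exp_semigroup (generator k L lambda n) h f r <=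
    (1 + h * (7 * K)) * gap J (cumul r) (cumul (x (i%:R * h))) + step_noise.
  move=> rn.
  have hT : h <= T by rewrite ler_pdivrMr ?ltr0n// ler_peMr// ler1n.
  have s0S : simplex (x (i%:R * h)) by apply: x_simplex; rewrite t0 (grid_le (ltnW iN)).
  have s1S : simplex (x (i.+1%:R * h)) by apply: x_simplex; rewrite grid_ge0 (grid_le iN).
  have := @one_step R k L lambda lambda_ge0 k_gt0 k_le_L n n_gt0 n_large L_le_n T J h r
    (x (i%:R * h)) (x (i.+1%:R * h)) h0 hT h_small rn s0S s1S.
  rewrite /step_noise addrA; apply => j.
  have := x_drift j t0 _ iT; rewrite lerDl => /(_ h0).
  by rewrite -tS (_ : i.+1%:R * h - i%:R * h = h)//; rewrite tS; ring.
have int_exp : P.-integrable (quiet i)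
    (EFin \o (fun w => exp_semigroup (generator k L lambda n) h f (X (i%:R * h) w))).
  apply: (chain_integrable n_gt0 X_chain (b := 6)) => // r rn.
  by have [] := OS r rn.
have mk : \int[P]_(w in quiet i) V i.+1 w =
    \int[P]_(w in quiet i) exp_semigroup (generator k L lambda n) h f (X (i%:R * h) w).
  rewrite -(chain_markov X_chain (b := 2) t0 h0 (@quiet_history i)).
    by rewrite -tS.
  by move=> r rn; exact: fluct_bound.
pose g w := (1 + h * (7 * K)) * V i w + step_noise.
have c1 : 0 <= 1 + h * (7 * K) by rewrite addr_ge0// mulr_ge0// mulr_ge0.
have iVi := iV (quiet i) i (ltnW iN) (mQ i).
have ig1 : P.-integrable (quiet i) (EFin \o (fun w => (1 + h * (7 * K)) * V i w)).
  by have := integrableZl (mQ i) (1 + h * (7 * K)) iVi; apply: eq_integrable.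
have ig2 : P.-integrable (quiet i) (EFin \o (cst step_noise : Omega -> R)).
  apply: (bounded_integrable (b := `|step_noise|)) => //.
  by apply: le_lt_trans (probability_le1 _ (mQ i)) _; rewrite ltry.
have ig : P.-integrable (quiet i) (EFin \o g).
  by have := integrableD (mQ i) ig1 ig2; apply: eq_integrable.
have up : \int[P]_(w in quiet i) V i.+1 w <=
    (1 + h * (7 * K)) * \int[P]_(w in quiet i) V i w + step_noise.
  rewrite mk; apply: (@le_trans _ _ (\int[P]_(w in quiet i) g w)).
    apply: le_Rintegral => // w _.
    by have [_] := OS (X (i%:R * h) w) (XE _ w t0).
  rewrite RintegralD// RintegralZl// lerD2l Rintegral_cst//.
  rewrite ler_piMr ?step_noise_ge0//.
  by have /andP[] := fine_probability_itv P (mQ i).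
have p01 : 0 <= 1 - fine (P (quiet i)).
  by rewrite subr_ge0; have /andP[] := fine_probability_itv P (mQ i).
(* The part already stopped keeps its value, so multiplying it by [1 + h * (7 * K)] only helps. *)
have ep : 0 <= h * (7 * K) * (e * (1 - fine (P (quiet i)))).
  apply: mulr_ge0; first by apply: mulr_ge0 => //; exact: mulr_ge0.
  by apply: mulr_ge0 => //; exact: ltW.
rewrite /balance -/(V i) -/(V i.+1).
move: up loud_low ep; rewrite Isplit Psplit.
move: (\int[P]_(w in quiet i) V i w) (\int[P]_(w in quiet i.+1) V i.+1 w) (\int[P]_(w in loud) V i.+1 w).
move: (fine (P (quiet i.+1))) (fine (P loud)) (h * (7 * K)) step_noise => p1 p2 c s I0 I1 I2 *.
lra.
Qed.

Lemma maximal_inequality : e * (1 - fine (P (quiet N))) <=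
  expR (T * (7 * K)) * (gap J (cumul r0) (cumul (x 0)) +
    (T * (2 * K * 2 ^- J + noise_cst k L lambda / n%:R)
     + T ^+ 2 * step_cst k L lambda n T / N%:R)).
Proof.
have K0 : 0 <= K by exact: Fcst_ge0.
have N0 : N%:R != 0 :> R by rewrite pnatr_eq0 -lt0n.
have p01 i : 0 <= 1 - fine (P (quiet i)).
  by rewrite subr_ge0; have /andP[] := fine_probability_itv P (quiet_measurable i).
have b0 i : e * (1 - fine (P (quiet i))) <= balance i.
  by rewrite lerDr Rintegral_ge0// => w _; exact: gap_ge0.
have bal0 : 0 <= balance 0 by apply: le_trans (b0 0%N); rewrite mulr_ge0// ltW.
have c0 : 0 <= h * (7 * K) by rewrite mulr_ge0 ?h_ge0// mulr_ge0.
have := gronwall c0 step_noise_ge0 bal0 balanceS.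
rewrite (_ : N%:R * (h * (7 * K)) = T * (7 * K)); last by field.
move=> g; apply: le_trans (b0 N) (le_trans g _).
rewrite ler_wpM2l ?expR_ge0// lerD ?balance0//.
rewrite /step_noise; set a := 2 * K * _ + _; set s := step_cst _ _ _ _ _.
by rewrite le_eqVlt; apply/orP; left; apply/eqP; field.
Qed.

End MaximalInequality.

(** * Convergence *)

Section UniformBound.
Context {R : realType} (k L : nat) (lambda T : R).
Hypotheses (lambda_ge0 : 0 <= lambda) (T_ge0 : 0 <= T).
Hypotheses (k_gt0 : (0 < k)%N) (k_le_L : (k <= L)%N).
Context (n : nat) (n_gt0 : (0 < n)%N) (n_large : (2 * (L * L) <= n)%N) (L_le_n : (L <= n)%N).
Context {d} {Omega : measurableType d} (P : probability Omega R).
Context (r0 : nat -> R) (X : R -> Omega -> nat -> R).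
Hypothesis X_chain : markov_chain P (simplex_n n) (generator k L lambda n) r0 X.
Context (x : R -> nat -> R).
Local Notation K := (Fcst k L lambda).
Hypothesis x_simplex : forall t : R, 0 <= t <= T -> simplex (x t).
Hypothesis x_drift : forall (s t : R) j, 0 <= s -> s <= t -> t <= T ->
    `|cumul (x t) j - cumul (x s) j - (t - s) * cdrift k L lambda j (x s)| <=
      K ^+ 2 * (t - s) ^+ 2.
Context (J : nat) (e : R) (e_gt0 : 0 < e).

Lemma x_lip (s t : R) j : 0 <= s -> s <= t -> t <= T ->
  `|cumul (x t) j - cumul (x s) j| <= (K + K ^+ 2 * T) * (t - s).
Proof.
move=> s0 st tT; have K0 : 0 <= K by exact: Fcst_ge0.
have ts : 0 <= t - s by rewrite subr_ge0.
have sS : simplex (x s) by apply: x_simplex; rewrite s0 (le_trans st).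
rewrite (_ : _ - _ = (cumul (x t) j - cumul (x s) j - (t - s) * cdrift k L lambda j (x s)) +
  (t - s) * cdrift k L lambda j (x s)); last by ring.
apply: le_trans (ler_normD _ _) _.
apply: le_trans (lerD (x_drift j s0 st tT) (lexx _)) _.
rewrite normrM (ger0_norm ts).
have h1 : (t - s) * `|cdrift k L lambda j (x s)| <= (t - s) * K.
  by rewrite ler_wpM2l// cdrift_bound.
have h2 : K ^+ 2 * (t - s) ^+ 2 <= K ^+ 2 * T * (t - s).
  by rewrite expr2 (expr2 (t - s)) -!mulrA !ler_wpM2l// ler_wpM2r//; lra.
apply: le_trans (lerD h2 h1) _.
by rewrite le_eqVlt; apply/orP; left; apply/eqP; ring.
Qed.

Lemma fluct_right_cvg w (t : R) : 0 <= t -> t < T ->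
  fluct X x J s w @[s --> t^'+] --> fluct X x J t w.
Proof.
move=> t0 tT; have K0 : 0 <= K by exact: Fcst_ge0.
have [_ _ _ /(_ w) Xc _] := X_chain; have [XS Xr _] := Xc t t0.
have near0 : \forall s \near t^'+, t <= s.
  by near=> s; apply: ltW; near: s; exact: nbhs_right_gt.
have cX j : cumul (X s w) j @[s --> t^'+] --> cumul (X t w) j.
  apply: d0_cumul => //; apply: filterS near0 => s ts.
  by have [] := Xc s (le_trans t0 ts).
pose C := K + K ^+ 2 * T.
have C0 : 0 <= C by apply: addr_ge0 => //; apply: mulr_ge0 => //; exact: sqr_ge0.
have cx j : cumul (x s) j @[s --> t^'+] --> cumul (x t) j.
  apply/cvgrPdist_le => eps eps0.
  have d1 : t < t + eps / (C + 1) by rewrite ltrDl divr_gt0// ltr_wpDl.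
  near=> s.
  have ts : t <= s by near: s.
  have sT : s <= T by apply: ltW; near: s; exact: nbhs_right_lt.
  have sd : s < t + eps / (C + 1) by near: s; exact: nbhs_right_lt.
  rewrite distrC (le_trans (x_lip j t0 ts sT))//.
  apply: (@le_trans _ _ ((C + 1) * (s - t))).
    by rewrite ler_wpM2r ?subr_ge0// lerDl.
  by rewrite mulrC -ler_pdivlMr ?ltr_wpDl// lerBlDl ltW.
rewrite /fluct /gap; elim: J => [|m IH].
  under eq_fun do rewrite big_nil; rewrite big_nil; exact: cvg_cst.
under eq_fun do rewrite big_nat_recr//=.
rewrite big_nat_recr//=; apply: cvgD => //; apply: cvgM; first exact: cvg_cst.
by rewrite expr2; under eq_fun do rewrite expr2; apply: cvgM; apply: cvgB.
Unshelve. all: by end_near. Qed.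

(** With [2 ^ m] steps the grids are nested, so these events increase with [m]. *)
Definition loud_grid (m : nat) : set Omega := ~` quiet T X x J (2 ^ m) e (2 ^ m).

Definition exit_bound : R := expR (T * (7 * K)) *
  (gap J (cumul r0) (cumul (x 0)) + T * (2 * K * 2 ^- J + noise_cst k L lambda / n%:R)) / e.

Lemma loud_grid_measurable m : measurable (loud_grid m).
Proof.
apply: measurableC; apply: (quiet_measurable T_ge0 n_gt0 X_chain).
Qed.

Lemma loud_grid_nd m m' : (m <= m')%N -> loud_grid m `<=` loud_grid m'.
Proof.
move=> mm'; apply: subsetC => w q i im.
have two m0 : (2 ^ m0)%:R != 0 :> R by rewrite pnatr_eq0 expn_eq0.
have := q (i * 2 ^ (m' - m))%N.
rewrite (_ : (i * 2 ^ (m' - m))%N%:R * (T / (2 ^ m')%:R) = i%:R * (T / (2 ^ m)%:R)); last first.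
  rewrite -[in (2 ^ m')%:R](subnKC mm') expnD !natrM; field.
  by rewrite !two.
apply; rewrite -[X in (_ <= 2 ^ X)%N](subnKC mm') expnD leq_mul2r im orbT//.
Qed.

(** By monotonicity the event is estimated on ever finer grids [m' >= m], where the steps become
    small enough for the maximal inequality and the [step_cst] term tends to 0. *)
Lemma loud_grid_bound m : (P (loud_grid m) <= exit_bound%:E)%E.
Proof.
have mq m' : measurable (quiet T X x J (2 ^ m') e (2 ^ m')).
  exact: (quiet_measurable T_ge0 n_gt0 X_chain).
have PC m' : fine (P (loud_grid m')) = 1 - fine (P (quiet T X x J (2 ^ m') e (2 ^ m'))).
  by rewrite /loud_grid probability_setC// fineB// fin_num_measure.
rewrite -fine_probability ?lee_fin; last exact: loud_grid_measurable.
pose c := T * (2 * K * 2 ^- J + noise_cst k L lambda / n%:R).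
pose g0 := gap J (cumul r0) (cumul (x 0)).
pose s := step_cst k L lambda n T.
pose b m' := expR (T * (7 * K)) * (g0 + (c + T ^+ 2 * s * 2 ^- m')) / e.
have bc : b m' @[m' --> \oo] --> exit_bound.
  rewrite /exit_bound -/c -/g0 -[X in g0 + X]addr0.
  apply: cvgM; last exact: cvg_cst.
  apply: cvgM; first exact: cvg_cst.
  apply: cvgD; first exact: cvg_cst.
  by apply: cvgD; [exact: cvg_cst|exact: half_pow_cvg].
apply: cvgr_to_ge bc _.
have /cvgrPdist_le/(_ 1 ltr01) small := half_pow_cvg (T * rate_cst k lambda n).
near=> m'.
have mm' : (m <= m')%N by near: m'; exact: nbhs_infty_ge.
have hs : T / (2 ^ m')%:R * rate_cst k lambda n <= 1.
  have : `|0 - T * rate_cst k lambda n * 2 ^- m'| <= 1 by near: m'.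
  by rewrite sub0r normrN => /(le_trans (ler_norm _)); rewrite natrX mulrAC.
apply: (@le_trans _ _ (fine (P (loud_grid m')))).
  rewrite -lee_fin !fine_probability; try exact: loud_grid_measurable.
  by apply: le_measure; rewrite ?inE; [exact: loud_grid_measurable..|exact: loud_grid_nd].
rewrite PC /b ler_pdivlMr// mulrC.
have N0 : (0 < 2 ^ m')%N by rewrite expn_gt0.
have := maximal_inequality lambda_ge0 T_ge0 k_gt0 k_le_L n_gt0 n_large L_le_n X_chain
  x_simplex x_drift J e_gt0 N0 hs.
by rewrite natrX.
Unshelve. all: by end_near. Qed.

(** The event ranges over a continuum of times, hence the outer measure; right continuity places it
    inside the countable union of the measurable grid events. *)
Lemma exit_probability :
  ((P^*)%mu [set w | exists2 t : R, (0 <= t <= T)%R & (e < fluct X x J t w)%R] <= exit_bound%:E)%E.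
Proof.
have mU : measurable (\bigcup_m loud_grid m).
  by apply: bigcupT_measurable => m; exact: loud_grid_measurable.
apply: (@le_trans _ _ (P (\bigcup_m loud_grid m))); last first.
  have c := @nondecreasing_cvg_mu _ _ _ P loud_grid loud_grid_measurable mU.
  have {}c : (P \o loud_grid) m @[m --> \oo] --> P (\bigcup_m loud_grid m).
    by apply: c => m m' mm'; rewrite subsetEset; exact: loud_grid_nd.
  rewrite -(cvg_lim _ c)//; apply: lime_le; first by apply/cvg_ex; eexists; exact: c.
  by apply: nearW => m; exact: loud_grid_bound.
rewrite -(measurable_mu_extE P mU); apply: le_mu_ext => w [t /andP[t0 tT] bad].
apply: contrapT => nU.
have q m : quiet T X x J (2 ^ m) e (2 ^ m) w.
  by apply: contrapT => nq; apply: nU; exists m.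
have grid m i : (i <= 2 ^ m)%N -> fluct X x J (i%:R * (T / (2 ^ m)%:R)) w < e by exact: q.
(* The end point has no right neighbourhood in [[0, T]], but it is a node of every grid. *)
move: tT; rewrite le_eqVlt => /orP[/eqP tT|tT].
  have := grid 0%N 1%N (leqnn _); rewrite expn0 divr1 mul1r -tT.
  by rewrite ltNge (ltW bad).
have /cvgr_gt/(_ _ bad) := fluct_right_cvg (w := w) t0 tT.
move=> [del /= del0 near_bad].
have [m _ /(_ m (leqnn m))] := (cvgrPdist_lt _ _).1 (half_pow_cvg T) _ del0.
rewrite /= sub0r normrN => hm.
have T0 : 0 < T by exact: le_lt_trans tT.
pose h := T / (2 ^ m)%:R.
have h0 : 0 < h by rewrite divr_gt0// ltr0n expn_gt0.
have hdel : h < del by rewrite /h natrX (le_lt_trans (ler_norm _) hm).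
have th : 0 <= t / h by rewrite divr_ge0// ltW.
have /andP[i1 i2] := truncn_itv th.
(* Node [i + 1] is the first grid point strictly after [t], at distance at most [h < del]. *)
set i := Num.truncn (t / h) in i1 i2.
rewrite ler_pdivlMr// in i1; rewrite ltr_pdivrMr// in i2.
have im : (i.+1 <= 2 ^ m)%N.
  rewrite -(ltr_nat R) -(ltr_pM2r h0) (le_lt_trans i1)// (lt_le_trans tT)//.
  by rewrite /h mulrC divfK// pnatr_eq0 expn_eq0.
have := grid m i.+1 im; rewrite -/h; apply/negP; rewrite -leNgt; apply: ltW.
apply: near_bad => //=.
rewrite /ball/= ltr_norml; apply/andP; split.
  by move: i1 i2; rewrite -natr1 mulrDl mul1r; lra.
by move: i1 i2; rewrite -natr1 mulrDl mul1r; lra.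
Qed.

End UniformBound.

(** * From the gap to the Skorohod distance *)

Section Skorohod.
Context {R : realType}.

Lemma time_change_id (T : R) : time_change T (@idfun R).
Proof. by split => //; rewrite image_id. Qed.

Lemma skorohod_le_sup (T : R) (x y : R -> nat -> R) (e : R) : 0 <= T -> 0 <= e ->
  (forall t, 0 <= t <= T -> d0 (x t) (y t) <= e) -> skorohod T x y <= e.
Proof.
move=> T0 e0 xy; apply: ge_inf.
  exists 0 => e' [h [_ /(_ 0)]]; rewrite lexx T0 => /(_ isT)[le _].
  exact: le_trans le.
exists idfun; split; first exact: time_change_id.
by move=> t tT; rewrite subrr normr0; split => //; exact: xy.
Qed.

Lemma gap_cvg {X : Type} {FF : set_system X} {_ : ProperFilter FF} (J : nat)
    (r : X -> nat -> R) (s : nat -> R) :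
  (\forall x \near FF, simplex (r x)) -> simplex s ->
  d0 (r x) s @[x --> FF] --> (0 : R) -> gap J (cumul (r x)) (cumul s) @[x --> FF] --> (0 : R).
Proof.
move=> rS sS rs.
have <- : gap J (cumul s) (cumul s) = 0.
  by rewrite /gap big1// => j _; rewrite subrr expr0n mulr0.
rewrite /gap; elim: J => [|J IH].
  under eq_fun do rewrite big_nil; rewrite big_nil; exact: cvg_cst.
under eq_fun do rewrite big_nat_recr//=.
rewrite big_nat_recr//=; apply: cvgD => //; apply: cvgM; first exact: cvg_cst.
rewrite expr2; under eq_fun do rewrite expr2.
by apply: cvgM; (apply: cvgB; [exact: d0_cumul|exact: cvg_cst]).
Qed.

Lemma d0_le_gap (r s : nat -> R) (a : R) (J0 J : nat) : simplex r -> simplex s ->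
  0 <= a -> (J0 < J)%N -> gap J (cumul r) (cumul s) <= 2 ^- J0 * a ^+ 2 ->
  d0 r s <= 4 * a + 2 * 2 ^- J0.
Proof.
move=> rS sS a0 J0J g; apply: d0_le_cumul => // j jJ0.
have h := le_trans (gap_coord _ _ (leq_ltn_trans jJ0 J0J)) g.
have w0 := half_pow_gt0 (R := R) j.
have : 2 ^- j * (cumul r j - cumul s j) ^+ 2 <= 2 ^- j * a ^+ 2.
  apply: le_trans h _; rewrite ler_wpM2r ?sqr_ge0//.
  by rewrite lef_pV2 ?posrE ?exprn_gt0// ler_weXn2l// ler1n.
rewrite ler_pM2l// -real_normK ?num_real// => h2.
by rewrite -(@ler_pXn2r _ 2) ?nnegrE.
Qed.

End Skorohod.

Theorem theorem2p2 (R : realType) (T lambda : R) (k L : nat)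
    (T_gt0 : 0 < T) (lambda_gt0 : 0 < lambda) (k_gt0 : (1 <= k)%N)
    (k_le_L : (k <= L)%N)
    (d : nat -> measure_display) (Omega : forall n, measurableType (d n))
    (P : forall n, probability (Omega n) R)
    (X : forall n, R -> Omega n -> nat -> R)
    (init : nat -> nat -> R) (pi0 : nat -> R)
    (X_chain : forall n, (L <= n)%N ->
       markov_chain (P n) (simplex_n n) (generator k L lambda n) (init n) (X n))
    (pi0_simplex : simplex pi0)
    (init_cvg : d0 (init n) pi0 @[n --> \oo] --> (0 : R)) :
  exists x : R -> nat -> R,
    [/\ ode_solution k L lambda T pi0 x,
        forall y, ode_solution k L lambda T pi0 y ->
          forall t : R, 0 <= t <= T -> y t = x t &
        forall e : R, 0 < e ->
          ((P n)^*%mu [set w | e <= skorohod T (fun t => X n t w) x])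
            @[n --> \oo] --> (0 : \bar R)%E].
Proof.
have lambda_ge0 := ltW lambda_gt0; have T_ge0 := ltW T_gt0.
have [x [x0 xS xode xd]] := ode_exists k L lambda_ge0 T_ge0 pi0_simplex.
have xcd := has_drift_of_l1 xd.
exists x; split => //; first by move=> y; exact: ode_unique.
move=> e e0.
pose K := Fcst k L lambda.
have K0 : 0 <= K by exact: Fcst_ge0.
pose bad n : set (Omega n) := [set w | e <= skorohod T (fun t => X n t w) x].
(* A probability space is nonempty, and any sample point exhibits [init n] as a state of the
   chain. *)
have init_simplex n : (L <= n)%N -> simplex (init n).
  move=> /X_chain[X0 XE _ _ _].
  have [w _] : [set: Omega n] !=set0.
    apply/set0P/negP => /eqP T0; have := probability_setT (P n).
    by rewrite T0 measure0 => /eqP; rewrite eq_sym onee_eq0.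
  by rewrite -(X0 w); have [] := XE 0 w (lexx _).
(* With [2 * 2 ^- J0 < e / 4], the bound [4 * a + 2 * 2 ^- J0] of [d0_le_gap] stays below
   [e / 2]. *)
pose a := e / 16.
have a0 : 0 < a by rewrite divr_gt0.
have [J0 _ /(_ J0 (leqnn _))] := (cvgrPdist_lt _ _).1 (half_pow_cvg 2) _ (divr_gt0 e0 (ltr0n R 4)).
rewrite sub0r normrN => /(le_lt_trans (ler_norm _)) J0e.
pose ep := 2 ^- J0 * a ^+ 2.
have ep0 : 0 < ep by rewrite mulr_gt0 ?half_pow_gt0// exprn_gt0.
have bad_exit n J : (L <= n)%N -> (J0 < J)%N ->
    bad n `<=` [set w | exists2 t : R, 0 <= t <= T & ep < fluct (X n) x J t w].
  move=> Ln J0J w /= bw; apply: contrapT => nw.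
  have : skorohod T (fun t => X n t w) x <= e / 2.
    apply: skorohod_le_sup => //; first by rewrite divr_ge0// ltW.
    move=> t tT; have [_ XE _ _ _] := X_chain n Ln.
    have XtS : simplex (X n t w) by have /andP[t0 _] := tT; have [] := XE t w t0.
    have g : gap J (cumul (X n t w)) (cumul (x t)) <= ep.
      by rewrite leNgt; apply/negP => gt; apply: nw; exists t.
    apply: le_trans (d0_le_gap XtS (xS t tT) (ltW a0) J0J g) _.
    by move: J0e; rewrite /a; move: (2 ^- J0) => z; lra.
  by move=> h; have := le_trans bw h; lra.
apply/fine_cvgP; split.
  apply: nearW => n; rewrite ge0_fin_numE; last exact: mu_ext_ge0.
  apply: (@le_lt_trans _ _ ((P n)^*%mu setT)); first exact: le_mu_ext.
  rewrite measurable_mu_extE; last exact: measurableT.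
  by apply: le_lt_trans (probability_le1 (P n) measurableT) _; rewrite ltry.
apply/cvgrPdist_le => eta eta0.
pose Q := expR (T * (7 * K)).
(* [J] is chosen once the threshold [ep] is fixed and before [n]: the surviving boundary term,
   divided by [ep], must be below [eta]. *)
have [J' _ hJ'] := (cvgrPdist_lt _ _).1 (half_pow_cvg (Q * (T * (2 * K)) / ep)) _ eta0.
pose J := maxn J' J0.+1.
have J0J : (J0 < J)%N by exact: leq_maxr.
have := hJ' J (leq_maxl _ _); rewrite /= sub0r normrN => /(le_lt_trans (ler_norm _)) hJ.
pose b n := exit_bound k L lambda T n (init n) x J ep.
have bc : b n @[n --> \oo] --> Q * (0 + T * (2 * K * 2 ^- J + 0)) / ep.
  apply: cvgM; last exact: cvg_cst.
  apply: cvgM; first exact: cvg_cst.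
  apply: cvgD.
    rewrite x0; apply: gap_cvg => //; near=> n; apply: init_simplex.
    by near: n; exact: nbhs_infty_ge.
  apply: cvgM; first exact: cvg_cst.
  apply: cvgD; first exact: cvg_cst.
  rewrite -(cvg_shiftn 1); under eq_fun do rewrite addn1.
  exact: inv_nat_cvg.
have bl : Q * (0 + T * (2 * K * 2 ^- J + 0)) / ep < eta.
  rewrite (_ : _ / ep = Q * (T * (2 * K)) / ep * 2 ^- J)//.
  by field; rewrite expf_neq0//= gt_eqF.
have near_b : \forall n \near \oo, b n < eta by apply: cvgr_lt bc _ bl.
near=> n.
have nL : (L <= n)%N by near: n; exact: nbhs_infty_ge.
have n2 : (2 * (L * L) <= n)%N by near: n; exact: nbhs_infty_ge.
have n0 : (0 < n)%N by rewrite (leq_trans _ nL)// (leq_trans k_gt0).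
have bn : b n < eta by near: n.
rewrite sub0r normrN ger0_norm; last by apply: fine_ge0; exact: mu_ext_ge0.
have ex := exit_probability lambda_ge0 T_ge0 k_gt0 k_le_L n0 n2 nL (X_chain n nL) xS xcd J ep0.
have le : ((P n)^*%mu (bad n) <= (b n)%:E)%E.
  by apply: le_trans ex; apply: le_mu_ext; exact: bad_exit.
apply: le_trans (ltW bn); rewrite -lee_fin fineK//.
rewrite ge0_fin_numE; last exact: mu_ext_ge0.
exact: le_lt_trans le (ltry _).
Unshelve. all: by end_near. Qed.
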